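(* Let $k\ge 3$ and $m\ge 5$ be integers. Among all linear unicyclic $k$-uniform hypergraphs with $m$ edges, $T^k_{m,1}$ is (up to isomorphism) the unique hypergraph with the second largest spectral radius. That is, a linear unicyclic $k$-uniform hypergraph $G$ with $m$ edges has $\rho(G)$ equal to the second largest element of the set $\{\rho(H): H \text{ is a linear unicyclic } k\text{-uniform hypergraph with } m \text{ edges}\}$ if and only if $G\cong T^k_{m,1}$.
   Context: A hypergraph $G=(V,E)$ has a finite nonempty vertex set $V$ and a set $E$ of edges, each edge being a subset of $V$; it is $k$-uniform if every edge has exactly $k$ vertices. It is linear if any two distinct edges share at most one vertex. A walk of length $l$ is an alternating sequence $v_0e_1v_1e_2\cdots e_lv_l$ of vertices and edges with $\{v_{i},v_{i+1}\}\subseteq e_{i+1}$ for $i=0,\ldots,l-1$. A cycle is a walk with $v_0=v_l$, $l\ge 2$, in which no vertices or edges are repeated except $v_0=v_l$; cycles are counted up to choice of starting point and direction. $G$ is connected if every two vertices are joined by a walk. $G$ is unicyclic if it is connected and contains exactly one cycle. Spectral radius: for a $k$-uniform hypergraph $G$ on vertex set $[n]$, the adjacency tensor $\mathcal{A}(G)=(a_{i_1\cdots i_k})$ is the order $k$, dimension $n$ tensor with $a_{i_1\cdots i_k}=\frac{1}{(k-1)!}$ if $\{i_1,\ldots,i_k\}\in E(G)$ and $0$ otherwise. A number $\lambda\in\mathbb{C}$ is an eigenvalue of a tensor $\mathcal{T}=(t_{i_1\cdots i_k})$ if there is a nonzero $x\in\mathbb{C}^n$ with $\sum_{i_2,\ldots,i_k\in[n]}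 t_{i i_2\cdots i_k}x_{i_2}\cdots x_{i_k}=\lambda x_i^{k-1}$ for all $i\in[n]$. The spectral radius $\rho(G)$ is the maximum modulus of the eigenvalues of $\mathcal{A}(G)$. Power: for a simple graph $\Gamma=(V,E)$ and $k\ge3$, the $k$-th power $\Gamma^k$ is the $k$-uniform hypergraph obtained by adding to each edge $e\in E$ a set of $k-2$ new vertices $i_{e,1},\ldots,i_{e,k-2}$ (distinct for distinct edges); its vertex set is $V\cup\{i_{e,j}\}$ and its edges are $e\cup\{i_{e,1},\ldots,i_{e,k-2}\}$, $e\in E$. Graphs: $S_{m,3}$ is the simple graph with $m$ edges obtained from a triangle $C_3$ by attaching $m-3$ pendent edges at one vertex of the triangle (i.e. identifying the center of a star $K_{1,m-3}$ with that vertex). $T_{m,1}$ is the simple graph with $m$ edges obtained from $S_{m-1,3}$ by attaching one pendent edge at a vertex of degree $2$. $T^k_{m,1}$ denotes the $k$-th power of $T_{m,1}$. *)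

(* Defs.v *)
From HB Require Import structures.
From mathcomp Require Import all_boot all_order all_algebra.
From mathcomp Require Import all_classical all_reals.
From mathcomp Require Import complex.

Set Implicit Arguments.
Unset Strict Implicit.
Unset Printing Implicit Defensive.

Import Order.TTheory GRing.Theory Num.Theory.

Local Open Scope ring_scope.
Local Open Scope classical_set_scope.
Local Open Scope set_scope.

Record hypergraph := Hypergraph {
  vertex :> finType;
  vertex_gt0 : (0 < #|vertex|)%N;
  edges : {set {set vertex}}
}.

Definition uniform (k : nat) (G : hypergraph) : Prop :=
  forall e : {set G}, e \in edges G -> #|e| = k.

Definition linear_hypergraph (G : hypergraph) : Prop :=
  forall e f : {set G}, e \in edges G -> f \in edges G -> e != f ->
    (#|e :&: f| <= 1)%N.

Definition isomorphic (G H : hypergraph) : Prop :=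
  exists2 f : G -> H, bijective f &
    forall e : {set G}, (e \in edges G) = (f @: e \in edges H).

Section Walks.
Variable G : hypergraph.

(* The walk v_0 e_1 v_1 ... e_l v_l is represented by its initial vertex v_0
   and the sequence of steps (e_1, v_1), ..., (e_l, v_l). *)
Definition step : Type := ({set G} * G)%type.

Fixpoint walk (v : G) (s : seq step) : bool :=
  if s is (e, w) :: s' then
    [&& e \in edges G, [set v; w] \subset e & walk w s']
  else true.

Definition walk_end (v : G) (s : seq step) : G := last v (unzip2 s).

(* v_l e_l v_(l-1) ... e_1 v_0 has steps (e_l, v_(l-1)), ..., (e_1, v_0). *)
Definition rev_steps (v : G) (s : seq step) : seq step :=
  zip (rev (unzip1 s)) (rev (belast v (unzip2 s))).

Definition hypergraph_connected : Prop :=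
  forall u v : G, exists2 s, walk u s & walk_end u s = v.

(* As v_0 = v_l, uniqueness of v_1, ..., v_l says that v_0 = v_l is the only
   repetition among the vertices. *)
Definition is_cycle (v : G) (s : seq step) : Prop :=
  [/\ walk v s, walk_end v s = v, (2 <= size s)%N,
      uniq (unzip1 s) & uniq (unzip2 s)].

(* Same cycle up to starting point and direction; the initial vertex of the
   second cycle is the last one of its steps, so it need not be mentioned. *)
Definition same_cycle (v : G) (s t : seq step) : Prop :=
  exists i : nat, t = rot i s \/ t = rot i (rev_steps v s).

Definition unicyclic : Prop :=
  hypergraph_connected /\
  exists v s, is_cycle v s /\ forall w t, is_cycle w t -> same_cycle v s t.

End Walks.

Section Tensors.
Variables (C : fieldType) (V : finType) (r : nat).

(* A tensor of order r.+1 and dimension #|V|, with indices in V. *)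
Definition tensor : Type := {ffun r.+1.-tuple V -> C}.

Definition tensor_eigenvalue (T : tensor) (lambda : C) : Prop :=
  exists2 x : {ffun V -> C}, x != 0 &
    forall i : V,
      \sum_(t : r.-tuple V) T [tuple of i :: t] * \prod_(j <- t) x j
      = lambda * x i ^+ r.

End Tensors.

Definition adjacency_tensor (C : fieldType) (k : nat) (G : hypergraph) :
    tensor C G k.-1 :=
  [ffun t : k.-1.+1.-tuple G =>
    if [set v in t] \in edges G then ((k.-1)`!%:R)^-1 else 0].

Definition is_maximum (R : realType) (A : set R) (x : R) : Prop :=
  A x /\ ubound A x.

Definition is_second_maximum (R : realType) (A : set R) (x : R) : Prop :=
  exists2 y, is_maximum A y & is_maximum (A `\ y)%classic x.

Definition eigenvalue_moduli (R : realType) (k : nat) (G : hypergraph) :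
    set R :=
  [set r | exists2 lambda : R[i],
             tensor_eigenvalue (adjacency_tensor R[i] k G) lambda &
             r = ComplexField.Normc.normc lambda]%classic.

(* eigenvalue_moduli has a maximum, so the default value 0 is not used. *)
Definition spectral_radius (R : realType) (k : nat) (G : hypergraph) : R :=
  xget 0 [set r | is_maximum (@eigenvalue_moduli R k G) r]%classic.

Section Power.
Variables (G : hypergraph) (k : nat).

Definition power_vertex : finType :=
  (G + {e : {set G} | e \in edges G} * 'I_(k - 2))%type.

Lemma power_vertex_gt0 : (0 < #|power_vertex|)%N.
Proof. by rewrite card_sum addn_gt0 vertex_gt0. Qed.

(* For a simple graph G, seen as a 2-uniform hypergraph. *)
Definition power : hypergraph :=
  Hypergraph power_vertex_gt0
    [set ([set inl v | v in val e] :|: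
          [set inr (e, j) | j : 'I_(k - 2)] : {set power_vertex})
       | e : {e : {set G} | e \in edges G}].

End Power.

Section AttachPendents.
Variables (G : hypergraph) (v : G) (p : nat).

Lemma attach_vertex_gt0 : (0 < #|{: G + 'I_p}|)%N.
Proof. by rewrite card_sum addn_gt0 vertex_gt0. Qed.

(* p pendent edges attached at the vertex v, with new ends inr i. *)
Definition attach_pendents : hypergraph :=
  Hypergraph attach_vertex_gt0
    ([set ([set inl u | u in e] : {set G + 'I_p}) | e : {set G} in edges G] :|:
     [set ([set inl v; inr i] : {set G + 'I_p}) | i : 'I_p]).

End AttachPendents.

Lemma ord3_gt0 : (0 < #|'I_3|)%N.
Proof. by rewrite card_ord. Qed.

Definition triangle : hypergraph :=
  Hypergraph ord3_gt0 [set e : {set 'I_3} | #|e| == 2%N].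

Definition S3 (m : nat) : hypergraph :=
  attach_pendents (ord0 : triangle) (m - 3).

(* For m >= 5, the vertex inl 1 of S3 m.-1 is one of the two triangle vertices
   other than the center; they have degree 2 and are exchanged by an
   automorphism, and all other vertices have degree different from 2. *)
Definition T1 (m : nat) : hypergraph :=
  attach_pendents (inl (inord 1 : 'I_3) : S3 m.-1) 1.

Definition linear_unicyclic (k m : nat) (G : hypergraph) : Prop :=
  [/\ linear_hypergraph G, unicyclic G, uniform k G & #|edges G| = m].

Definition linear_unicyclic_radii (R : realType) (k m : nat) : set R :=
  [set r | exists2 H : hypergraph,
             linear_unicyclic k m H & r = spectral_radius R k H]%classic.
Arguments linear_unicyclic_radii : clear implicits.

(* Main.v *)
Require Import Defs.
From mathcomp Require Import all_boot all_order all_algebra.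
From mathcomp Require Import all_classical all_reals.
From mathcomp Require Import topology normedtype realfun derive exp.
From mathcomp Require Import complex lra ring zify fintype finset.
Set Implicit Arguments.
Unset Strict Implicit.
Unset Printing Implicit Defensive.
Import Order.TTheory GRing.Theory Num.Theory.
Import numFieldNormedType.Exports.
Local Open Scope ring_scope.
Local Open Scope set_scope.

(** The spectral radius of a k-uniform hypergraph [G] is the maximum of [k * F x]
    over the nonnegative [x] with [\sum_v x v ^+ k = 1], where [F x] is the sum
    over the edges of the products of the entries of [x]
    ([spectral_radius_variational]).  So hypergraphs are compared by comparing
    the values of their forms at a single vector.

    Let [G] be linear unicyclic with [m = n + 4] edges, [x] a maximiser and [u] a
    vertex at which [x] is largest.  Reveal the edges one by one from [u], those
    through [u] first, each meeting the earlier ones.  As [G] has exactly one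
    cycle, each edge meets the earlier ones in a single vertex, its parent, except
    one closing edge, which meets them in two ([unicyclic_decomposition]).  In the
    product of an edge the parent can now be exchanged for any other vertex, and
    exchanging it for [u] does not decrease [F x].  If only the closing edge
    avoids [u], then [G] is the power of [S3 m] ([star_recognition]).  Otherwise
    one further edge [g] is kept off [u], all others are hung at [u], and a few
    more exchanges that do not decrease the form lead to the shape of the power of
    [T1 m] ([kept_edge_off_triangle], [kept_edge_quadrangle]).  In one
    configuration, a triangle that meets the star of [u] in a single edge, no such
    exchange is available and the form is bounded directly
    ([far_triangle_bound]).

    Let [lam] be the largest adjacency eigenvalue of the graph [T1 m] and
    [rho = lam `^ (2 / k)].  A form of the shape of the power of [T1 m] is at most
    [rho / k] times the mass, by the weighted AM-GM inequality on each edge with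
    weights read off the eigenvector of the graph; equality makes all entries of a
    nonzero [x] positive and the entry of the second centre larger than all others
    but that of [u] ([bull_bound]).  Therefore, if the radius of [G] is at least
    [rho], every exchange was the identity and [G] is the power of [T1 m]
    ([classify_bull], [bull_recognition]).

    Conversely, test vectors built from vectors on the graphs show that the power
    of [T1 m] has radius at least [rho] and that of [S3 m] more than [rho]
    ([power_radius_ge]).  No vertex of the power of [T1 m] lies on all edges but
    one, so its radius is exactly [rho], while every other hypergraph of the family
    but the power of [S3 m] stays below [rho]. *)

(** * The spectral radius as a constrained maximum *)

(** Such a tuple is an enumeration of the [n] elements of [e :\ i], so there are
    [n`!] of them and all have the same product; this is why the entries of the
    adjacency tensor carry an inverse factorial. *)
Lemma sum_tuples_spanning (C : numFieldType) (V : finType) (n : nat)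
    (x : V -> C) (e : {set V}) (i : V) : i \in e -> #|e| = n.+1 ->
  \sum_(t : n.-tuple V | [set v in i :: t] == e) \prod_(j <- t) x j =
  n`!%:R * \prod_(v in e :\ i) x v.
Proof.
move=> ie ce.
have ce' : #|e :\ i| = n by move: (cardsD1 i e); rewrite ie ce => -[].
have spanE (t : n.-tuple V) :
    ([set v in i :: t] == e) = all [in e :\ i] t && uniq t.
  apply/eqP/andP => [te|[/allP te ut]].
    have ut : uniq (i :: t).
      by apply/card_uniqP; rewrite /= size_tuple -ce -te cardsE.
    split; last by case/andP: ut.
    apply/allP => v vt; rewrite !inE -te inE in_cons vt orbT andbT.
    by apply: contraTneq vt => ->; case/andP: ut.
  have tE : [set v in t] = e :\ i.
    apply/eqP; rewrite eqEcard ce' cardsE (card_uniqP ut) size_tuple leqnn andbT.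
    by apply/subsetP => v; rewrite inE => /te.
  rewrite -(setD1K ie) -tE; apply/setP => v; rewrite !inE; by case: eqP.
pose P := \prod_(v in e :\ i) x v.
have prodE (t : n.-tuple V) : [set v in i :: t] == e -> \prod_(j <- t) x j = P.
  move=> /[dup] tie /eqP te; move: tie; rewrite spanE => /andP[/allP ta ut].
  rewrite big_uniq //=; apply: eq_bigl => v; apply/idP/idP => [/ta //|].
  by rewrite !inE -te inE in_cons; case: eqP.
rewrite (eq_bigr _ prodE) (eq_bigl _ _ spanE) -/P mulr_natl.
rewrite -[n in n`!]ce' -ffactnn {2}ce' -card_uniq_tuples -sumr_const.
by apply: eq_bigl => t; rewrite inE.
Qed.

Lemma adjacency_action (C : numFieldType) (k : nat) (G : hypergraph)
    (x : G -> C) (i : G) : (0 < k)%N -> uniform k G ->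
  \sum_(t : k.-1.-tuple G)
     adjacency_tensor C k G [tuple of i :: t] * \prod_(j <- t) x j =
  \sum_(e in edges G | i \in e) \prod_(v in e :\ i) x v.
Proof.
case: k => // k _ unif.
transitivity (\sum_(t : k.-tuple G | [set v in i :: t] \in edges G)
    (k`!%:R)^-1 * \prod_(j <- t) x j).
  rewrite [RHS]big_mkcond; apply: eq_bigr => t _.
  by rewrite ffunE; case: ifP => //; rewrite mul0r.
rewrite -big_distrr /=.
rewrite (partition_big (fun t : k.-tuple G => [set v in i :: t])
  (fun e => (e \in edges G) && (i \in e))); last first.
  by move=> t ->; rewrite !inE eqxx.
rewrite big_distrr; apply: eq_bigr => e /andP[eE ie].
transitivity ((k`!%:R)^-1 *
    \sum_(t : k.-tuple G | [set v in i :: t] == e) \prod_(j <- t) x j : C).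
  congr (_ * _); apply: eq_bigl => t.
  by case: eqP => [->|]; rewrite ?eE ?andbF.
rewrite sum_tuples_spanning //; last exact: unif.
by rewrite mulrA mulVf ?mul1r // pnatr_eq0 -lt0n fact_gt0.
Qed.

Definition mass (R : realType) (V : finType) (k : nat) (x : V -> R) : R :=
  \sum_v x v ^+ k.

Definition edge_form (R : realType) (G : hypergraph) (x : G -> R) : R :=
  \sum_(e in edges G) \prod_(v in e) x v.

(** The nonnegative vectors of mass 1 form a compact subset of the unit cube. *)
Lemma edge_form_attains_max (R : realType) (k : nat) (G : hypergraph) :
  (0 < k)%N ->
  exists x : G -> R, [/\ forall v, 0 <= x v, mass k x = 1 &
    forall y : G -> R, (forall v, 0 <= y v) -> mass k y = 1 ->
      edge_form y <= edge_form x].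
Proof.
move=> k_gt0.
pose vec (M : 'rV[R]_#|G|) (v : G) := M ord0 (enum_rank v).
have vec_cont v : continuous (vec^~ v) by exact: coord_continuous.
have form_cont : continuous (fun M => edge_form (vec M)).
  apply: continuous_big => [|e _]; first exact: add_continuous.
  by apply: continuous_big => [|v _]; [exact: mul_continuous|exact: vec_cont].
have mass_cont : continuous (fun M => mass k (vec M)).
  apply: continuous_big => [|v _]; first exact: add_continuous.
  by move=> M; apply: (@continuous_comp _ _ _ (vec^~ v) (fun t => t ^+ k)); [exact: vec_cont|exact: exprn_continuous].
pose cube := [set M : 'rV[R]_#|G| | forall i, `[0, 1]%classic (M ord0 i)]%classic.
pose A := (cube `&` [set M | mass k (vec M) = 1])%classic.
have cA : compact A.
  apply: compact_closedI; first exact: (rV_compact (fun=> @segment_compact R 0 1)).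
  rewrite (_ : [set M | _]%classic = (fun M => mass k (vec M)) @^-1` [set 1])%classic //.
  apply: preimage_closed; last exact: closed_eq.
  by move=> M _; exact: mass_cont.
have vec_ofK (y : G -> R) : vec (\row_i y (enum_val i)) = y.
  by apply/funext => v; rewrite /vec mxE enum_rankK.
have of_vec (y : G -> R) : (forall v, 0 <= y v) -> mass k y = 1 ->
    A (\row_i y (enum_val i))%R.
  move=> y0 y1; split; last by rewrite /= vec_ofK.
  move=> i; rewrite /= mxE in_itv /= y0 /= leNgt; apply/negP => y_gt1.
  have : mass k y <= 1 by rewrite y1.
  rewrite leNgt => /negP; apply; rewrite /mass (bigD1 (enum_val i)) //=.
  rewrite ltr_wpDr ?sumr_ge0 // => [v _|]; first by rewrite exprn_ge0.
  by rewrite exprn_egt1 -?lt0n ?gt_eqF.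
have A0 : (A !=set0)%classic.
  have /card_gt0P[v0 _] := vertex_gt0 G.
  exists (\row_i (enum_val i == v0)%:R); apply: (of_vec (fun v => (v == v0)%:R)) => [v|].
    by rewrite ler0n.
  rewrite /mass (bigD1 v0) //= eqxx expr1n big1 ?addr0 // => v /negPf ->.
  by rewrite expr0n gtn_eqF.
have [M MA maxM] := EVT_max_rV A0 cA (continuous_subspaceT form_cont).
have {MA} [cubeM massM] : A M by exact: set_mem.
exists (vec M); split => // [v|y y0 y1].
  by have := cubeM (enum_rank v); rewrite /= in_itv /= => /andP[].
by have := maxM (\row_i y (enum_val i)); rewrite vec_ofK; apply; apply: mem_set; exact: of_vec.
Qed.

Lemma edge_form_ge0 (R : realType) (G : hypergraph) (x : G -> R) :
  (forall v, 0 <= x v) -> 0 <= edge_form x.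
Proof. by move=> x0; apply: sumr_ge0 => e _; exact: prodr_ge0. Qed.

Lemma mass_gt0 (R : realType) (V : finType) k (x : V -> R) v :
  (forall v, 0 <= x v) -> 0 < x v -> 0 < mass k x.
Proof.
move=> x0 xv; rewrite /mass (bigD1 v) //= ltr_wpDr ?exprn_gt0 //.
by apply: sumr_ge0 => w _; rewrite exprn_ge0.
Qed.

Lemma edge_form_scale (R : realType) k (G : hypergraph) (c : R) (x : G -> R) :
  uniform k G -> edge_form (fun v => c * x v) = c ^+ k * edge_form x.
Proof.
move=> unif; rewrite big_distrr; apply: eq_bigr => e eE.
by rewrite /= big_split /= prodr_const unif.
Qed.

(** Both sides are homogeneous of degree [k]; this removes the constraint on the
    mass. *)
Lemma edge_form_le_max (R : realType) (k : nat) (G : hypergraph) (x : G -> R) :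
  (0 < k)%N -> uniform k G ->
  (forall y : G -> R, (forall v, 0 <= y v) -> mass k y = 1 ->
      edge_form y <= edge_form x) ->
  forall y : G -> R, (forall v, 0 <= y v) ->
    edge_form y <= edge_form x * mass k y.
Proof.
move=> k_gt0 unif maxx y y0.
have [/existsP[v yv]|] := boolP [exists v, y v != 0]; last first.
  rewrite negb_exists => /forallP ynull.
  have yE v : y v = 0 by apply/eqP; have := ynull v; rewrite negbK.
  rewrite [mass k y]big1 ?mulr0 => [|v _]; last by rewrite yE expr0n gtn_eqF.
  rewrite [edge_form y]big1 // => e eE.
  have /card_gt0P[v ve] : (0 < #|e|)%N by rewrite unif.
  by rewrite (bigD1 v) //= yE mul0r.
have my : 0 < mass k y by apply: (@mass_gt0 _ _ _ _ v) => //; rewrite lt_def yv y0.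
pose c := (mass k y) `^ (- (k%:R)^-1).
have ck : c ^+ k = (mass k y)^-1.
  rewrite -powR_mulrn ?powR_ge0 // -powRrM mulNr mulVf ?powRN ?powRr1 ?ltW //.
  by rewrite pnatr_eq0 -lt0n.
have := maxx (fun v => c * y v); rewrite (edge_form_scale _ _ unif) ck.
rewrite -ler_pdivrMr // mulrC; apply => [v'|]; first by rewrite mulr_ge0 ?powR_ge0.
rewrite /mass; under eq_bigr do rewrite exprMn.
by rewrite -big_distrr /= ck mulVf // gt_eqF.
Qed.

(** First-order condition for a form that is affine in one coordinate.  Away
    from 0 the derivative vanishes; at 0 only one side is available, and the
    vanishing of [A] comes from [t ^+ k] being of smaller order than [t]. *)
Lemma critical_point (R : realType) (k : nat) (A B M c s : R) :
  (1 < k)%N -> 0 <= A -> 0 <= c -> 0 <= s ->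
  (forall t, 0 <= t -> t * A + B <= c * (t ^+ k + M)) ->
  s * A + B = c * (s ^+ k + M) ->
  A = k%:R * c * s ^+ k.-1.
Proof.
move=> k_gt1 A0 c0; rewrite le_eqVlt => /orP[/eqP <-|s_gt0] le_t eq_s.
  rewrite expr0n -subn1 subn_eq0 leqNgt k_gt1 mulr0.
  move: eq_s; rewrite mul0r add0r expr0n gtn_eqF ?add0r ?(ltnW k_gt1) // => BE.
  apply/eqP; rewrite eq_le A0 andbT leNgt; apply/negP => A_gt0.
  (* For t <= 1 the bound t ^+ k <= t ^+ 2 suffices. *)
  have {}le_t t : 0 < t -> t <= 1 -> A <= c * t.
    move=> t0 t1; have := le_t t (ltW t0); rewrite BE mulrDr lerD2r mulrC.
    rewrite -ler_pdivlMr // -mulrA => /le_trans; apply; apply: ler_wpM2l => //.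
    rewrite ler_pdivrMr // -expr2; apply: ler_wiXn2l => //; exact: ltW.
  pose t := Order.min 1 (A / (c + 1)).
  have c1 : 0 < c + 1 by rewrite ltr_wpDl.
  have t0 : 0 < t by rewrite lt_min ltr01 divr_gt0.
  have := le_t t t0; rewrite ge_min lexx => /(_ isT).
  rewrite leNgt => /negP; apply; rewrite (@le_lt_trans _ _ (c * (A / (c + 1)))) //.
    by apply: ler_wpM2l => //; rewrite ge_min lexx orbT.
  by rewrite mulrA ltr_pdivrMr // mulrC ltr_pM2l // ltrDl.
pose f : R -> R := A *: (id : R -> R) + cst B - c *: ((id : R -> R) ^+ k + cst M).
have fE t : f t = t * A + B - c * (t ^+ k + M) by rewrite /f !fctE /GRing.scale /= mulrC.
have df t : is_derive t (1 : R) f (A - k%:R * c * t ^+ k.-1).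
  by rewrite /f; apply: is_derive_eq; rewrite /GRing.scale /=; ring.
have : is_derive s (1 : R) f 0.
  apply: (@derive1_at_max _ f 0 (s + 1)) => // [||t].
  - by rewrite ltW // addr_gt0.
  - by rewrite in_itv /= s_gt0 ltrDl ltr01.
  by rewrite in_itv /= => /andP[/ltW t0 _]; rewrite !fE eq_s subrr subr_le0 le_t.
move=> [_]; have [_ ->] := df s => /eqP; rewrite subr_eq0 => /eqP //.
Qed.

Lemma sum_edges_through (R : realType) (k : nat) (G : hypergraph) (x : G -> R) :
  uniform k G ->
  \sum_i \sum_(e in edges G | i \in e) \prod_(v in e) x v = k%:R * edge_form x.
Proof.
move=> unif; rewrite (exchange_big_dep (mem (edges G))) => [|i e _ /andP[]] //=.
rewrite big_distrr; apply: eq_bigr => e eE /=.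
rewrite eE /= sumr_const unif // mulr_natl //.
Qed.

Lemma sum_edges_through_split (C : numFieldType) (G : hypergraph) (x : G -> C) i :
  \sum_(e in edges G | i \in e) \prod_(v in e) x v =
  x i * \sum_(e in edges G | i \in e) \prod_(v in e :\ i) x v.
Proof.
rewrite big_distrr; apply: eq_bigr => e /andP[_ ie].
by rewrite /= (big_setD1 i).
Qed.

(** Lagrange condition, obtained by varying one coordinate at a time.  It holds at
    the vanishing coordinates too, which makes the maximiser an eigenvector. *)
Lemma maximizer_eigenvector (R : realType) (k : nat) (G : hypergraph) (x : G -> R) :
  (1 < k)%N -> (forall v, 0 <= x v) -> mass k x = 1 ->
  (forall y : G -> R, (forall v, 0 <= y v) ->
    edge_form y <= edge_form x * mass k y) ->
  forall i, \sum_(e in edges G | i \in e) \prod_(v in e :\ i) x v =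
            k%:R * edge_form x * x i ^+ k.-1.
Proof.
move=> k1 x0 m1 maxx i.
pose upd t v := if v == i then t else x v.
have formE t : edge_form (upd t) =
    t * (\sum_(e in edges G | i \in e) \prod_(v in e :\ i) x v) +
    \sum_(e in edges G | i \notin e) \prod_(v in e) x v.
  rewrite /edge_form (bigID (fun e : {set G} => i \in e)) /=; congr (_ + _).
    rewrite big_distrr; apply: eq_bigr => e /andP[_ ie].
    rewrite (big_setD1 i) //= {1}/upd eqxx; congr (_ * _).
    by apply: eq_bigr => v; rewrite !inE /upd => /andP[/negPf ->].
  apply: eq_bigr => e /andP[_ ie]; apply: eq_bigr => v ve.
  by rewrite /upd; case: eqP => // vi; rewrite -vi ve in ie.
have massE t : mass k (upd t) = t ^+ k + \sum_(v | v != i) x v ^+ k.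
  rewrite /mass (bigD1 i) //= {1}/upd eqxx; congr (_ + _).
  by apply: eq_bigr => v /negPf vi; rewrite /upd vi.
have updi : upd (x i) = x by apply/funext => v; rewrite /upd; case: eqP => // ->.
apply: (@critical_point _ _ _ (\sum_(e in edges G | i \notin e) \prod_(v in e) x v)
  (\sum_(v | v != i) x v ^+ k)) => //; first by apply: sumr_ge0 => e _; exact: prodr_ge0.
- exact: edge_form_ge0.
- move=> t t0; rewrite -formE -massE; apply: maxx => v.
  by rewrite /upd; case: ifP.
by rewrite -formE -massE updi m1 mulr1.
Qed.

Section NormC.
Import ComplexField.Normc.
Variable R : realType.

Lemma normc_ge0 (z : R[i]) : 0 <= normc z.
Proof. by case: z => a b; rewrite sqrtr_ge0. Qed.

Lemma normc_prod (I : finType) (P : pred I) (F : I -> R[i]) :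
  normc (\prod_(i | P i) F i) = \prod_(i | P i) normc (F i).
Proof. by apply: (big_morph _ (@normcM R)); rewrite /= expr1n expr0n addr0 sqrtr1. Qed.

Lemma normc_sum_le (I : finType) (P : pred I) (F : I -> R[i]) :
  normc (\sum_(i | P i) F i) <= \sum_(i | P i) normc (F i).
Proof.
apply: (big_ind2 (fun a b => normc a <= b)) => //.
  by rewrite /= expr0n addr0 sqrtr0.
by move=> a b c d ab cd; apply: le_trans (lerD ab cd); exact: le_normcD.
Qed.

Lemma normcX (z : R[i]) n : normc (z ^+ n) = normc z ^+ n.
Proof.
elim: n => [|n IHn]; first by rewrite /= expr1n expr0n addr0 sqrtr1.
by rewrite !exprS normcM IHn.
Qed.

Lemma normc_real (a : R) : 0 <= a -> normc (a%:C)%C = a.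
Proof. by move=> a0; rewrite /= expr0n addr0 sqrtr_sqr ger0_norm. Qed.

(** The maximum is an eigenvalue by the Lagrange condition.  It bounds any other
    eigenvalue [lam]: take moduli in the equations of an eigenvector [z], multiply
    the one at [i] by the modulus of [z i] and add them up. *)
Lemma spectral_radius_variational (k : nat) (G : hypergraph) :
  (1 < k)%N -> uniform k G ->
  exists x : G -> R, [/\ forall v, 0 <= x v, mass k x = 1,
    spectral_radius R k G = k%:R * edge_form x,
    forall y : G -> R, (forall v, 0 <= y v) ->
      k%:R * edge_form y <= spectral_radius R k G * mass k y &
    forall i, \sum_(e in edges G | i \in e) \prod_(v in e) x v =
              spectral_radius R k G * x i ^+ k].
Proof.
move=> k1 unif; have k0 := ltnW k1.
have [x [x0 m1 /(edge_form_le_max k0 unif) maxx]] := edge_form_attains_max R G k0.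
have eigx := maximizer_eigenvector k1 x0 m1 maxx.
pose rho := k%:R * edge_form x.
have rho0 : 0 <= rho by rewrite mulr_ge0 ?ler0n ?edge_form_ge0.
have maxx' (y : G -> R) : (forall v, 0 <= y v) ->
    k%:R * edge_form y <= rho * mass k y.
  by move=> y0; rewrite -mulrA ler_wpM2l ?ler0n // maxx.
have max_rho : is_maximum (@eigenvalue_moduli R k G) rho.
  split.
    exists (rho%:C)%C; last by rewrite normc_real.
    exists [ffun v => (x v)%:C]%C.
      apply/eqP => /ffunP xnull.
      move: m1; rewrite /mass big1 => [/esym/eqP|v _]; first by rewrite oner_eq0.
      by have := xnull v; rewrite !ffunE => -[->]; rewrite expr0n gtn_eqF.
    move=> i; rewrite adjacency_action // ffunE -rmorphXn -rmorphM -eigx rmorph_sum.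
    apply: eq_bigr => e _; rewrite rmorph_prod; apply: eq_bigr => v _.
    by rewrite ffunE.
  move=> _ [lam [z z_neq0 eigz] ->].
  pose y v := normc (z v); have y0 v : 0 <= y v by exact: normc_ge0.
  have my : 0 < mass k y.
    have [v zv] : exists v, z v != 0.
      apply/existsP; apply: contraNT z_neq0; rewrite negb_exists => /forallP znull.
      by apply/eqP/ffunP => v; rewrite ffunE; apply/eqP; have := znull v; rewrite negbK.
    apply: (@mass_gt0 _ _ _ _ v) => //; rewrite lt_def y0 andbT.
    by apply: contraNneq zv => /eq0_normc ->.
  rewrite -(ler_pM2r my); apply: le_trans (maxx' y y0).
  rewrite -sum_edges_through // /mass big_distrr /=; apply: ler_sum => i _.
  rewrite sum_edges_through_split -[in y i ^+ k](prednK k0) exprS mulrCA.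
  apply: ler_wpM2l => //; rewrite -normcX -normcM -eigz adjacency_action //.
  apply: le_trans (normc_sum_le _ _) _; apply: ler_sum => e _.
  by rewrite normc_prod.
have rhoE : spectral_radius R k G = rho.
  apply: xget_unique => // r [Ar ubr]; apply/eqP.
  by rewrite eq_le (max_rho.2 _ Ar) (ubr _ max_rho.1).
exists x; split; rewrite ?rhoE // => i.
by rewrite sum_edges_through_split eigx mulrCA -exprS prednK.
Qed.
End NormC.

(** * Bounding the form edge by edge *)

(** Weighted AM-GM on an edge.  If the weights of all edges at a vertex add up to
    at most 1 and the product of the weights on each edge is at least [X^-1], then
    adding these inequalities bounds the form by [rho / k] times the mass.  The
    equality case determines [x] on the edge; the third clause gives strictness
    when the weights have some slack. *)
Lemma weighted_AGM (R : realType) (V : finType) (k : nat) (A : {set V})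
    (w x : V -> R) (X rho : R) :
  (0 < k)%N -> #|A| = k -> (forall v, v \in A -> 0 < w v) ->
  (forall v, 0 <= x v) -> 0 < rho -> rho ^+ k = X ->
  1 <= X * \prod_(v in A) w v ->
  [/\ k%:R * \prod_(v in A) x v <= rho * \sum_(v in A) w v * x v ^+ k,
      rho * (\sum_(v in A) w v * x v ^+ k) <= k%:R * \prod_(v in A) x v ->
        forall v, v \in A -> \prod_(v in A) x v = rho * (w v * x v ^+ k) &
      1 < X * \prod_(v in A) w v -> 0 < \prod_(v in A) x v ->
        k%:R * \prod_(v in A) x v < rho * \sum_(v in A) w v * x v ^+ k].
Proof.
move=> k0 cA w0 x0 rho0 rhoX Xw.
have kR : 0 < k%:R :> R by rewrite ltr0n.
pose E v := w v * x v ^+ k.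
have E0 v : v \in A -> 0 <= E v.
  by move=> vA; rewrite mulr_ge0 ?exprn_ge0 // ltW ?w0.
have [AGM AGMeq] := leif_AGM E0.
rewrite cA in AGM AGMeq; set mu := _ / _ in AGM AGMeq.
have mu0 : 0 <= mu by rewrite divr_ge0 ?ler0n ?sumr_ge0.
have SE : \sum_(v in A) E v = k%:R * mu by rewrite mulrC divfK ?gt_eqF.
have X0 : 0 < X by rewrite -rhoX exprn_gt0.
set P := \prod_(v in A) x v; have P0 : 0 <= P by exact: prodr_ge0.
have PE : X * \prod_(v in A) E v = X * (\prod_(v in A) w v) * P ^+ k.
  by rewrite big_split /= prodrXl mulrA.
have PX : P ^+ k <= X * \prod_(v in A) E v by rewrite PE ler_peMl ?exprn_ge0.
have XM : X * mu ^+ k = (rho * mu) ^+ k by rewrite [RHS]exprMn rhoX.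
have rm0 : 0 <= rho * mu by rewrite mulr_ge0 // ltW.
have le_P : P <= rho * mu.
  rewrite -(ler_pXn2r k0) ?nnegrE // (le_trans PX) // -XM.
  by apply: ler_wpM2l AGM; exact: ltW.
rewrite -/(E _) SE; split.
- by rewrite mulrCA ler_wpM2l // ltW.
- rewrite mulrCA ler_pM2l // => ge_P v vA.
  have : \prod_(v in A) E v == mu ^+ k.
    rewrite eq_le AGM -(ler_pM2l X0) (le_trans _ PX) // XM.
    by rewrite lerXn2r ?nnegrE.
  rewrite AGMeq => /forall_inP/(_ v vA)/forall_inP Eeq.
  have -> : P = rho * mu by apply/le_anti; rewrite le_P.
  congr (_ * _); rewrite /mu (eq_bigr (fun=> E v)) => [|i /Eeq/eqP //].
  by rewrite sumr_const cA -(mulr_natr (E v)) mulfK ?gt_eqF.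
move=> Xw1 P_gt0; rewrite mulrCA ltr_pM2l // -(ltr_pXn2r k0) ?nnegrE //.
rewrite -XM (lt_le_trans _ (ler_wpM2l (ltW X0) AGM)) // PE.
by rewrite ltr_pMl ?exprn_gt0.
Qed.

Section EdgeBounds.
Variables (R : realType) (V : finType) (k : nat) (x : V -> R) (X rho : R).
Hypotheses (k2 : (2 <= k)%N) (x0 : forall v, 0 <= x v) (rho0 : 0 < rho).
Hypothesis rhoX : rho ^+ k = X.

Let zs (A : {set V}) := \sum_(v in A) x v ^+ k.
Let pr (A : {set V}) := \prod_(v in A) x v.

Let X0 : 0 < X. Proof. by rewrite -rhoX exprn_gt0. Qed.

(** An edge whose only vertex of degree more than 1 is [p]: the other vertices
    have weight 1, so [p] can be given the weight [X^-1]. *)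
Lemma pendent_AGM p (C : {set V}) : p \notin C -> #|C| = k.-1 ->
  k%:R * (x p * pr C) <= rho * (x p ^+ k / X + zs C) /\
  (rho * (x p ^+ k / X + zs C) <= k%:R * (x p * pr C) ->
   x p * pr C = rho * (x p ^+ k / X) /\
   forall v, v \in C -> x v ^+ k = x p ^+ k / X).
Proof.
move=> pC cC; have k0 : (0 < k)%N by exact: ltnW.
pose w v := if v == p then X^-1 else 1.
have cA : #|p |: C| = k by rewrite cardsU1 pC cC add1n prednK.
have wC v : v \in C -> w v = 1.
  by move=> vC; rewrite /w; case: eqP => // vp; rewrite -vp vC in pC.
have w0 v : v \in p |: C -> 0 < w v.
  by move=> _; rewrite /w; case: ifP; rewrite ?invr_gt0.
have Xw : 1 <= X * \prod_(v in p |: C) w v.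
  rewrite big_setU1 //= big1 ?mulr1 => [|v /wC //].
  by rewrite /w eqxx mulfV ?gt_eqF.
have [] := weighted_AGM k0 cA w0 x0 rho0 rhoX Xw.
have SE : \sum_(v in p |: C) w v * x v ^+ k = x p ^+ k / X + zs C.
  rewrite big_setU1 //= /w eqxx mulrC; congr (_ + _).
  by apply: eq_bigr => v /wC; rewrite /w => ->; rewrite mul1r.
rewrite SE big_setU1 //= => le_rho eq_rho _; split=> // /eq_rho eqv.
have eqp : x p * pr C = rho * (x p ^+ k / X).
  by rewrite /pr (eqv p) ?setU11 // /w eqxx [_^-1 * _]mulrC.
split=> // v vC; apply: (mulfI (lt0r_neq0 rho0)).
by rewrite -eqp /pr (eqv v) ?setU1r // wC // mul1r.
Qed.

(** An edge joined to the rest at [p] and [q]. *)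
Lemma joint_AGM p q (C : {set V}) wp wq :
  p \notin C -> q \notin C -> p != q -> #|C| = (k - 2)%N ->
  0 < wp -> 0 < wq -> X * (wp * wq) = 1 ->
  k%:R * (x p * x q * pr C) <= rho * (wp * x p ^+ k + wq * x q ^+ k + zs C) /\
  (rho * (wp * x p ^+ k + wq * x q ^+ k + zs C) <= k%:R * (x p * x q * pr C) ->
   [/\ x p * x q * pr C = rho * (wp * x p ^+ k),
       wp * x p ^+ k = wq * x q ^+ k &
       forall v, v \in C -> x v ^+ k = wp * x p ^+ k]).
Proof.
move=> pC qC pq cC wp0 wq0 Xww; have k0 : (0 < k)%N by exact: ltnW.
pose w v := if v == p then wp else if v == q then wq else 1.
have pA : p \notin q |: C by rewrite !inE negb_or pq.
have cA : #|p |: (q |: C)| = k by rewrite !cardsU1 pA qC cC; lia.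
have wpE : w p = wp by rewrite /w eqxx.
have wqE : w q = wq by rewrite /w eqxx eq_sym (negPf pq).
have wC v : v \in C -> w v = 1.
  move=> vC; rewrite /w; case: eqP => [vp|_]; first by rewrite -vp vC in pC.
  by case: eqP => // vq; rewrite -vq vC in qC.
have w0 v : v \in p |: (q |: C) -> 0 < w v.
  by move=> _; rewrite /w; do 2?case: ifP.
have Xw : 1 <= X * \prod_(v in p |: (q |: C)) w v.
  by rewrite !big_setU1 //= [X in _ * (_ * X)]big1 ?mulr1 ?wpE ?wqE ?Xww => [//|v /wC].
have [] := weighted_AGM k0 cA w0 x0 rho0 rhoX Xw.
have SE : \sum_(v in p |: (q |: C)) w v * x v ^+ k =
    wp * x p ^+ k + wq * x q ^+ k + zs C.
  rewrite !big_setU1 //= wpE wqE addrA; congr (_ + _).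
  by apply: eq_bigr => v /wC ->; rewrite mul1r.
rewrite SE !big_setU1 //= [x p * (x q * _)]mulrA => le_rho eq_rho _; split=> //.
move=> /eq_rho eqv; have rhoI := mulfI (lt0r_neq0 rho0).
have eqp : x p * x q * pr C = rho * (wp * x p ^+ k).
  by rewrite /pr -wpE -(eqv p) ?setU11.
split=> [//||v vC]; apply: rhoI; rewrite -eqp.
  by rewrite /pr -wqE -(eqv q) ?inE ?eqxx ?orbT.
by rewrite /pr (eqv v) ?inE ?vC ?orbT // wC // mul1r.
Qed.

End EdgeBounds.

(** The equation of the largest adjacency eigenvalue of [T1 (n + 4)], which is the
    bull graph for [n = 1].  The eigenvector has the entries [lam ^+ 2 - 2] at the
    centre, [lam + 1] and [(lam ^+ 2 + lam - 1) / lam] at the two other vertices of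
    the triangle, the second of these being the one without a pendent edge; a
    pendent vertex has the entry of its neighbour divided by [lam]. *)
Definition bull_root (R : realType) (n : nat) (lam : R) : Prop :=
  2 < lam /\
  lam ^+ 4 - (n%:R + 4) * lam ^+ 2 - 2 * lam + 2 * n%:R + 1 = 0.

Lemma bull_root_exists (R : realType) (n : nat) :
  exists lam : R, bull_root n lam.
Proof.
pose p : {poly R} := 'X^4 - (n%:R + 4)%:P * 'X^2 - 2%:P * 'X + (2 * n%:R + 1)%:P.
have pE t : p.[t] = t ^+ 4 - (n%:R + 4) * t ^+ 2 - 2 * t + 2 * n%:R + 1.
  by rewrite /p !(hornerD, hornerN, hornerM, hornerC, hornerXn, hornerX); ring.
have n0 : 0 <= n%:R :> R by rewrite ler0n.
have [||lam /andP[lam2 _] /rootP] := @poly_ivt R p 2 (n%:R + 5).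
- by lra.
- by rewrite !pE; apply/andP; split; nra.
rewrite pE => root; exists lam; split => //.
rewrite lt_def lam2 andbT; apply: contra_eqN root => /eqP ->.
by apply/eqP; nra.
Qed.

Lemma sum_indicator (R : realType) (V : finType) (A : {set V}) (w : V) :
  \sum_(v in A) (v == w)%:R = (w \in A)%:R :> R.
Proof.
have [wA|wA] := boolP (w \in A).
  rewrite (big_setD1 w) //= eqxx big1 ?addr0 // => v.
  by rewrite !inE => /andP[/negPf ->].
rewrite big1 // => v vA; case: eqP => // vw.
by rewrite -vw vA in wA.
Qed.

(** A form of the shape of the power of [T1 (n + 4)]: the triangle [u], [a], [b]
    with private parts [R1] of the edge [u a], [R2] of [u b] and [R0] of [a b], a
    pendent edge [Cg] at [a], and [n] pendent edges [Q j] at [u].  That these sets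
    partition the vertices is expressed by the summation formula [partV], which
    survives exchanges of vertices between the parts by mere rewriting. *)
Section BullBound.
Variables (R : realType) (V I : finType) (k n : nat) (x : V -> R) (lam rho : R).
Variables (u a b : V) (R1 R2 R0 Cg : {set V}) (J : {set I}) (Q : I -> {set V}).
Hypotheses (k2 : (2 <= k)%N) (x0 : forall v, 0 <= x v) (rho0 : 0 < rho).
Hypotheses (lamP : bull_root n lam) (rhoX : rho ^+ k = lam ^+ 2).
Hypotheses (cR1 : #|R1| = (k - 2)%N) (cR2 : #|R2| = (k - 2)%N).
Hypotheses (cR0 : #|R0| = (k - 2)%N) (cCg : #|Cg| = k.-1) (cJ : #|J| = n).
Hypothesis cQ : forall j, j \in J -> #|Q j| = k.-1.
Hypothesis partV : forall f : V -> R, \sum_v f v =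
  f u + f a + f b + \sum_(v in R1) f v + \sum_(v in R2) f v +
  \sum_(v in R0) f v + \sum_(v in Cg) f v + \sum_(j in J) \sum_(v in Q j) f v.
Hypothesis mass0 : 0 < mass k x.

Let pr (A : {set V}) := \prod_(v in A) x v.
Let zs (A : {set V}) := \sum_(v in A) x v ^+ k.

Definition bull_form := x u * x a * pr R1 + x u * x b * pr R2 +
  x a * x b * pr R0 + x a * pr Cg + \sum_(j in J) x u * pr (Q j).

(** [partV] for the indicator of [v]: disjointness and covering at once. *)
Let partN v : (1 = (u == v) + (a == v) + (b == v) + (v \in R1) + (v \in R2) +
  (v \in R0) + (v \in Cg) + \sum_(j in J) (v \in Q j))%N.
Proof.
apply/eqP; rewrite -(eqr_nat R) !natrD natr_sum; apply/eqP.
have := partV (fun w => (w == v)%:R); rewrite !sum_indicator.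
under [in RHS]eq_bigr do rewrite sum_indicator.
by move=> <-; rewrite (bigD1 v) //= eqxx big1 ?addr0 // => w /negPf ->.
Qed.

Let X := lam ^+ 2.
Let y0 := lam ^+ 2 - 2.
Let ya := lam + 1.
Let yb := (lam ^+ 2 + lam - 1) / lam.

Let lam2 : 2 < lam. Proof. by case: lamP. Qed.
Let lam_gt0 : 0 < lam. Proof. exact: lt_trans lam2. Qed.
Let y0_gt0 : 0 < y0. Proof. by have := lam2; rewrite /y0; nra. Qed.
Let ya_gt0 : 0 < ya. Proof. by have := lam2; rewrite /ya; lra. Qed.
Let yb_gt0 : 0 < yb. Proof. by rewrite divr_gt0 //; have := y0_gt0; have := lam2; rewrite /y0; lra. Qed.

(** The weights at a vertex add up to 1 by the eigenvalue equation at that vertex: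
    the edge [i j] has weight [y j / (lam * y i)] at [i]. *)
Let eq_center : n%:R / X + ya / (lam * y0) + yb / (lam * y0) = 1.
Proof.
have [_ root] := lamP.
have -> : n%:R = (lam ^+ 4 - 4 * lam ^+ 2 - 2 * lam + 1) / (lam ^+ 2 - 2).
  apply: (canRL (mulfK (lt0r_neq0 y0_gt0))); apply/esym/subr0_eq.
  by rewrite -[RHS]root /y0; ring.
rewrite /X /yb /ya /y0; field.
by rewrite (lt0r_neq0 y0_gt0) lt0r_neq0.
Qed.

Let eq_second : X^-1 + y0 / (lam * ya) + yb / (lam * ya) = 1.
Proof. by rewrite /X /yb /y0 /ya; field; rewrite !lt0r_neq0. Qed.

Let eq_third : y0 / (lam * yb) + ya / (lam * yb) = 1.
Proof.
rewrite /yb /y0 /ya; field; rewrite !lt0r_neq0 //.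
by move: yb_gt0; rewrite /yb pmulr_lgt0 // invr_gt0.
Qed.

Let Xww s t : 0 < s -> 0 < t -> X * (s / (lam * t) * (t / (lam * s))) = 1.
Proof. by move=> s0 t0; rewrite /X; field; rewrite !lt0r_neq0. Qed.

Let w_gt0 s t : 0 < s -> 0 < t -> 0 < s / (lam * t).
Proof. by move=> s0 t0; rewrite divr_gt0 // mulr_gt0. Qed.

(** In the case of equality the values [x v ^+ k] are those of the squared graph
    eigenvector, up to a common factor [c]: [c * y v ^+ 2] at the vertices of the
    graph and [c * y i * y j / lam] at the private vertices of the edge [i j].  As
    [lam + 1] exceeds all entries but the first, the comparison with [x a]
    follows. *)
Lemma bull_bound :
  k%:R * bull_form <= rho * mass k x /\
  (rho * mass k x <= k%:R * bull_form ->
   [/\ forall v, 0 < x v,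
       forall v, v != u -> v != a -> x v < x a &
       x u * x a * pr R1 + x u * x b * pr R2 + \sum_(j in J) x u * pr (Q j) =
       rho * x u ^+ k]).
Proof.
have k0 : (0 < k)%N by exact: ltnW.
have := partN u; rewrite eqxx -!addnA add1n => -[] /esym/eqP.
rewrite !addn_eq0 sum_nat_eq0 !eqb0 => /andP[au] /andP[bu].
move=> /andP[uR1] /andP[uR2] /andP[_] /andP[_] /forall_inP uQ0.
have ua : u != a by rewrite eq_sym.
have ub : u != b by rewrite eq_sym.
have uQ j : j \in J -> u \notin Q j by move=> /uQ0; rewrite eqb0.
have := partN a; rewrite eqxx (negPf ua) add0n -!addnA add1n => -[] /esym/eqP.
rewrite !addn_eq0 !eqb0 => /andP[ba] /andP[aR1] /andP[_].
move=> /andP[aR0] /andP[aCg] _.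
have ab : a != b by rewrite eq_sym.
have := partN b; rewrite eqxx (negPf ub) (negPf ab) !add0n -!addnA add1n.
move=> -[] /esym/eqP; rewrite !addn_eq0 !eqb0.
move=> /andP[_] /andP[bR2] /andP[bR0] _.
have [le1 eq1] := joint_AGM k2 x0 rho0 rhoX uR1 aR1 ua cR1
  (w_gt0 ya_gt0 y0_gt0) (w_gt0 y0_gt0 ya_gt0) (Xww ya_gt0 y0_gt0).
have [le2 eq2] := joint_AGM k2 x0 rho0 rhoX uR2 bR2 ub cR2
  (w_gt0 yb_gt0 y0_gt0) (w_gt0 y0_gt0 yb_gt0) (Xww yb_gt0 y0_gt0).
have [le3 eq3] := joint_AGM k2 x0 rho0 rhoX aR0 bR0 ab cR0
  (w_gt0 yb_gt0 ya_gt0) (w_gt0 ya_gt0 yb_gt0) (Xww yb_gt0 ya_gt0).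
have [le4 eq4] := pendent_AGM k2 x0 rho0 rhoX aCg cCg.
pose pend j := x u ^+ k / X + zs (Q j).
have leJ j : j \in J -> 0 <= rho * pend j - k%:R * (x u * pr (Q j)).
  by move=> jJ; have [+ _] := pendent_AGM k2 x0 rho0 rhoX (uQ j jJ) (cQ jJ); rewrite subr_ge0.
have eqJ j : j \in J -> rho * pend j - k%:R * (x u * pr (Q j)) = 0 ->
    x u * pr (Q j) = rho * (x u ^+ k / X) /\
    forall v, v \in Q j -> x v ^+ k = x u ^+ k / X.
  move=> jJ /eqP; rewrite subr_eq0 => /eqP e.
  by have [_ +] := pendent_AGM k2 x0 rho0 rhoX (uQ j jJ) (cQ jJ); apply; rewrite -e.
have sumJ : \sum_(j in J) (rho * pend j - k%:R * (x u * pr (Q j))) =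
    rho * (n%:R * (x u ^+ k / X) + \sum_(j in J) zs (Q j)) -
    k%:R * \sum_(j in J) x u * pr (Q j).
  rewrite sumrB -!big_distrr /= big_split /= sumr_const cJ.
  by rewrite (mulr_natl (x u ^+ k / X) n).
have massE : mass k x =
   (ya / (lam * y0) * x u ^+ k + y0 / (lam * ya) * x a ^+ k + zs R1) +
   (yb / (lam * y0) * x u ^+ k + y0 / (lam * yb) * x b ^+ k + zs R2) +
   (yb / (lam * ya) * x a ^+ k + ya / (lam * yb) * x b ^+ k + zs R0) +
   (x a ^+ k / X + zs Cg) +
   (n%:R * (x u ^+ k / X) + \sum_(j in J) zs (Q j)).
  transitivity ((n%:R / X + ya / (lam * y0) + yb / (lam * y0)) * x u ^+ k +
      (X^-1 + y0 / (lam * ya) + yb / (lam * ya)) * x a ^+ k +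
      (y0 / (lam * yb) + ya / (lam * yb)) * x b ^+ k +
      zs R1 + zs R2 + zs R0 + zs Cg + \sum_(j in J) zs (Q j)); last by ring.
  by rewrite eq_center eq_second eq_third !mul1r; exact: partV.
pose slack p := rho * p.1 - k%:R * p.2.
have slackE : rho * mass k x - k%:R * bull_form =
  slack (ya / (lam * y0) * x u ^+ k + y0 / (lam * ya) * x a ^+ k + zs R1,
         x u * x a * pr R1) +
  slack (yb / (lam * y0) * x u ^+ k + y0 / (lam * yb) * x b ^+ k + zs R2,
         x u * x b * pr R2) +
  slack (yb / (lam * ya) * x a ^+ k + ya / (lam * yb) * x b ^+ k + zs R0,
         x a * x b * pr R0) +
  slack (x a ^+ k / X + zs Cg, x a * pr Cg) +
  \sum_(j in J) slack (pend j, x u * pr (Q j)).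
  by rewrite sumJ massE /slack /bull_form /=; ring.
have sJ : 0 <= \sum_(j in J) slack (pend j, x u * pr (Q j)).
  by apply: sumr_ge0.
rewrite -subr_ge0 in le1; rewrite -subr_ge0 in le2.
rewrite -subr_ge0 in le3; rewrite -subr_ge0 in le4.
split.
  rewrite -subr_ge0 slackE.
  exact: addr_ge0 (addr_ge0 (addr_ge0 (addr_ge0 le1 le2) le3) le4) sJ.
move=> eq_rho.
have {}eq_rho : rho * mass k x - k%:R * bull_form <= 0 by rewrite subr_le0.
rewrite slackE in eq_rho.
have [s1 s2 s3 s4 s5] : [/\
  slack (ya / (lam * y0) * x u ^+ k + y0 / (lam * ya) * x a ^+ k + zs R1,
         x u * x a * pr R1) <= 0,
  slack (yb / (lam * y0) * x u ^+ k + y0 / (lam * yb) * x b ^+ k + zs R2,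
         x u * x b * pr R2) <= 0,
  slack (yb / (lam * ya) * x a ^+ k + ya / (lam * yb) * x b ^+ k + zs R0,
         x a * x b * pr R0) <= 0,
  slack (x a ^+ k / X + zs Cg, x a * pr Cg) <= 0 &
  \sum_(j in J) slack (pend j, x u * pr (Q j)) = 0].
  move: (le1) (le2) (le3) (le4) sJ eq_rho; rewrite /slack /=.
  move: (rho * _ - _) (rho * _ - _) (rho * _ - _) (rho * _ - _) (\sum_(j in J) _).
  by move=> p q r s t ? ? ? ? ? ?; split; lra.
rewrite subr_le0 in s1; have {eq1 s1} [p1 e1 v1] := eq1 s1.
rewrite subr_le0 in s2; have {eq2 s2} [p2 e2 v2] := eq2 s2.
rewrite subr_le0 in s3; have {eq3 s3} [p3 e3 v3] := eq3 s3.
rewrite subr_le0 in s4; have {eq4 s4} [p4 v4] := eq4 s4.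
have {s5} s5 j (jJ : j \in J) : slack (pend j, x u * pr (Q j)) = 0.
  by have /(_ j jJ) := psumr_eq0P leJ s5.
pose c := x u ^+ k / y0 ^+ 2.
have zu : x u ^+ k = c * y0 ^+ 2 by rewrite /c divfK // gt_eqF // exprn_gt0.
have za : x a ^+ k = c * ya ^+ 2.
  have w0 : 0 < y0 / (lam * ya) by exact: w_gt0.
  apply: (mulfI (lt0r_neq0 w0)); rewrite -e1 zu; field.
  by rewrite !lt0r_neq0.
have zb : x b ^+ k = c * yb ^+ 2.
  have w0 : 0 < y0 / (lam * yb) by exact: w_gt0.
  apply: (mulfI (lt0r_neq0 w0)); rewrite -e2 zu; field.
  by rewrite !lt0r_neq0.
have yb_ya : yb < ya.
  by rewrite /yb /ya ltr_pdivrMr // mulrDl mul1r -expr2; lra.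
have y0_ya : y0 / lam < ya.
  by rewrite /y0 /ya ltr_pdivrMr // mulrDl mul1r -expr2; have := lam_gt0; lra.
have ya_ya : ya / lam < ya by rewrite ltr_pdivrMr // ltr_pMr //; have := lam2; lra.
have yb_ya' : yb / lam < ya.
  by apply: lt_trans yb_ya; rewrite ltr_pdivrMr // ltr_pMr //; have := lam2; lra.
have y0l : 0 < y0 / lam by exact: divr_gt0.
have yal : 0 < ya / lam by exact: divr_gt0.
have lt_mul s t : 0 < t -> s <= ya -> t < ya -> s * t < ya ^+ 2.
  move=> t0 sy ty; rewrite expr2.
  by rewrite (le_lt_trans (ler_wpM2r (ltW t0) sy)) // ltr_pM2l.
(* Off u, x v ^+ k is c times a product of two factors that are at most ya. *)
have covers v : exists2 t, 0 < t /\ (v != u -> v != a -> t < ya ^+ 2) &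
    x v ^+ k = c * t.
  have [->|vu] := eqVneq v u.
    exists (y0 ^+ 2) => //; split=> //; exact: exprn_gt0.
  have [->|va] := eqVneq v a.
    exists (ya ^+ 2) => //; split=> //; exact: exprn_gt0.
  have small s t : 0 < s -> 0 < t -> s <= ya -> t < ya -> x v ^+ k = c * (s * t) ->
      exists2 t, 0 < t /\ (true -> true -> t < ya ^+ 2) & x v ^+ k = c * t.
    by move=> s0 t0 sy ty zv; exists (s * t) => //; rewrite mulr_gt0 ?lt_mul.
  have l0 := lt0r_neq0 lam_gt0; have n0 := lt0r_neq0 y0_gt0.
  have na := lt0r_neq0 ya_gt0; have nb := lt0r_neq0 yb_gt0.
  have [vb|vb] := eqVneq v b.
    by apply: (small yb yb) => //; rewrite ?ltW //; rewrite vb zb expr2.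
  have [/v1 zv|vR1] := boolP (v \in R1).
    by apply: (small ya (y0 / lam)) => //; rewrite zv zu; field; rewrite l0.
  have [/v2 zv|vR2] := boolP (v \in R2).
    by apply: (small yb (y0 / lam)) => //; rewrite ?ltW //; rewrite zv zu; field; rewrite l0.
  have [/v3 zv|vR0] := boolP (v \in R0).
    by apply: (small yb (ya / lam)) => //; rewrite ?ltW //; rewrite zv za; field; rewrite l0.
  have [/v4 zv|vCg] := boolP (v \in Cg).
    by apply: (small (ya / lam) (ya / lam)) => //; rewrite ?ltW //; rewrite zv za /X; field.
  have := partN v; rewrite ![_ == v]eq_sym (negPf vu) (negPf va) (negPf vb).
  rewrite (negPf vR1) (negPf vR2) (negPf vR0) (negPf vCg) !add0n => sum1.
  have [j jJ vj] : exists2 j, j \in J & v \in Q j.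
    apply/exists_inP; apply: contra_eqT sum1 => /exists_inPn vQ.
    by rewrite big1 // => j /vQ /negPf ->.
  have zv : x v ^+ k = c * (y0 / lam * (y0 / lam)).
    have s_j := s5 j jJ; have [_ ->//] := eqJ j jJ s_j.
    by rewrite zu /X; field.
  by apply: (small (y0 / lam) (y0 / lam)) => //; exact: ltW.
have c0 : 0 < c.
  have c_ge0 : 0 <= c by rewrite divr_ge0 // exprn_ge0 // ltW.
  rewrite lt_def c_ge0 andbT; apply: contraTneq mass0 => c0.
  rewrite -leNgt le_eqVlt /mass big1 ?eqxx // => v _.
  by have [t _ ->] := covers v; rewrite c0 mul0r.
split.
- move=> v; rewrite lt_def x0 andbT; have [t [t0 _] zv] := covers v.
  apply: contraTneq t0 => xv; have /eqP : c * t = 0.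
    by rewrite -zv xv expr0n gtn_eqF.
  by rewrite mulf_eq0 gt_eqF //= => /eqP ->; rewrite ltxx.
- move=> v vu va; rewrite -(ltr_pXn2r k0) ?nnegrE //.
  by have [t [_ lt_t] ->] := covers v; rewrite za ltr_pM2l // lt_t.
have -> : \sum_(j in J) x u * pr (Q j) = \sum_(j in J) rho * (x u ^+ k / X).
  by apply: eq_bigr => j jJ; have s_j := s5 j jJ; have [->] := eqJ j jJ s_j.
rewrite sumr_const cJ p1 p2 -[RHS]mulr1 -eq_center.
by rewrite -(mulr_natl (rho * _) n); ring.
Qed.

End BullBound.

(** A triangle [a], [b], [c] whose edge [b c] also contains [u], with [n.+1]
    pendent edges at [u].  The weight of [u] on a pendent edge is [X^-1]; on the edges [a b]
    and [a c] that of [a] is [1 / 2] and that of the other end [2 / X].  What is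
    left, [beta] at [u] and [s] at [b] and [c], goes to the edge through [u], and
    the eigenvalue equation makes the product of these strictly larger than
    [X^-1]. *)
Section FarTriangle.
Variables (R : realType) (V I : finType) (k n : nat) (x : V -> R) (lam rho : R).
Variables (u a b c : V) (S0 S1 S2 : {set V}) (J : {set I}) (Q : I -> {set V}).
Hypotheses (k3 : (3 <= k)%N) (x0 : forall v, 0 <= x v) (rho0 : 0 < rho).
Hypotheses (lamP : bull_root n lam) (rhoX : rho ^+ k = lam ^+ 2).
Hypotheses (cS0 : #|S0| = (k - 3)%N) (cS1 : #|S1| = (k - 2)%N).
Hypotheses (cS2 : #|S2| = (k - 2)%N) (cJ : #|J| = n.+1).
Hypothesis cQ : forall j, j \in J -> #|Q j| = k.-1.
Hypothesis partV : forall f : V -> R, \sum_v f v =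
  f u + f a + f b + f c + \sum_(v in S0) f v + \sum_(v in S1) f v +
  \sum_(v in S2) f v + \sum_(j in J) \sum_(v in Q j) f v.
Hypothesis xu0 : 0 < x u.

Let pr (A : {set V}) := \prod_(v in A) x v.
Let zs (A : {set V}) := \sum_(v in A) x v ^+ k.

Lemma far_triangle_bound :
  k%:R * (x u * x b * x c * pr S0 + x a * x b * pr S1 + x a * x c * pr S2 +
          \sum_(j in J) x u * pr (Q j)) < rho * mass k x.
Proof.
have partN v : (1 = (u == v) + (a == v) + (b == v) + (c == v) + (v \in S0) +
    (v \in S1) + (v \in S2) + \sum_(j in J) (v \in Q j))%N.
  apply/eqP; rewrite -(eqr_nat R) !natrD natr_sum; apply/eqP.
  have := partV (fun w => (w == v)%:R); rewrite !sum_indicator.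
  under [in RHS]eq_bigr do rewrite sum_indicator.
  by move=> <-; rewrite (bigD1 v) //= eqxx big1 ?addr0 // => w /negPf ->.
have k0 : (0 < k)%N by exact: ltnW (ltnW k3).
have k2 : (2 <= k)%N by exact: ltnW.
have := partN u; rewrite eqxx -!addnA add1n => -[] /esym/eqP.
rewrite !addn_eq0 sum_nat_eq0 !eqb0 => /andP[au] /andP[bu] /andP[cu].
move=> /andP[uS0] /andP[_] /andP[_] /forall_inP uQ0.
have uQ j : j \in J -> u \notin Q j by move=> /uQ0; rewrite eqb0.
have := partN a; rewrite eqxx [u == a]eq_sym (negPf au) add0n -!addnA add1n.
move=> -[] /esym/eqP; rewrite !addn_eq0 !eqb0 => /andP[ba] /andP[ca] /andP[_].
move=> /andP[aS1] /andP[aS2] _.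
have := partN b; rewrite eqxx [u == b]eq_sym [a == b]eq_sym (negPf bu) (negPf ba).
rewrite !add0n -!addnA add1n => -[] /esym/eqP; rewrite !addn_eq0 !eqb0.
move=> /andP[cb] /andP[bS0] /andP[bS1] _.
have := partN c; rewrite eqxx [u == c]eq_sym [a == c]eq_sym [b == c]eq_sym.
rewrite (negPf cu) (negPf ca) (negPf cb) !add0n -!addnA add1n => -[] /esym/eqP.
rewrite !addn_eq0 !eqb0 => /andP[cS0c] /andP[_] /andP[cS2c] _.
have [lam2 root] := lamP.
pose X := lam ^+ 2; have X2 : 0 < X - 2 by rewrite /X; nra.
have X0 : 0 < X by lra.
have lam0 : 0 < lam by lra.
have XnE : X - n.+1%:R = (lam + 1) ^+ 2 / (X - 2).
  apply: (canRL (mulfK (lt0r_neq0 X2))); apply: subr0_eq.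
  by rewrite -[RHS]root /X -natr1; ring.
pose beta := 1 - n.+1%:R / X; pose s := 1 - 2 / X.
have betaE : beta = (lam + 1) ^+ 2 / ((X - 2) * X).
  rewrite invfM mulrA -XnE /beta mulrBl mulfV // lt0r_neq0 //.
have lam1 : 0 < lam + 1 by lra.
have beta0 : 0 < beta by rewrite betaE divr_gt0 ?exprn_gt0 // mulr_gt0.
have sE : s = (X - 2) / X by rewrite /s mulrBl mulfV // lt0r_neq0.
have s0 : 0 < s by rewrite sE divr_gt0.
have strictX : 1 < X * (beta * (s * s)).
  have -> : X * (beta * (s * s)) = (lam + 1) ^+ 2 * (X - 2) / X ^+ 2.
    rewrite betaE sE; field.
    by rewrite lt0r_neq0 // lt0r_neq0.
  rewrite ltr_pdivlMr ?exprn_gt0 // mul1r /X.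
  (* The claim is 2 lam^3 - lam^2 - 4 lam - 2 > 0, which holds for lam > 2. *)
  have h1 : 0 < (lam - 2) * lam ^+ 2 by rewrite mulr_gt0 ?exprn_gt0; lra.
  have h2 : 0 < (lam - 2) * lam by rewrite mulr_gt0; lra.
  nra.
have half0 : 0 < 2^-1 :> R by rewrite invr_gt0.
have tX0 : 0 < 2 / X by rewrite divr_gt0.
have Xww : X * (2^-1 * (2 / X)) = 1 by field; rewrite lt0r_neq0.
have ab : a != b by rewrite eq_sym.
have ac : a != c by rewrite eq_sym.
have [le1 _] := joint_AGM k2 x0 rho0 rhoX aS1 bS1 ab cS1 half0 tX0 Xww.
have [le2 _] := joint_AGM k2 x0 rho0 rhoX aS2 cS2c ac cS2 half0 tX0 Xww.
have leJ j : j \in J -> k%:R * (x u * pr (Q j)) <= rho * (x u ^+ k / X + zs (Q j)).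
  by move=> jJ; have [+ _] := pendent_AGM k2 x0 rho0 rhoX (uQ j jJ) (cQ jJ).
have lt0 : k%:R * (x u * x b * x c * pr S0) <
    rho * (beta * x u ^+ k + s * x b ^+ k + s * x c ^+ k + zs S0).
  pose A := u |: (b |: (c |: S0)).
  pose w v := if v == u then beta else if (v == b) || (v == c) then s else 1.
  have bA : b \notin c |: S0 by rewrite !inE negb_or eq_sym cb.
  have uA : u \notin b |: (c |: S0).
    by rewrite !inE !negb_or uS0 [u == b]eq_sym [u == c]eq_sym bu cu.
  have cA : #|A| = k by rewrite !cardsU1 uA bA cS0c cS0 !addnA subnKC.
  have w0 v : v \in A -> 0 < w v by move=> _; rewrite /w; do 2?case: ifP.
  have wu : w u = beta by rewrite /w eqxx.
  have wb : w b = s by rewrite /w (negPf bu) eqxx.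
  have wc : w c = s by rewrite /w (negPf cu) eqxx orbT.
  have wS v : v \in S0 -> w v = 1.
    move=> vS; rewrite /w; case: eqP => [vu|_]; first by rewrite -vu vS in uS0.
    case: eqP => [vb|_]; first by rewrite -vb vS in bS0.
    by case: eqP => // vc; rewrite -vc vS in cS0c.
  have prodw : X * \prod_(v in A) w v = X * (beta * (s * s)).
    rewrite !big_setU1 //= wu wb wc [X in _ * (_ * (_ * X))]big1 ?mulr1 //.
  have Xw : 1 <= X * \prod_(v in A) w v by rewrite prodw ltW.
  have [_ _] := weighted_AGM k0 cA w0 x0 rho0 rhoX Xw.
  have SE : \sum_(v in A) w v * x v ^+ k =
      beta * x u ^+ k + s * x b ^+ k + s * x c ^+ k + zs S0.
    rewrite !big_setU1 //= wu wb wc !addrA; congr (_ + _).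
    by apply: eq_bigr => v /wS ->; rewrite mul1r.
  have prodA : \prod_(v in A) x v = x u * x b * x c * pr S0.
    by rewrite !big_setU1 //= !mulrA.
  rewrite SE prodw prodA => /(_ strictX) lt1.
  have [P0|P0] := ltrP 0 (x u * x b * x c * pr S0).
    exact: lt1.
  apply: (@le_lt_trans _ _ 0); first by rewrite mulr_ge0_le0 ?ler0n.
  rewrite mulr_gt0 // -!addrA ltr_pwDl ?mulr_gt0 ?exprn_gt0 //.
  rewrite !addr_ge0 ?mulr_ge0 ?exprn_ge0 ?(ltW s0) //.
  by apply: sumr_ge0 => v _; rewrite exprn_ge0.
have -> : rho * mass k x =
  rho * (beta * x u ^+ k + s * x b ^+ k + s * x c ^+ k + zs S0) +
  rho * (2^-1 * x a ^+ k + 2 / X * x b ^+ k + zs S1) +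
  rho * (2^-1 * x a ^+ k + 2 / X * x c ^+ k + zs S2) +
  \sum_(j in J) rho * (x u ^+ k / X + zs (Q j)).
  rewrite -big_distrr big_split /= sumr_const cJ -(mulr_natl (x u ^+ k / X) n.+1).
  rewrite /mass partV /beta /s -!mulrDr; congr (rho * _).
  rewrite -/(zs S0) -/(zs S1) -/(zs S2); field.
  by rewrite lt0r_neq0.
have -> : k%:R * (x u * x b * x c * pr S0 + x a * x b * pr S1 +
    x a * x c * pr S2 + \sum_(j in J) x u * pr (Q j)) =
  k%:R * (x u * x b * x c * pr S0) + k%:R * (x a * x b * pr S1) +
  k%:R * (x a * x c * pr S2) + \sum_(j in J) k%:R * (x u * pr (Q j)).
  by rewrite !mulrDr big_distrr.
apply: ltr_leD; last exact: ler_sum.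
by apply: ltr_leD le2; apply: ltr_leD le1.
Qed.

End FarTriangle.

(** * Walks and cycles *)

Section Walks.
Variable G : hypergraph.
Implicit Types (u v w a b : G) (s t : seq (step G)) (e f : {set G}).

Lemma walk_cat v s t : walk v (s ++ t) = walk v s && walk (walk_end v s) t.
Proof.
elim: s v => //= -[e w] s IHs v; rewrite IHs /walk_end /=.
by rewrite -!andbA.
Qed.

Lemma walk_end_cat v s t : walk_end v (s ++ t) = walk_end (walk_end v s) t.
Proof. by rewrite /walk_end /unzip2 map_cat last_cat. Qed.

Lemma walk_rcons v s e w :
  walk v (rcons s (e, w)) =
  [&& walk v s, e \in edges G, walk_end v s \in e & w \in e].
Proof.
by rewrite -cats1 walk_cat /= andbT subUset !sub1set.
Qed.

Lemma walk_end_rcons v s e w : walk_end v (rcons s (e, w)) = w.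
Proof. by rewrite -cats1 walk_end_cat. Qed.

Lemma walk_edges v s : walk v s -> {subset unzip1 s <= edges G}.
Proof.
elim: s v => //= -[e w] s IHs v /= /and3P[eE _ /IHs sE] f.
by rewrite inE => /predU1P[->|/sE].
Qed.

Lemma walk_mem_vertex v s e w : walk v s -> (e, w) \in s -> w \in e.
Proof.
elim: s v => //= -[f x] s IHs v /and3P[_ + ws].
rewrite subUset !sub1set => /andP[_ xf]; rewrite inE => /predU1P[[-> ->//]|].
exact: IHs ws.
Qed.

(** A repeated vertex or edge allows a shortcut.  Shortcuts are taken from the
    front: the tail is simple by induction, and the first step is either dropped,
    prolonged, or put in front. *)
Lemma simple_walk v s : walk v s ->
  exists t, [/\ walk v t, walk_end v t = walk_end v s,
    {subset unzip1 t <= unzip1 s}, (size t <= size s)%N &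
    uniq (unzip1 t) /\ uniq (v :: unzip2 t)].
Proof.
elim: s v => [|[e w] s IHs] v /=; first by exists [::].
case/and3P=> eE; rewrite subUset !sub1set => /andP[ve we] /IHs.
case=> t [wt endt subt sizet [u1 u2]].
have subt' : {subset unzip1 t <= e :: unzip1 s}.
  by move=> f /subt ft; rewrite inE ft orbT.
have [vt|vt] := boolP (v \in w :: unzip2 t).
  move: vt; rewrite inE => /predU1P[->|/mapP[[f x] ft /= xv]].
    by exists t; split=> //; exact: leq_trans sizet _.
  case/splitPr: ft wt endt subt subt' sizet u1 u2 => p q.
  rewrite walk_cat walk_end_cat -xv => /andP[_ /= /and3P[_ _ wq]] endt subt subt'.
  move=> sizet u1 u2; exists q; split; last split; rewrite //.
  - by move=> g gq; apply: subt'; rewrite /unzip1 map_cat mem_cat inE gq !orbT.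
  - by move: sizet; rewrite size_cat /=; lia.
  - by move: u1; rewrite /unzip1 map_cat cat_uniq => /and3P[_ _ /andP[]].
  - by move: u2; rewrite /unzip2 map_cat cat_uniq => /andP[_ /and3P[]].
have [et|et] := boolP (e \in unzip1 t); last first.
  exists ((e, w) :: t); split; last split; rewrite //=.
  - by rewrite eE subUset !sub1set ve we.
  - move=> f; rewrite !inE => /predU1P[->|/subt ->]; first by rewrite eqxx.
    by rewrite orbT.
  - by rewrite et.
  - by rewrite vt.
move: et => /mapP[[f x] ft /= fe].
case/splitPr: ft wt endt subt subt' sizet u1 u2 vt => p q.
rewrite walk_cat -fe => /andP[_ /= /and3P[_ + wq]] endt subt subt' sizet u1 u2 vt.
rewrite subUset !sub1set => /andP[_ xe].
exists ((e, x) :: q); split; last split; rewrite //=.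
- by rewrite eE subUset !sub1set ve xe.
- by move: endt; rewrite walk_end_cat.
- move=> g gq; apply: subt'; rewrite /unzip1 map_cat mem_cat.
  by apply/orP; right.
- by move: sizet; rewrite size_cat /=; lia.
- by move: u1; rewrite /unzip1 map_cat cat_uniq => /and3P[_ _].
move: u2 vt; rewrite /unzip2 !map_cat cat_uniq => /andP[_ /and3P[_ _ /= ->]].
by rewrite inE mem_cat !negb_or => /and3P[_ _ ->].
Qed.

Lemma reverse_walk v s : walk v s ->
  exists t, [/\ walk (walk_end v s) t, walk_end (walk_end v s) t = v &
    {subset unzip1 t <= unzip1 s}].
Proof.
elim: s v => [|[e w] s IHs] v /=; first by exists [::].
case/and3P=> eE; rewrite subUset !sub1set => /andP[ve we] /IHs[t [wt endt subt]].
exists (rcons t (e, v)); rewrite /walk_end /= -/(walk_end _ _); split.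
- by rewrite walk_rcons wt eE endt we ve.
- by rewrite -/(walk_end _ _) walk_end_rcons.
move=> f; rewrite /unzip1 map_rcons mem_rcons !inE => /predU1P[->|/subt ->].
  by rewrite eqxx.
by rewrite orbT.
Qed.

(** The cycle is written from [a], the new edge being its last step. *)
Lemma closing_edge_cycle a s e : walk a s -> uniq (unzip1 s) ->
  uniq (a :: unzip2 s) -> e \in edges G -> e \notin unzip1 s ->
  a \in e -> walk_end a s \in e -> walk_end a s != a ->
  is_cycle a (rcons s (e, a)).
Proof.
move=> ws u1 /= /andP[aV u2] eE es ae be ba; split.
- by rewrite walk_rcons ws eE be ae.
- by rewrite walk_end_rcons.
- by case: s ba {ws u1 aV u2 es be} => [|? ?]; rewrite ?eqxx ?size_rcons.
- by rewrite /unzip1 map_rcons rcons_uniq es.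
- by rewrite /unzip2 map_rcons rcons_uniq aV.
Qed.

Lemma same_cycle_mem v s t : is_cycle v s -> same_cycle v s t ->
  unzip1 t =i unzip1 s /\ unzip2 t =i unzip2 s.
Proof.
move=> [_ endv /ltnW s_gt0 _ _] [i st].
have szb : size (rev (unzip1 s)) = size (rev (belast v (unzip2 s))).
  by rewrite !size_rev size_belast !size_map.
have revV : belast v (unzip2 s) =i unzip2 s.
  case/lastP: s s_gt0 endv {st szb} => // s [e w] _.
  rewrite walk_end_rcons /unzip2 map_rcons belast_rcons => -> x.
  by rewrite mem_rcons.
case: st => ->; rewrite /unzip1 /unzip2 !map_rot.
  by split=> x; rewrite mem_rot.
rewrite /rev_steps -/(unzip1 _) -/(unzip2 _) unzip1_zip ?szb // unzip2_zip ?szb //.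
by split=> x; rewrite mem_rot mem_rev.
Qed.

(** All that is used of the uniqueness of the cycle: any two cycles have the same
    edges and the same vertices, as rotation and reversal change neither. *)
Lemma unicyclic_supports : unicyclic G ->
  exists (cE : seq {set G}) (cV : seq G), forall w t, is_cycle w t ->
    unzip1 t =i cE /\ unzip2 t =i cV.
Proof.
move=> [_ [v [s [cs uniq_c]]]]; exists (unzip1 s), (unzip2 s) => w t ct.
exact: same_cycle_mem cs (uniq_c w t ct).
Qed.

(** The next edge after [e] on the cycle; for the last step it is the first one,
    since the cycle returns to its initial vertex. *)
Lemma cycle_next_edge v s e w : is_cycle v s -> (e, w) \in s ->
  exists f, [/\ f \in unzip1 s, f != e & w \in f].
Proof.
move=> [ws endv s2 u1 u2] es; move: endv ws s2 u1 u2.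
case/splitPr: es => p q endv.
rewrite walk_cat /= subUset !sub1set => /andP[wp /and3P[eE /andP[pe we] wq]] s2.
rewrite /unzip1 /unzip2 !map_cat /= => u1 u2.
suff [f [fq fe wf]] : exists f,
    [/\ f \in unzip1 q ++ unzip1 p, f != e & w \in f].
  exists f; split=> //.
  by move: fq; rewrite !mem_cat inE => /orP[|] ->; rewrite ?orbT.
case: q endv wq s2 u1 u2 => [|[f x] q] endv /=.
  move=> _ s2 u1 u2; case: p endv pe wp s2 u1 u2 => // -[f x] p.
  rewrite walk_end_cat => /= wv _ /and3P[_ sub_f _] _ /andP[f_notin _] _.
  rewrite /walk_end /= in wv; move: sub_f f_notin; rewrite -wv.
  rewrite subUset !sub1set => /andP[wf _]; rewrite mem_cat !inE negb_or.
  move=> /andP[_ fe].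
  by exists f; split=> //; rewrite inE eqxx.
case/and3P=> fE; rewrite subUset !sub1set => /andP[wf _] _ _.
rewrite cat_uniq => /and3P[_ _ /= /andP[e_notin _]] _.
move: e_notin; rewrite inE negb_or => /andP[ef _]; exists f; split=> //; last by rewrite eq_sym.
by rewrite inE eqxx.
Qed.

Lemma cycle_edge_two_vertices v s e : is_cycle v s -> e \in unzip1 s ->
  exists w1 w2 f1 f2, [/\ w1 != w2, w1 \in e, w2 \in e &
    [/\ f1 \in unzip1 s, f2 \in unzip1 s, f1 != e, f2 != e & w1 \in f1 /\ w2 \in f2]].
Proof.
move=> cs /mapP[[e' w] es /= ->] {e}.
have [f2 [f2s f2e wf2]] := cycle_next_edge cs es; move: cs f2s.
case=> [ws endv s2 u1 u2] f2s.
have we := walk_mem_vertex ws es.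
move: endv ws s2 u1 u2 f2s; case/splitPr: es => p q endv.
rewrite walk_cat /= subUset !sub1set => /andP[wp /and3P[eE /andP[pe _] wq]] s2.
rewrite /unzip1 /unzip2 !map_cat /= => u1 u2 f2s.
have [f1 [f1q f1e pf1 pw]] : exists f1,
    [/\ f1 \in unzip1 q ++ unzip1 p, f1 != e', walk_end v p \in f1 &
        walk_end v p != w].
  case/lastP: p endv wp pe s2 u1 u2 {f2 f2s f2e wf2} => [|p [f x]] endv wp pe s2.
    case/lastP: q endv wq s2 => // q [f x]; rewrite /= /walk_end /= => endv.
    rewrite walk_rcons => /and4P[_ fE _ xf] _ /= /andP[ef _] /andP[wx _].
    move: endv wx ef; rewrite /unzip2 /unzip1 !map_rcons last_rcons /= => xv wx ef.
    exists f; rewrite /walk_end /= -xv xf mem_cat mem_rcons inE eqxx; split=> //.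
      by apply: contraNneq ef => ->; rewrite mem_rcons inE eqxx.
    by apply: contraNneq wx => ->; rewrite mem_rcons inE eqxx.
  move: wp; rewrite walk_rcons walk_end_rcons => /and4P[_ fE _ xf].
  rewrite /unzip1 /unzip2 !map_rcons !cat_rcons /= => u1 u2.
  exists f; rewrite xf mem_cat mem_rcons inE eqxx orbT; split=> //.
    by apply: contraTneq u1 => ->; rewrite cat_uniq /= inE eqxx !andbF.
  by apply: contraTneq u2 => ->; rewrite cat_uniq /= inE eqxx !andbF.
have qp f : f \in unzip1 q ++ unzip1 p ->
    f \in [seq i.1 | i <- p] ++ e' :: [seq i.1 | i <- q].
  by rewrite !mem_cat inE => /orP[|] ->; rewrite ?orbT.
by exists (walk_end v p), w, f1, f2; split=> //; split=> //; exact: qp.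
Qed.

End Walks.

(** * Revealing a unicyclic hypergraph from a vertex *)

Section Growth.
Variables (G : hypergraph) (u : G).
Implicit Types (e f : {set G}) (s es : seq {set G}) (v w : G).

Definition reached s : {set G} := u |: \bigcup_(f <- s) f.

Lemma mem_reached s v : (v \in reached s) = (v == u) || has (fun f => v \in f) s.
Proof.
rewrite !inE; congr (_ || _).
by elim: s => [|f s IHs]; rewrite ?big_nil ?big_cons !inE //= IHs.
Qed.

Definition earlier es e := take (index e es) es.

Lemma mem_earlier es e f : uniq es -> f \in es -> e \in es ->
  (f \in earlier es e) = (index f es < index e es)%N.
Proof. by move=> ues fes ees; rewrite /earlier in_take. Qed.

Definition growth_order es := [/\ uniq es, es =i edges G,
  forall e, e \in es -> exists2 w, w \in e & w \in reached (earlier es e) &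
  forall e f, e \in es -> f \in es -> u \in e ->
    (index f es < index e es)%N -> u \in f].

Lemma leaving_step v (t : seq (step G)) (A : {set G}) :
  walk v t -> v \in A -> walk_end v t \notin A ->
  exists e, [/\ e \in edges G, ~~ (e \subset A) & exists2 w, w \in e & w \in A].
Proof.
elim: t v => [|[e w] t IHt] v /=; first by move=> _ ->.
case/and3P=> eE; rewrite subUset !sub1set => /andP[ve we] wt vA nA.
have [wA|wA] := boolP (w \in A); first exact: (IHt w).
exists e; split=> //; last by exists v.
by apply: contra wA => /subsetP ->.
Qed.

(** Start with the edges through [u]; by connectedness an order that is not yet
    complete can be prolonged by an edge on which a walk from [u] leaves the
    vertices reached so far. *)
Lemma growth_order_exists : hypergraph_connected G ->
  (forall e, e \in edges G -> e != set0) -> exists es, growth_order es.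
Proof.
move=> conn ne0.
pose good es := [/\ uniq es, {subset es <= edges G},
  forall e, e \in edges G -> u \in e -> e \in es,
  forall e, e \in es -> exists2 w, w \in e & w \in reached (earlier es e) &
  forall e f, e \in es -> f \in es -> u \in e ->
    (index f es < index e es)%N -> u \in f].
have extend es : good es -> (size es < #|edges G|)%N ->
    exists2 es', good es' & size es' = (size es).+1.
  move=> [ues sub_es petals grow first_petals] lt_es.
  have [e [eE e_nes [w we wR]]] : exists e, [/\ e \in edges G, e \notin es &
      exists2 w, w \in e & w \in reached es].
    have [e0 e0E e0es] : exists2 e, e \in edges G & e \notin es.
      apply/exists_inP; apply: contraLR lt_es => /exists_inPn sub.
      rewrite -leqNgt cardE uniq_leq_size ?enum_uniq // => e.
      by rewrite mem_enum => /sub; rewrite negbK.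
    have /set0Pn[v ve0] := ne0 _ e0E.
    have [vR|vR] := boolP (v \in reached es).
      by exists e0; split=> //; exists v.
    have [t wt endt] := conn u v.
    have uR : u \in reached es by rewrite mem_reached eqxx.
    have [|e [eE esub mete]] := leaving_step wt uR; first by rewrite endt.
    exists e; split=> //; apply: contra esub => ees; apply/subsetP => x xe.
    by rewrite mem_reached; apply/orP; right; apply/hasP; exists e.
  exists (rcons es e); last by rewrite size_rcons.
  have idx f : f \in es -> index f (rcons es e) = index f es.
    by move=> fes; rewrite -cats1 index_cat fes.
  have idxe : index e (rcons es e) = size es.
    by rewrite -cats1 index_cat (negPf e_nes) /= eqxx addn0.
  split.
  - by rewrite rcons_uniq e_nes.
  - by move=> f; rewrite mem_rcons inE => /predU1P[->|/sub_es].
  - by move=> f fE uf; rewrite mem_rcons inE petals ?orbT.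
  - move=> f; rewrite mem_rcons inE => /predU1P[->|fes].
      by exists w; rewrite // /earlier idxe -cats1 take_size_cat.
    rewrite /earlier idx // -cats1 takel_cat; first exact: grow.
    by rewrite ltnW // index_mem.
  move=> f g; rewrite !mem_rcons !inE => /predU1P[->|fes].
    by move=> _ ue; rewrite (petals _ eE ue) in e_nes.
  move=> /predU1P[->|ges] uf; first by rewrite idxe idx // ltnNge index_size.
  by rewrite !idx //; exact: first_petals.
have good0 : good (enum [set e in edges G | u \in e]).
  split; first exact: enum_uniq.
  - by move=> e; rewrite mem_enum inE => /andP[].
  - by move=> e eE ue; rewrite mem_enum inE eE.
  - move=> e; rewrite mem_enum inE => /andP[_ ue].
    by exists u; rewrite // mem_reached eqxx.
  by move=> e f _; rewrite mem_enum inE => /andP[].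
suff [es [ues sub_es _ grow first_petals] full] :
    exists2 es, good es & (#|edges G| <= size es)%N.
  exists es; split=> // e; apply/idP/idP => [/sub_es//|eE].
  have : es =i enum (edges G).
    have [||//] := @uniq_min_size _ es (enum (edges G)) ues.
      by move=> f /sub_es; rewrite mem_enum.
    by rewrite -cardE.
  by move=> ->; rewrite mem_enum.
have [n] := ubnP (#|edges G| - size (enum [set e in edges G | u \in e])).
elim: n (enum _) good0 => // n IHn es good_es lt_n.
have [|lt_es] := leqP #|edges G| (size es); first by exists es.
have [es' good' sz] := extend es good_es lt_es.
by apply: (IHn es') => //; rewrite sz subnS -ltnS prednK // subn_gt0.
Qed.

Lemma reached_walk es v : growth_order es ->
  forall i, v \in reached (take i es) ->
  exists t, [/\ walk u t, walk_end u t = v & {subset unzip1 t <= take i es}].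
Proof.
move=> [ues esE grow _] i; elim: i v => [|i IHi] v.
  by rewrite take0 mem_reached orbF => /eqP ->; exists [::].
have [le_es|lt_es] := leqP (size es) i.
  by rewrite take_oversize ?(leqW le_es) // -(take_oversize le_es); exact: IHi.
rewrite (take_nth set0) // mem_reached has_rcons orbCA => /orP[vi|vR]; last first.
  have [|t [wt endt subt]] := IHi v; first by rewrite mem_reached.
  by exists t; split=> // f /subt ft; rewrite mem_rcons inE ft orbT.
set e := nth _ _ _ in vi *; have ees : e \in es by rewrite mem_nth.
have [w we] := grow e ees; rewrite /earlier index_uniq // => wR.
have [t [wt endt subt]] := IHi w wR.
exists (rcons t (e, v)); rewrite walk_rcons walk_end_rcons wt endt we vi -esE ees.
split=> // f; rewrite /unzip1 map_rcons !mem_rcons !inE.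
by move=> /predU1P[->|/subt ->]; rewrite ?eqxx ?orbT.
Qed.

Lemma reached_connected es e a b : growth_order es -> e \in es ->
  a \in reached (earlier es e) -> b \in reached (earlier es e) ->
  exists t, [/\ walk a t, walk_end a t = b &
    {subset unzip1 t <= earlier es e}].
Proof.
move=> gr ees aR bR.
have [ta [wta enda suba]] := reached_walk gr aR.
have [tb [wtb endb subb]] := reached_walk gr bR.
have [tr [wtr endr subr]] := reverse_walk wta; rewrite enda in wtr endr.
exists (tr ++ tb); rewrite walk_cat walk_end_cat wtr endr wtb endb.
split=> // f; rewrite /unzip1 map_cat mem_cat => /orP[/subr/suba|/subb] //.
Qed.

End Growth.

(** The trace of a growth order: [C e] are the vertices revealed by [e], [p e] is
    the single old vertex of a tree edge, [e0] is the closing edge and [a], [b] its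
    two old vertices.  The sets [C e] partition the vertices other than [u], so
    [edge_form] becomes a sum of products over disjoint sets times parent entries.
    Of the order itself only the rank [rk] is retained. *)
Record decomposition (k : nat) (G : hypergraph) (u : G) (e0 : {set G}) (a b : G)
    (C : {set G} -> {set G}) (p : {set G} -> G) (rk : {set G} -> nat) : Prop :=
  Decomposition {
  dec_e0 : e0 \in edges G;
  dec_u_e0 : u \notin e0;
  dec_closing : [/\ e0 = a |: (b |: C e0), a != b, a \notin C e0,
                    b \notin C e0 & #|C e0| = (k - 2)%N];
  dec_tree : forall e, e \in edges G -> e != e0 ->
    [/\ e = p e |: C e, p e \notin C e & #|C e| = k.-1];
  dec_petal : forall e, e \in edges G -> e != e0 -> (p e == u) = (u \in e);
  dec_root : forall e, e \in edges G -> u \notin C e;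
  dec_disjoint : forall e f v, e \in edges G -> f \in edges G ->
    v \in C e -> v \in C f -> e = f;
  dec_cover : forall v, v != u -> exists2 e, e \in edges G & v \in C e;
  dec_rank : forall e f, e \in edges G -> f \in edges G -> e != e0 ->
    p e \in C f -> (rk f < rk e)%N;
  dec_rank_e0 : forall f, f \in edges G -> (a \in C f) || (b \in C f) ->
    (rk f < rk e0)%N
}.

Section Decompose.
Variables (G : hypergraph) (u : G) (k : nat) (es : seq {set G}).
Hypotheses (linG : linear_hypergraph G) (uniG : unicyclic G).
Hypotheses (unifG : uniform k G) (k3 : (3 <= k)%N).
Hypothesis gr : growth_order u es.
Implicit Types (e f : {set G}) (v w a b : G).

Let old e := e :&: reached u (earlier es e).

Let ues : uniq es. Proof. by case: gr. Qed.
Let esE : es =i edges G. Proof. by case: gr. Qed.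

Lemma linear_eq e f v w : e \in edges G -> f \in edges G -> v != w ->
  v \in e -> w \in e -> v \in f -> w \in f -> e = f.
Proof.
move=> eE fE vw ve we vf wf; apply/eqP/negPn/negP => ef.
have := linG eE fE ef; rewrite leqNgt => /negP; apply.
rewrite (leq_trans _ (subset_leq_card (_ : [set v; w] \subset e :&: f))) //.
  by rewrite cards2 vw.
by rewrite subUset !sub1set !inE ve we vf wf.
Qed.

(** Two old vertices of [e] are joined by a walk in the earlier edges, which [e]
    closes to a cycle. *)
Lemma old_cycle e a b : e \in edges G -> a \in old e -> b \in old e -> a != b ->
  exists t, [/\ is_cycle a t, e \in unzip1 t, b \in unzip2 t &
    forall f, f \in unzip1 t -> f = e \/ f \in earlier es e].
Proof.
move=> eE; rewrite !in_setI => /andP[ae aR] /andP[be bR] ab.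
have ees : e \in es by rewrite esE.
have [t0 [wt0 endt0 subt0]] := reached_connected gr ees aR bR.
have [t [wt endt subt _ [u1 u2]]] := simple_walk wt0.
rewrite endt0 in endt.
have e_nt : e \notin unzip1 t.
  by apply/negP => /subt/subt0; rewrite mem_earlier // ltnn.
exists (rcons t (e, a)); split.
- by apply: closing_edge_cycle; rewrite ?endt // eq_sym.
- by rewrite /unzip1 map_rcons mem_rcons inE eqxx.
- rewrite /unzip2 map_rcons mem_rcons inE -/(unzip2 t); apply/orP; right.
  move: endt ab; rewrite /walk_end; case/lastP: (unzip2 t) => [/= ->|q x].
    by rewrite eqxx.
  by rewrite last_rcons => -> _; rewrite mem_rcons inE eqxx.
move=> f; rewrite /unzip1 map_rcons mem_rcons inE.
by move=> /predU1P[->|/subt/subt0]; [left|right].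
Qed.

(** Choosing the two old vertices and the walk between them as short as possible,
    no other vertex of [e] lies on the cycle. *)
Lemma old_cycle_two e a b : e \in edges G -> a \in old e -> b \in old e ->
  a != b -> exists v w t, [/\ is_cycle v t, e \in unzip1 t, v != w,
    v \in old e /\ w \in old e & forall x, x \in unzip2 t -> x \in e -> x = v \/ x = w].
Proof.
move=> eE a_old b_old ab.
pose P n := `[< exists v w t, [/\ v \in old e, w \in old e, v != w &
  [/\ walk v t, walk_end v t = w, {subset unzip1 t <= earlier es e} &
      size t = n]] >].
have exP : exists n, P n.
  move: a_old b_old; rewrite !in_setI => /andP[ae aR] /andP[be bR].
  have ees : e \in es by rewrite esE.
  have [t [wt endt subt]] := reached_connected gr ees aR bR.
  by exists (size t); apply/asboolP; exists a, b, t; rewrite !in_setI ae aR be bR.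
case: (ex_minnP exP) => n /asboolP[v [w [t0 [vo wo vw [wt0 endt0 subt0 szt0]]]]] minP.
have [t [wt endt subt szt [u1 u2]]] := simple_walk wt0.
have [ve we] : v \in e /\ w \in e by move: vo wo; rewrite !in_setI => /andP[-> _] /andP[].
rewrite endt0 in endt.
have e_nt : e \notin unzip1 t.
  by apply/negP => /subt/subt0; rewrite mem_earlier ?esE // ltnn.
exists v, w, (rcons t (e, v)); split=> //.
- by apply: closing_edge_cycle; rewrite ?endt // eq_sym.
- by rewrite /unzip1 map_rcons mem_rcons inE eqxx.
move=> x; rewrite /unzip2 map_rcons mem_rcons inE => /predU1P[->|]; first by left.
case/mapP=> -[f y] ft /= -> {x} ye; right; apply/eqP/negPn/negP => yw.
case/splitPr: ft wt endt subt szt u2 {u1 e_nt} => p q.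
rewrite walk_cat walk_end_cat /= => /andP[wp /and3P[fE fsub wq]] endt subt szt.
rewrite /unzip2 map_cat /= mem_cat inE !negb_or => /andP[/and3P[_ vy _] _].
have ptf : {subset unzip1 (rcons p (f, y)) <= earlier es e}.
  move=> g; rewrite /unzip1 map_rcons mem_rcons => gp; apply/subt0/subt.
  rewrite /unzip1 map_cat mem_cat inE /=; move: gp; rewrite inE.
  by case: (g == f); rewrite ?orbT //= => ->.
have yo : y \in old e.
  rewrite in_setI ye mem_reached; apply/orP; right.
  apply/hasP; exists f; first by apply: ptf; rewrite /unzip1 map_rcons mem_rcons inE eqxx.
  by move: fsub; rewrite subUset !sub1set => /andP[].
have sz_lt : (size (rcons p (f, y)) < n)%N.
  case: q endt szt {subt} wq => [endt|g q _ szt _]; last first.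
    rewrite -szt0 (leq_trans _ szt) // size_cat size_rcons /= !addnS !ltnS.
    exact: leq_addr.
  by move: yw; rewrite -endt /walk_end /= eqxx.
suff /minP : P (size (rcons p (f, y))) by rewrite leqNgt sz_lt.
apply/asboolP; exists v, y, (rcons p (f, y)); split=> //; split=> //.
  by rewrite walk_rcons wp fE; move: fsub; rewrite subUset !sub1set => /andP[-> ->].
by rewrite walk_end_rcons.
Qed.

(** A third old vertex of [e] would lie on a cycle through [e], hence on every
    cycle, against [old_cycle_two]. *)
Lemma old_le2 e : e \in edges G -> (#|old e| <= 2)%N.
Proof.
move=> eE; rewrite leqNgt; apply/negP => gt2.
have [a [b [ao bo ab]]] : exists a b, [/\ a \in old e, b \in old e & a != b].
  by have /card_gt1P[a [b [ao bo ab]]] := ltnW gt2; exists a, b.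
have [v [w [t [ct et vw [vo wo] two]]]] := old_cycle_two eE ao bo ab.
have [c [co cv cw]] : exists c, [/\ c \in old e, v != c & c != w].
  have : (0 < #|old e :\ v :\ w|)%N.
    by move: gt2; rewrite (cardsD1 v) vo (cardsD1 w) in_setD1 eq_sym vw wo.
  case/card_gt0P=> c; rewrite !in_setD1 => /and3P[cw cv co].
  by exists c; rewrite eq_sym cv.
have [t' [ct' _ ct2 _]] := old_cycle eE vo co cv.
have [cE [cV same]] := unicyclic_supports uniG.
have [_ V1] := same _ _ ct; have [_ V2] := same _ _ ct'.
have ce : c \in e by move: co; rewrite in_setI => /andP[].
have [] := two c _ ce; first by rewrite V1 -V2.
  by move=> cv'; rewrite cv' eqxx in cv.
by move=> cw'; rewrite cw' eqxx in cw.
Qed.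

(** The cycle closed by the earlier of two such edges does not contain the later
    one. *)
Lemma old_gt1_unique e f : e \in edges G -> f \in edges G ->
  (1 < #|old e|)%N -> (1 < #|old f|)%N -> e = f.
Proof.
wlog le_ef : e f / (index e es <= index f es)%N.
  move=> H eE fE e2 f2; case/orP: (leq_total (index e es) (index f es)) => le_ef.
    exact: H.
  by apply/esym/H.
move=> eE fE /card_gt1P[a [b [ao bo ab]]] /card_gt1P[c [d [co do_ cd]]].
have [t [ct _ _ sub_t]] := old_cycle eE ao bo ab.
have [t' [ct' ft' _ _]] := old_cycle fE co do_ cd.
have [cE [cV same]] := unicyclic_supports uniG.
have [E1 _] := same _ _ ct; have [E2 _] := same _ _ ct'.
have [|->//|] := sub_t f; first by rewrite E1 -E2.
by rewrite mem_earlier ?esE // ltnNge le_ef.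
Qed.

(** The last edge of the cycle: both of its vertices on the cycle lie on other,
    hence earlier, edges of the cycle. *)
Lemma old_gt1_exists : exists2 e, e \in edges G & (1 < #|old e|)%N.
Proof.
have [_ [v [s [cs _]]]] := uniG.
have [ws _ s2 _ _] := cs.
have sub_s := walk_edges ws.
have [e1 e1s] : exists e1, e1 \in unzip1 s.
  by case: s s2 {cs ws sub_s} => // -[e x] s _; exists e; rewrite inE eqxx.
case: (@arg_maxnP _ e1 (mem (unzip1 s)) (fun e => index e es) e1s) => e es' maxe.
have [w1 [w2 [f1 [f2 [w12 w1e w2e [f1s f2s f1e f2e [w1f w2f]]]]]]] :=
  cycle_edge_two_vertices cs es'.
exists e; first exact: sub_s.
have in_old w f : w \in e -> f \in unzip1 s -> f != e -> w \in f -> w \in old e.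
  move=> we fs fe wf; rewrite in_setI we /= mem_reached; apply/orP; right.
  apply/hasP; exists f => //; rewrite mem_earlier ?esE ?sub_s //.
  have le_fe : (index f es <= index e es)%N := maxe f fs.
  rewrite ltn_neqAle le_fe andbT; apply: contra fe => /eqP idx.
  by rewrite -(nth_index set0 (_ : e \in es)) ?esE ?sub_s // -idx nth_index ?esE ?sub_s.
by apply/card_gt1P; exists w1, w2; split; [exact: (in_old _ f1)|exact: (in_old _ f2)|].
Qed.

Lemma decomposition_of_order : exists e0 a b C p rk,
  @decomposition k G u e0 a b C p rk.
Proof.
have [_ _ grow first_petals] := gr.
have old_gt0 e : e \in edges G -> (0 < #|old e|)%N.
  rewrite -esE => /grow[w we wR]; apply/card_gt0P; exists w.
  by rewrite in_setI we.
have [e0 e0E old2] := old_gt1_exists.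
have {}old2 : #|old e0| = 2%N by apply/eqP; rewrite eqn_leq old_le2.
have old1 e : e \in edges G -> e != e0 -> #|old e| = 1%N.
  move=> eE ne; apply/eqP; rewrite eqn_leq old_gt0 // andbT leqNgt.
  by apply: contra ne => gt1; apply/eqP/old_gt1_unique => //; rewrite old2.
pose C e := e :\: reached u (earlier es e).
pose p e := odflt u [pick w in old e].
have oldC e : e = old e :|: C e by rewrite setID.
have cC e : e \in edges G -> #|C e| = (k - #|old e|)%N.
  by move=> eE; rewrite -(unifG eE) -(cardsID (reached u (earlier es e)) e) addKn.
have nC e w : w \in old e -> w \notin C e.
  by rewrite in_setI in_setD => /andP[_ ->].
have oldp e : e \in edges G -> e != e0 -> old e = [set p e].
  move=> eE ne; have /eqP/cards1P[w oldw] := old1 e eE ne.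
  rewrite /p; case: pickP => [x|/(_ w)]; rewrite oldw in_set1 ?eqxx => // /eqP -> //.
have uold e : e \in edges G -> u \in e -> old e = [set u].
  move=> eE ue; apply/setP => w; rewrite in_setI in_set1; apply/andP/eqP => [|->].
    move=> [we]; rewrite mem_reached => /predU1P[//|].
    case/hasP=> f fear wf; have fes : f \in es by exact: mem_take fear.
    have ees : e \in es by rewrite esE.
    have lt_fe : (index f es < index e es)%N by rewrite -mem_earlier.
    have uf := first_petals e f ees fes ue lt_fe.
    apply/eqP/negPn/negP => wu.
    have ef : e = f by apply: (linear_eq _ _ wu); rewrite -?esE.
    by rewrite ef ltnn in lt_fe.
  by rewrite mem_reached eqxx.
have p_old e : e \in edges G -> e != e0 ->
    (p e \in e) /\ (p e \in reached u (earlier es e)).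
  move=> eE ne; have : p e \in old e by rewrite oldp // in_set1.
  by rewrite in_setI => /andP[].
have earlier_C e f v : e \in edges G -> f \in edges G -> v \in C f ->
    v \in reached u (earlier es e) -> (index f es < index e es)%N.
  move=> eE fE; rewrite in_setD => /andP[vR vf].
  rewrite mem_reached => /predU1P[vu|/hasP[g gear vg]].
    by rewrite vu mem_reached eqxx in vR.
  have ges : g \in es by exact: mem_take gear.
  have lt_ge : (index g es < index e es)%N by rewrite -mem_earlier // esE.
  apply: leq_ltn_trans lt_ge; rewrite leqNgt; apply: contra vR => lt_gf.
  rewrite mem_reached; apply/orP; right; apply/hasP; exists g => //.
  by rewrite mem_earlier // esE.
have /cards2P[a [b [ab old_ab]]] : #|old e0| == 2%N by rewrite old2.
exists e0, a, b, C, p, (index^~ es); split => //.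
- apply/negP => /(uold _ e0E) o1; by rewrite o1 cards1 in old2.
- split=> //; first by rewrite {1}[e0]oldC old_ab setUA.
  + by apply: nC; rewrite old_ab !inE eqxx.
  + by apply: nC; rewrite old_ab !inE eqxx orbT.
  by rewrite cC // old2.
- move=> e eE ne; split; first by rewrite {1}[e]oldC oldp.
  + by apply: nC; rewrite oldp // inE.
  by rewrite cC // old1 // subn1.
- move=> e eE ne; apply/eqP/idP => [pu|ue].
    by have [] := p_old e eE ne; rewrite pu.
  by have := oldp e eE ne; rewrite uold // => /set1_inj ->.
- by move=> e _; rewrite in_setD mem_reached eqxx.
- move=> e f v eE fE vCe vCf; apply/eqP/negPn/negP => ef.
  wlog lt_ef : e f eE fE vCe vCf ef / (index e es < index f es)%N.
    move=> H; have [|lt|eq] := ltngtP (index e es) (index f es); first exact: H.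
      by apply: (H f e) => //; rewrite eq_sym.
    case/eqP: ef; rewrite -(nth_index set0 (_ : e \in es)) ?esE // eq.
    by rewrite nth_index ?esE.
  move: vCf; rewrite in_setD mem_reached negb_or => /andP[/andP[_ /hasPn/(_ e)]].
  rewrite mem_earlier ?esE // => /(_ lt_ef) + _.
  by move: vCe; rewrite in_setD => /andP[_ ->].
- move=> v vu; have [s ws ends] := uniG.1 v u.
  have [e1 e1E ve1] : exists2 e, e \in edges G & v \in e.
    case: s ws ends => [_ /= vu'|[e w] s /= /and3P[eE + _] _].
      by rewrite -vu' /walk_end eqxx in vu.
    by rewrite subUset sub1set => /andP[ve _]; exists e.
  have P1 : (e1 \in edges G) && (v \in e1) by rewrite e1E.
  case: (@arg_minnP _ e1 (fun e => (e \in edges G) && (v \in e))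
    (fun e => index e es) P1) => e /andP[eE ve] mine.
  exists e => //; rewrite in_setD ve andbT mem_reached (negPf vu) /=.
  apply/hasPn => f fear; apply/negP => vf.
  have fes : f \in es by exact: mem_take fear.
  have := mine f; rewrite -esE fes vf => /(_ isT).
  by rewrite leqNgt -mem_earlier ?esE ?fear // -esE.
- move=> e f eE fE ne pf; apply: (earlier_C e f (p e)) => //.
  by have [] := p_old e eE ne.
have old0 w : w \in [set a; b] -> w \in reached u (earlier es e0).
  by rewrite -old_ab in_setI => /andP[].
move=> f fE; case/orP=> abf; apply: (earlier_C e0 f _ e0E fE abf); apply: old0.
  by rewrite !inE eqxx.
by rewrite !inE eqxx orbT.
Qed.

End Decompose.

Lemma unicyclic_decomposition (k m : nat) (G : hypergraph) (u : G) :
  (3 <= k)%N -> linear_unicyclic k m G -> exists e0 a b C p rk,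
  @decomposition k G u e0 a b C p rk.
Proof.
move=> k3 [linG uniG unifG _].
have ne0 e : e \in edges G -> e != set0.
  by move=> /unifG ce; rewrite -card_gt0 ce; case: k k3 {unifG ce}.
have [es gr] := growth_order_exists u uniG.1 ne0.
exact: (decomposition_of_order linG uniG unifG gr).
Qed.

(** * Exchanging vertices at a maximal entry *)

Lemma decomposition_sym k (G : hypergraph) (u : G) e0 a b C p rk :
  @decomposition k G u e0 a b C p rk -> @decomposition k G u e0 b a C p rk.
Proof.
case=> D1 D2 [D3 ab aC bC cC] D4 D5 D6 D7 D8 D9 D10; split=> //.
  by split=> //; rewrite 1?eq_sym // setUCA.
by move=> f fE; rewrite orbC; exact: D10.
Qed.

(** The vector [x] plays the role of a maximiser of a hypergraph of radius at least
    [rho]: [form_ge] is the value of the form and [star_ge] the eigenvalue equation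
    at the maximal entry [u].  The latter replaces the strict inequality
    [x a < x u], which fails for [n = 1], where the graph [T1 5] has a symmetry
    that exchanges its two centres. *)
Section Classify.
Variables (R : realType) (k n : nat) (G : hypergraph) (x : G -> R) (u : G).
Variables (lam rho : R).
Hypotheses (k3 : (3 <= k)%N) (linG : linear_hypergraph G).
Hypothesis (cE : #|edges G| = (n + 4)%N).
Hypotheses (x0 : forall v, 0 <= x v) (xu0 : 0 < x u).
Hypothesis maxu : forall v, x v <= x u.
Hypotheses (rho0 : 0 < rho) (lamP : bull_root n lam) (rhoX : rho ^+ k = lam ^+ 2).
Hypothesis form_ge : rho * mass k x <= k%:R * edge_form x.
Hypothesis star_ge :
  rho * x u ^+ k <= \sum_(e in edges G | u \in e) \prod_(v in e) x v.

Let pr (A : {set G}) := \prod_(v in A) x v.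
Let pr0 A : 0 <= pr A. Proof. exact: prodr_ge0. Qed.
Let k2 : (2 <= k)%N. Proof. exact: ltnW. Qed.
Let kR : 0 < k%:R :> R. Proof. by rewrite ltr0n ltnW. Qed.

Section Decomposed.
Variables (e0 : {set G}) (a b : G) (C : {set G} -> {set G}) (p : {set G} -> G).
Variable rk : {set G} -> nat.
Hypothesis D : decomposition k u e0 a b C p rk.
Implicit Types (e f g i h j : {set G}) (v w : G).

Let e0E : e0 \in edges G. Proof. exact: dec_e0 D. Qed.

Lemma dec_partition (f : G -> R) :
  \sum_v f v = f u + \sum_(e in edges G) \sum_(v in C e) f v.
Proof.
rewrite (bigD1 u) //=; congr (_ + _).
rewrite (exchange_big_dep (fun v => v != u)) /= => [|e v eE vC].
  apply: eq_bigr => v vu; have [e eE vC] := dec_cover D vu.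
  rewrite (big_pred1 e) // => f'; apply/andP/eqP => [[f'E vf']|->//].
  exact: dec_disjoint D _ _ _ _ _ vf' vC.
by apply: contraTneq vC => ->; exact: (dec_root D eE).
Qed.

Lemma dec_prod e : e \in edges G -> e != e0 ->
  \prod_(v in e) x v = x (p e) * pr (C e).
Proof.
move=> eE ne; have [eq_e pC _] := dec_tree D eE ne.
by rewrite {1}eq_e big_setU1.
Qed.

Lemma dec_prod_closing : \prod_(v in e0) x v = x a * x b * pr (C e0).
Proof.
have [eq_e ab aC bC _] := dec_closing D.
have abC : a \notin b |: C e0 by rewrite !inE negb_or ab.
by rewrite {1}eq_e big_setU1 // big_setU1 //= mulrA.
Qed.

Lemma dec_parent_root e : e \in edges G -> e != e0 -> u \in e -> p e = u.
Proof. by move=> eE ne ue; apply/eqP; rewrite (dec_petal D). Qed.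

Lemma dec_parent_owner e : e \in edges G -> e != e0 -> u \notin e ->
  exists j, [/\ j \in edges G, p e \in C j & (rk j < rk e)%N].
Proof.
move=> eE ne ue; have pu : p e != u by rewrite (dec_petal D).
have [j jE pj] := dec_cover D pu; exists j; split=> //.
exact: dec_rank D _ _ eE jE ne pj.
Qed.

Lemma dec_card e : e \in edges G -> e != e0 -> #|C e| = k.-1.
Proof. by move=> eE ne; have [] := dec_tree D eE ne. Qed.

Lemma dec_in_e0 : [/\ a \in e0, b \in e0 & a != b].
Proof.
have [eq_e ab _ _ _] := dec_closing D.
by rewrite eq_e !inE !eqxx !orbT.
Qed.

Lemma dec_C_sub e : e \in edges G -> C e \subset e.
Proof.
move=> eE; have [ee0|ne] := eqVneq e e0; last first.
  by have [eq_e _ _] := dec_tree D eE ne; rewrite {2}eq_e subsetUr.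
have [eq_e _ _ _ _] := dec_closing D; rewrite ee0 {2}eq_e.
by apply/subsetP => v vC; rewrite !inE vC !orbT.
Qed.

Lemma dec_neq_root : a != u /\ b != u.
Proof.
have [ae be _] := dec_in_e0.
by split; apply: contraNneq (dec_u_e0 D) => <-.
Qed.

(** The edges [i] and [h] that reveal [a] and [b] differ, since otherwise they
    would share the two vertices [a] and [b] with [e0]. *)
Lemma dec_owners : exists i h, [/\ i \in edges G, h \in edges G, a \in C i,
  b \in C h & [/\ i != h, i != e0 & h != e0]].
Proof.
have [au bu] := dec_neq_root; have [ae be ab] := dec_in_e0.
have [i iE aC] := dec_cover D au; have [h hE bC] := dec_cover D bu.
have ie0 : i != e0.
  have := dec_rank_e0 D iE; rewrite aC => /(_ isT).
  by apply: contraTneq => ->; rewrite ltnn.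
have he0 : h != e0.
  have := dec_rank_e0 D hE; rewrite bC orbT => /(_ isT).
  by apply: contraTneq => ->; rewrite ltnn.
exists i, h; split=> //; split=> //; apply: contraNneq ie0 => ih.
apply/eqP/(linear_eq linG iE e0E ab) => //.
  exact: subsetP (dec_C_sub iE) _ aC.
by rewrite ih; exact: subsetP (dec_C_sub hE) _ bC.
Qed.

(** One tree edge [g] off [u] keeps its parent and all other tree edges are hung at
    [u].  Only the parents change, the sets [C e] do not. *)
Section KeepOne.
Variable g : {set G}.
Hypotheses (gE : g \in edges G) (ge0 : g != e0) (ug : u \notin g).

Let J := edges G :\ e0 :\ g.

Definition regrafted_form :=
  \sum_(e in J) x u * pr (C e) + x (p g) * pr (C g) + x a * x b * pr (C e0).

Let memJ e : (e \in J) = [&& e != g, e != e0 & e \in edges G].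
Proof. by rewrite !in_setD1. Qed.

Lemma edge_form_split : edge_form x =
  \sum_(e in J) x (p e) * pr (C e) + x (p g) * pr (C g) + x a * x b * pr (C e0).
Proof.
rewrite /edge_form (big_setD1 e0) //= dec_prod_closing.
rewrite (big_setD1 g) ?in_setD1 ?ge0 //= dec_prod // addrC; congr (_ + _).
rewrite addrC; congr (_ + _); apply: eq_bigr => e.
by rewrite memJ => /and3P[_ ne eE]; rewrite dec_prod.
Qed.

Lemma edge_form_le_regrafted : edge_form x <= regrafted_form.
Proof.
rewrite edge_form_split !lerD2r; apply: ler_sum => e _.
by rewrite ler_wpM2r.
Qed.

(** The common end of all exchanges: the parts [C i], [C h], [C e0] and [C g] are
    rearranged into the parts of a bull with centres [u] and [ra], and the form
    does not decrease.  Then all inequalities in between are equalities, and an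
    exchange that was not the identity contradicts the strict comparison with
    [x ra]. *)
Section BullShape.
Variables (i h : {set G}) (ra rb : G) (R1 R2 R0 Cg : {set G}).
Hypotheses (iJ : i \in J) (hJ : h \in J) (ih : i != h).
Hypotheses (cR1 : #|R1| = (k - 2)%N) (cR2 : #|R2| = (k - 2)%N).
Hypotheses (cR0 : #|R0| = (k - 2)%N) (cCg : #|Cg| = k.-1).
Hypothesis reshuffle : forall f : G -> R,
  \sum_(v in C i) f v + \sum_(v in C h) f v + \sum_(v in C e0) f v +
  \sum_(v in C g) f v = f ra + f rb + \sum_(v in R1) f v + \sum_(v in R2) f v +
  \sum_(v in R0) f v + \sum_(v in Cg) f v.
Hypothesis improve : x u * pr (C i) + x u * pr (C h) + x (p g) * pr (C g) +
    x a * x b * pr (C e0) <=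
  x u * x ra * pr R1 + x u * x rb * pr R2 + x ra * pr Cg + x ra * x rb * pr R0.

Lemma regrafted_bull :
  [/\ forall v, 0 < x v, forall v, v != u -> v != ra -> x v < x ra,
      x u * x ra * pr R1 + x u * x rb * pr R2 + x ra * pr Cg + x ra * x rb * pr R0 <=
      x u * pr (C i) + x u * pr (C h) + x (p g) * pr (C g) + x a * x b * pr (C e0),
      x u * x ra * pr R1 + x u * x rb * pr R2 + \sum_(e in J :\ i :\ h) x u * pr (C e) =
      rho * x u ^+ k &
      k%:R * edge_form x <= rho * mass k x].
Proof.
have hJi : h \in J :\ i by rewrite in_setD1 eq_sym ih.
have cJ : #|J :\ i :\ h| = n.
  apply/eqP; rewrite -(eqn_add2r 4) -cE (cardsD1 e0 (edges G)) e0E.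
  rewrite (cardsD1 g (_ :\ e0)) in_setD1 ge0 gE -/J (cardsD1 i J) iJ.
  by rewrite (cardsD1 h (J :\ i)) hJi !add1n addn4.
have cC j : j \in J :\ i :\ h -> #|C j| = k.-1.
  by rewrite !in_setD1 => /and5P[_ _ _ ? ?]; exact: dec_card.
have partV (f : G -> R) : \sum_v f v =
  f u + f ra + f rb + \sum_(v in R1) f v + \sum_(v in R2) f v +
  \sum_(v in R0) f v + \sum_(v in Cg) f v +
  \sum_(j in J :\ i :\ h) \sum_(v in C j) f v.
  rewrite dec_partition (big_setD1 e0) //= (big_setD1 g) ?in_setD1 ?ge0 //=.
  rewrite -/J (big_setD1 i) //= (big_setD1 h) //=.
  by have := reshuffle f; lra.
have mass_pos := mass_gt0 k x0 xu0.
have [bound tight] := bull_bound k2 x0 rho0 lamP rhoX cR1 cR2 cR0 cCg cJ cC partV mass_pos.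
set B := bull_form _ _ _ _ _ _ _ _ _ _ in bound tight.
have BE : B = (x u * x ra * pr R1 + x u * x rb * pr R2 + x ra * pr Cg +
    x ra * x rb * pr R0) + \sum_(e in J :\ i :\ h) x u * pr (C e).
  by congr (_ + _); exact: addrAC.
have FE : regrafted_form = (x u * pr (C i) + x u * pr (C h) + x (p g) * pr (C g) +
    x a * x b * pr (C e0)) + \sum_(e in J :\ i :\ h) x u * pr (C e).
  by rewrite /regrafted_form (big_setD1 i) //= (big_setD1 h) //=; ring.
have F_le_B : regrafted_form <= B by rewrite FE BE lerD2r.
have mass_le_F : rho * mass k x <= k%:R * regrafted_form.
  by rewrite (le_trans form_ge) // ler_pM2l // edge_form_le_regrafted.
have [|pos strict star] := tight.
  by rewrite (le_trans mass_le_F) // ler_pM2l.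
split=> //; last first.
  apply: le_trans bound; rewrite ler_pM2l //.
  exact: le_trans edge_form_le_regrafted F_le_B.
have : B <= regrafted_form.
  by rewrite -(ler_pM2l kR) (le_trans bound).
by rewrite BE FE lerD2r.
Qed.

End BullShape.

Let prD1 (A : {set G}) v : v \in A -> pr A = x v * pr (A :\ v).
Proof. exact: big_setD1. Qed.

Let sumD1 (f : G -> R) (A : {set G}) v : v \in A ->
  \sum_(w in A) f w = f v + \sum_(w in A :\ v) f w.
Proof. exact: big_setD1. Qed.

Let cardD1 (A : {set G}) v : v \in A -> #|A| = k.-1 -> #|A :\ v| = (k - 2)%N.
Proof.
by move=> vA; rewrite (cardsD1 v) vA add1n subn2 => <-.
Qed.

Let pr_gt0 (A : {set G}) : (forall v, 0 < x v) -> 0 < pr A.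
Proof. by move=> xpos; apply: prodr_gt0. Qed.

Let inJ e : e \in edges G -> e != e0 -> g != e -> e \in J.
Proof. by move=> eE ne ge; rewrite memJ eE ne eq_sym ge. Qed.

Let pg_u : p g != u.
Proof. by rewrite (dec_petal D) // (negPf ug). Qed.

(** This is where the eigenvalue equation at [u] enters: an edge that had to be
    hung at [u] would add a positive term to the sum over the edges at [u]. *)
Lemma full_star : (forall v, 0 < x v) ->
  \sum_(e in J) x u * pr (C e) = rho * x u ^+ k ->
  forall e, e \in edges G -> e != e0 -> e != g -> u \in e.
Proof.
move=> xpos star e eE ne eg; apply/negPn/negP => ue.
have eJ : e \in J by rewrite inJ // eq_sym.
have : \sum_(e in edges G | u \in e) \prod_(v in e) x v < rho * x u ^+ k.
  rewrite -star (big_setD1 e) //=.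
  apply: (@le_lt_trans _ _ (\sum_(f in J :\ e) x u * pr (C f))); last first.
    by rewrite ltrDr mulr_gt0 ?pr_gt0.
  rewrite big_mkcond [leRHS]big_mkcond; apply: ler_sum => f _ /=.
  case: ifP => [/andP[fE uf]|_]; last first.
    by case: ifP => // _; rewrite mulr_ge0.
  have fe0 : f != e0 by apply: contraTneq uf => ->; exact: dec_u_e0 D.
  rewrite in_setD1 inJ //; last by apply: contraTneq uf => <-.
  have -> /= : f != e by apply: contraTneq uf => ->.
  by rewrite dec_prod // dec_parent_root.
by rewrite ltNge star_ge.
Qed.

(** The edge [g] hangs at [y = p g] off the triangle [u], [a], [b], and [y] is
    revealed by [j].  If [y] is not [a], the larger of [x y] and [x a] tells
    whether [g] moves to [a] or [y] takes the place of [a]; in the latter case,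
    when [y] lies on [e0], the vertices [a] and [y] are swapped.  The case
    [j = h] follows by exchanging the roles of [a] and [b], as [i != h]. *)
Lemma kept_edge_off_triangle i h j : i \in edges G -> h \in edges G ->
  j \in edges G -> a \in C i -> b \in C h -> i != h -> i != e0 -> h != e0 ->
  g != i -> g != h -> p g \in C j -> g != j -> j != h ->
  [/\ p g = a, forall e, e \in edges G -> e != e0 -> e != g -> u \in e &
      k%:R * edge_form x <= rho * mass k x].
Proof.
move=> iE hE jE aC bC ih ie0 he0 gi gh pC gj jh.
have iJ : i \in J by exact: inJ.
have hJ : h \in J by exact: inJ.
have ci := dec_card iE ie0; have ch := dec_card hE he0; have cg := dec_card gE ge0.
have [_ ab aC0 bC0 c0] := dec_closing D.
have [au bu] := dec_neq_root.
have ab_sum (f : G -> R) : \sum_(v in C i) f v + \sum_(v in C h) f v +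
    \sum_(v in C e0) f v + \sum_(v in C g) f v =
    f a + f b + \sum_(v in C i :\ a) f v + \sum_(v in C h :\ b) f v +
    \sum_(v in C e0) f v + \sum_(v in C g) f v.
  by rewrite (sumD1 _ aC) (sumD1 _ bC); ring.
have [ya|ya] := eqVneq (p g) a.
  have [] := regrafted_bull iJ hJ ih (cardD1 aC ci) (cardD1 bC ch) c0 cg ab_sum.
    by rewrite ya (prD1 aC) (prD1 bC) !mulrA.
  move=> xpos _ _ star form_le; split=> //; apply: full_star => //.
  have hJi : h \in J :\ i by rewrite in_setD1 eq_sym ih.
  rewrite (big_setD1 i) //= (big_setD1 h) //=.
  by rewrite -star (prD1 aC) (prD1 bC) !mulrA addrA.
exfalso; have [le_ya|lt_ay] := lerP (x (p g)) (x a).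
  have [] := regrafted_bull iJ hJ ih (cardD1 aC ci) (cardD1 bC ch) c0 cg ab_sum.
    by rewrite (prD1 aC) (prD1 bC) !mulrA lerD2r lerD2l ler_wpM2r.
  move=> xpos strict le_form _ _; move: le_form; have lt_ya := strict _ pg_u ya.
  rewrite (prD1 aC) (prD1 bC) !mulrA lerD2r lerD2l ler_pM2r ?pr_gt0 //.
  by rewrite leNgt lt_ya.
have [je0|je0] := eqVneq j e0.
  rewrite je0 in pC.
  have cR0 : #|a |: (C e0 :\ p g)| = (k - 2)%N.
    by rewrite cardsU1 !inE (negPf aC0) andbF -c0 (cardsD1 (p g) (C e0)) pC.
  have aN : a \notin C e0 :\ p g by rewrite !inE (negPf aC0) andbF.
  have prU : pr (a |: C e0 :\ p g) = x a * pr (C e0 :\ p g) by exact: big_setU1.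
  have swap : x (p g) * x b * (x a * pr (C e0 :\ p g)) =
      x a * x b * (x (p g) * pr (C e0 :\ p g)) by ring.
  have [||xpos _ le_form _ _] := regrafted_bull iJ hJ ih
    (cardD1 aC ci) (cardD1 bC ch) cR0 cg (ra := p g) (rb := b).
  - move=> f; rewrite (sumD1 _ aC) (sumD1 _ bC) (sumD1 _ pC) big_setU1 //=; ring.
  - rewrite prU (prD1 aC) (prD1 bC) (prD1 pC) swap !mulrA !lerD2r.
    by rewrite ler_wpM2r // ler_wpM2l // ltW.
  move: le_form; rewrite prU (prD1 aC) (prD1 bC) (prD1 pC) swap !mulrA !lerD2r.
  by rewrite ler_pM2r ?pr_gt0 // ler_pM2l // leNgt lt_ay.
have jJ : j \in J by exact: inJ.
have cj := dec_card jE je0.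
have [||xpos _ le_form _ _] := regrafted_bull jJ hJ jh (cardD1 pC cj) (cardD1 bC ch)
  c0 cg (ra := p g) (rb := b).
- by move=> f; rewrite (sumD1 _ pC) (sumD1 _ bC); ring.
- rewrite (prD1 pC) (prD1 bC) !mulrA lerD2l ler_wpM2r // ler_wpM2r //.
  exact: ltW.
move: le_form; rewrite (prD1 pC) (prD1 bC) !mulrA lerD2l.
by rewrite ler_pM2r ?pr_gt0 // ler_pM2r // leNgt lt_ay.
Qed.

(** The edge [g] reveals [a], so that [u], [p g], [a], [b] is a cycle of length
    four.  The larger of [x a] and [x (p g)] becomes the second centre of the bull,
    and [g] becomes the pendent edge there. *)
Lemma kept_edge_quadrangle h l : h \in edges G -> l \in edges G ->
  a \in C g -> b \in C h -> h != e0 -> l != e0 -> g != h -> g != l ->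
  p g \in C l -> l != h -> False.
Proof.
move=> hE lE aC bC he0 le0 gh gl cC lh.
have lJ : l \in J by exact: inJ.
have hJ : h \in J by exact: inJ.
have cl := dec_card lE le0; have ch := dec_card hE he0; have cg := dec_card gE ge0.
have [_ ab aC0 bC0 c0] := dec_closing D.
have [au bu] := dec_neq_root.
have [_ cg_notin _] := dec_tree D gE ge0.
have [le_ac|lt_ca] := lerP (x a) (x (p g)).
  have [||xpos strict le_form _ _] := regrafted_bull lJ hJ lh (cardD1 cC cl)
    (cardD1 bC ch) c0 cg (ra := p g) (rb := b).
  - by move=> f; rewrite (sumD1 _ cC) (sumD1 _ bC); ring.
  - by rewrite (prD1 cC) (prD1 bC) !mulrA lerD2l ler_wpM2r // ler_wpM2r.
  have a_c : a != p g by apply: contraNneq cg_notin => <-.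
  have lt_ac := strict _ au a_c.
  move: le_form; rewrite (prD1 cC) (prD1 bC) !mulrA lerD2l.
  by rewrite ler_pM2r ?pr_gt0 // ler_pM2r // leNgt lt_ac.
have cN : p g \notin C g :\ a by rewrite in_setD1 (negPf cg_notin) andbF.
have cCg : #|p g |: C g :\ a| = k.-1.
  by rewrite cardsU1 cN -cg (cardsD1 a (C g)) aC.
have prU : pr (p g |: C g :\ a) = x (p g) * pr (C g :\ a) by exact: big_setU1.
have swap : x a * (x (p g) * pr (C g :\ a)) = x (p g) * (x a * pr (C g :\ a)).
  by ring.
have [||xpos _ le_form _ _] := regrafted_bull lJ hJ lh (cardD1 cC cl)
  (cardD1 bC ch) c0 cCg (ra := a) (rb := b).
- by move=> f; rewrite (sumD1 _ cC) (sumD1 _ bC) (sumD1 _ aC) big_setU1 //=; ring.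
- rewrite prU swap -(prD1 aC) (prD1 cC) (prD1 bC) !mulrA !lerD2r.
  by rewrite ler_wpM2r // ler_wpM2l // ltW.
move: le_form; rewrite prU swap -(prD1 aC) (prD1 cC) (prD1 bC) !mulrA !lerD2r.
by rewrite ler_pM2r ?pr_gt0 // ler_pM2l // leNgt lt_ca.
Qed.

(** The triangle is [p g], [a], [b], and [u] lies on its edge [h] only. *)
Lemma kept_edge_far_triangle h : h \in edges G ->
  a \in C g -> b \in C h -> h != e0 -> g != h -> p g \in C h ->
  (forall e, e \in edges G -> e != e0 -> e != g -> u \in e) -> False.
Proof.
move=> hE aC bC he0 gh cC star.
have hJ : h \in J by exact: inJ.
have ch := dec_card hE he0; have cg := dec_card gE ge0.
have [eq_e0 ab aC0 bC0 c0] := dec_closing D.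
have [eq_g cg_notin _] := dec_tree D gE ge0.
have a_c : a != p g by apply: contraNneq cg_notin => <-.
have bc : p g != b.
  apply: contraNneq ge0 => cb; apply/eqP/(linear_eq linG gE e0E ab).
  - by rewrite eq_g !inE aC orbT.
  - by rewrite eq_g !inE cb eqxx.
  - by rewrite eq_e0 !inE eqxx.
  by rewrite eq_e0 !inE eqxx orbT.
have bC' : p g \in C h :\ b by rewrite in_setD1 bc.
have cS0 : #|C h :\ b :\ p g| = (k - 3)%N.
  have := cardD1 bC ch; rewrite (cardsD1 (p g)) bC' add1n.
  by case: k k3 => [|[|[|k']]] //= _; rewrite !subSS !subn0 => -[].
have cJ : #|J :\ h| = n.+1.
  apply/eqP; rewrite -(eqn_add2r 3) addSnnS -cE (cardsD1 e0 (edges G)) e0E.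
  by rewrite (cardsD1 g (_ :\ e0)) in_setD1 ge0 gE -/J (cardsD1 h J) hJ !add1n addn3.
have cC' j : j \in J :\ h -> #|C j| = k.-1.
  by rewrite !in_setD1 => /and4P[_ _ ? ?]; exact: dec_card.
have partV (f : G -> R) : \sum_v f v =
  f u + f a + f b + f (p g) + \sum_(v in C h :\ b :\ p g) f v +
  \sum_(v in C e0) f v + \sum_(v in C g :\ a) f v +
  \sum_(j in J :\ h) \sum_(v in C j) f v.
  rewrite dec_partition (big_setD1 e0) //= (big_setD1 g) ?in_setD1 ?ge0 //=.
  rewrite -/J (big_setD1 h) //=.
  by rewrite (sumD1 _ aC) (sumD1 _ bC) (sumD1 _ bC'); ring.
have := far_triangle_bound k3 x0 rho0 lamP rhoX cS0 c0 (cardD1 aC cg) cJ cC' partV xu0.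
rewrite ltNge => /negP; apply; apply: le_trans form_ge _; rewrite ler_pM2l //.
rewrite edge_form_split (eq_bigr (fun e => x u * pr (C e))) => [|e].
  rewrite (big_setD1 h) //= -!/(pr _) (prD1 bC) (prD1 bC') (prD1 aC).
  rewrite le_eqVlt; apply/orP; left; apply/eqP; ring.
rewrite memJ => /and3P[eg ne eE]; congr (x _ * _).
by rewrite dec_parent_root // star.
Qed.

End KeepOne.
End Decomposed.


Definition bull_shape := exists e0 a b C p rk g,
  [/\ decomposition k u e0 a b C p rk, g \in edges G, g != e0, p g = a &
      forall e, e \in edges G -> e != e0 -> e != g -> u \in e].


(** The kept edge is chosen off the edges [i] and [h] of the triangle if possible.
    Otherwise the edges off [u], other than [e0], are among [i] and [h], and one of
    them is kept; the rank excludes that [i] hangs at [h] and [h] at [i]. *)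
Lemma classify_bull e0 a b C p rk : decomposition k u e0 a b C p rk ->
  (exists g, [/\ g \in edges G, g != e0 & u \notin g]) ->
  bull_shape /\ k%:R * edge_form x <= rho * mass k x.
Proof.
move=> D [g1 [g1E g1e0 ug1]].
have D' := decomposition_sym D.
have [i [h [iE hE aC bC [ih ie0 he0]]]] := dec_owners D.
have hi : h != i by rewrite eq_sym.
have owner := dec_parent_owner D.
have notg g j : (rk j < rk g)%N -> g != j.
  by apply: contraTneq => ->; rewrite ltnn.
have [/exists_inP[g gE /and4P[ge0 ug gi gh]]|] := boolP [exists g in edges G,
    [&& g != e0, u \notin g, g != i & g != h]].
  have [j [jE pC /notg gj]] := owner g gE ge0 ug.
  have [jh|jh] := eqVneq j h.
    have ji : j != i by rewrite jh.
    have [pb star form_le] := kept_edge_off_triangle D' gE ge0 ug hE iE jE bC aC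
      hi he0 ie0 gh gi pC gj ji.
    by split=> //; exists e0, b, a, C, p, rk, g.
  have [pa star form_le] := kept_edge_off_triangle D gE ge0 ug iE hE jE aC bC
    ih ie0 he0 gi gh pC gj jh.
  by split=> //; exists e0, a, b, C, p, rk, g.
move=> /exists_inPn few.
have {}few e : e \in edges G -> e != e0 -> u \notin e -> e = i \/ e = h.
  move=> eE ne ue; have := few e eE; rewrite ne ue /= negb_and !negbK.
  by case/orP=> /eqP; [left|right].
(* By the symmetry between a and b, the edge that reveals a avoids u. *)
wlog ui : a b i h D D' iE hE aC bC ih ie0 he0 hi few / u \notin i.
  move=> H; have [e1|e1] := few _ g1E g1e0 ug1; rewrite e1 in ug1.
    exact: (H a b i h).
  apply: (H b a h i) => // e eE ne ue.
  by have [->|->] := few e eE ne ue; [right|left].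
have [l [lE cC lt_li]] := owner i iE ie0 ui.
have il := notg _ _ lt_li.
have le0 : l != e0.
  have := dec_rank_e0 D iE; rewrite aC => /(_ isT) lt_i0.
  by apply: contraTneq (ltn_trans lt_li lt_i0) => ->; rewrite ltnn.
have [lh|lh] := eqVneq l h; last first.
  by have := kept_edge_quadrangle D iE ie0 hE lE aC bC he0 le0 ih il cC lh.
rewrite lh in lE cC lt_li il le0.
have [uh|uh] := boolP (u \in h); last first.
  have [j [jE dC lt_jh]] := owner h hE he0 uh.
  have hj := notg _ _ lt_jh.
  have ji : j != i.
    by apply: contraTneq (ltn_trans lt_jh lt_li) => ->; rewrite ltnn.
  have je0 : j != e0.
    have := dec_rank_e0 D hE; rewrite bC orbT => /(_ isT) lt_h0.
    by apply: contraTneq (ltn_trans lt_jh lt_h0) => ->; rewrite ltnn.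
  by have := kept_edge_quadrangle D' hE he0 iE jE bC aC ie0 je0 hi hj dC ji.
have star e : e \in edges G -> e != e0 -> e != i -> u \in e.
  move=> eE ne ei; apply/negPn/negP => ue.
  by have [e1|e1] := few e eE ne ue; [rewrite e1 eqxx in ei|rewrite e1 uh in ue].
by have := kept_edge_far_triangle D iE ie0 hE aC bC he0 ih cC star.
Qed.

End Classify.

(** * Recognising powers of graphs *)

Definition power_edge (H : hypergraph) (k : nat) (e : {e : {set H} | e \in edges H}) :
    {set power H k} :=
  [set inl v | v in val e] :|: [set inr (e, j) | j : 'I_(k - 2)].

Lemma power_edgesP (H : hypergraph) k (A : {set power H k}) :
  reflect (exists e, A = power_edge k e) (A \in edges (power H k)).
Proof. by apply: (iffP imsetP) => [[e _ ->]|[e ->]]; exists e. Qed.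

Lemma inl_power_edge (H : hypergraph) k e (v : H) :
  ((inl v : power H k) \in power_edge k e) = (v \in val e).
Proof.
rewrite inE mem_imset; last by move=> ? ? [].
by rewrite orbC; case: imsetP => // -[].
Qed.

Lemma inr_power_edge (H : hypergraph) k e f (j : 'I_(k - 2)) :
  ((inr (f, j) : power H k) \in power_edge k e) = (f == e).
Proof.
rewrite inE; case: imsetP => [[]//|_] /=.
apply/imsetP/eqP => [[j' _ [->]] //|->]; by exists j.
Qed.

(** [G] is the power of [H] once the vertices and edges of [H] are embedded in [G]
    compatibly and two edges of [G] meet in embedded vertices only: the private
    parts of the edges all have [k - 2] elements and can be numbered. *)
Section PowerRecognition.
Variables (k : nat) (H G : hypergraph) (phi : H -> G).
Variable psi : {set H} -> {set G}.
Hypotheses (H2 : uniform 2 H) (Gk : uniform k G).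
Hypothesis phi_inj : injective phi.
Hypothesis psiE : forall e, e \in edges H -> psi e \in edges G.
Hypothesis psi_inj : {in edges H &, injective psi}.
Hypothesis card_edges : #|edges H| = #|edges G|.
Hypothesis phi_psi : forall e i, e \in edges H -> (phi i \in psi e) = (i \in e).
Hypothesis overlap : forall e f v, e \in edges H -> f \in edges H -> e != f ->
  v \in psi e -> v \in psi f -> exists i, v = phi i.
Hypothesis cover : forall v, (exists i, v = phi i) \/
  exists2 e, e \in edges H & v \in psi e.

Let private e := psi e :\: phi @: e.

Let private_phi e i : e \in edges H -> phi i \notin private e.
Proof.
move=> eH; rewrite inE phi_psi // andbC; case: (boolP (i \in e)) => // ie.
by rewrite imset_f.
Qed.

Let card_private e : e \in edges H -> #|private e| = (k - 2)%N.
Proof.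
move=> eH; have sub : phi @: e \subset psi e.
  by apply/subsetP => _ /imsetP[i ie ->]; rewrite phi_psi.
by rewrite cardsD (setIidPr sub) Gk ?psiE // card_imset // H2.
Qed.

Let default : G := enum_val (Ordinal (vertex_gt0 G)).

Let embed (w : power H k) : G :=
  match w with
  | inl i => phi i
  | inr (e, j) => nth default (enum (private (val e))) j
  end.

Let embed_private e j : embed (inr (e, j)) \in private (val e).
Proof. by rewrite -mem_enum mem_nth // -cardE card_private ?(valP e). Qed.

Let embed_inj : injective embed.
Proof.
have psi_private e v : v \in private e -> v \in psi e.
  by rewrite inE => /andP[].
move=> [i|[e j]] [i'|[e' j']].
- by move=> /phi_inj ->.
- move=> eq; have := embed_private e' j'; rewrite -eq /=.
  by rewrite (negPf (private_phi _ (valP e'))).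
- move=> eq; have := embed_private e j; rewrite eq /=.
  by rewrite (negPf (private_phi _ (valP e))).
move=> eq; have v1 := embed_private e j; have v2 := embed_private e' j'.
have ee' : e = e'.
  apply/val_inj/eqP/negPn/negP => ne.
  have := v2; rewrite -eq => /psi_private v2'.
  have [i vi] := overlap (valP e) (valP e') ne (psi_private _ _ v1) v2'.
  by move: v1; rewrite vi (negPf (private_phi _ (valP e))).
subst e'; congr (inr (_, _)); apply/val_inj/eqP.
rewrite -(nth_uniq default _ _ (enum_uniq (private (val e)))) -?cardE;
  rewrite ?card_private ?(valP e) ?ltn_ord //.
exact/eqP.
Qed.

Let embed_surj v : exists w, v = embed w.
Proof.
have [[i ->]|[e eH ve]] := cover v; first by exists (inl i).
have [/imsetP[i _ ->]|vphi] := boolP (v \in phi @: e); first by exists (inl i).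
have vp : v \in enum (private e) by rewrite mem_enum inE vphi.
have lt : (index v (enum (private e)) < k - 2)%N.
  by rewrite -(card_private eH) cardE index_mem.
by exists (inr (exist _ e eH, Ordinal lt)); rewrite /= nth_index.
Qed.

Let embed_edge e : embed @: power_edge k e = psi (val e).
Proof.
apply/setP => v; apply/imsetP/idP => [[[i|[f j]]]|ve].
- by rewrite inl_power_edge => ie ->; rewrite phi_psi ?(valP e).
- rewrite inr_power_edge => /eqP -> ->.
  by have := embed_private e j; rewrite inE => /andP[].
have [[i|[f j]] vw] := embed_surj v.
  by exists (inl i) => //; rewrite inl_power_edge -(phi_psi _ (valP e)) -[phi i]vw.
exists (inr (f, j)) => //; rewrite inr_power_edge; apply/eqP/val_inj/eqP/negPn/negP.
move=> ne; have := embed_private f j; rewrite -vw => vpf.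
have vf : v \in psi (val f) by move: vpf; rewrite inE => /andP[].
have [i vi] := overlap (valP f) (valP e) ne vf ve.
by move: vpf; rewrite vi (negPf (private_phi _ (valP f))).
Qed.

Lemma power_recognition : isomorphic G (power H k).
Proof.
have psi_onto : psi @: edges H = edges G.
  apply/eqP; rewrite eqEcard card_in_imset // card_edges leqnn andbT.
  by apply/subsetP => _ /imsetP[e eH ->]; exact: psiE.
have [f embedK fK] : bijective embed.
  apply: inj_card_bij embed_inj _.
  have -> : #|G| = #|embed @: [set: power H k]|.
    rewrite -cardsT; apply: eq_card => v; rewrite inE; apply/esym/imsetP.
    by have [w ->] := embed_surj v; exists w.
  by rewrite (leq_trans (leq_imset_card _ _)) // cardsT.
exists f; first by exists embed.
move=> A; apply/idP/power_edgesP => [|[e fA]].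
  rewrite -psi_onto => /imsetP[e eH ->]; exists (exist _ e eH).
  rewrite -(embed_edge (exist _ e eH)) -imset_comp.
  by rewrite -[RHS]imset_id; apply: eq_imset => w; exact: embedK.
have -> : A = psi (val e).
  rewrite -embed_edge -fA -imset_comp -[LHS]imset_id.
  by apply: eq_imset => w /=; exact/esym/fK.
exact: psiE (valP e).
Qed.

End PowerRecognition.

Lemma inl_set_inj (A B : finType) : injective (fun e : {set A} => [set (inl v : A + B) | v in e]).
Proof. by apply: imset_inj => ? ? []. Qed.

Lemma mem_inl_set (A B : finType) (e : {set A}) (w : A + B) :
  (w \in [set (inl v : A + B) | v in e]) = if w is inl v then v \in e else false.
Proof.
case: w => [v|j]; first by rewrite mem_imset // => ? ? [].
by apply/negP => /imsetP[].
Qed.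

Section Attach.
Variables (H : hypergraph) (v : H) (p : nat).

Lemma attach_edgesP (e : {set attach_pendents v p}) :
  reflect ((exists2 f, f \in edges H & e = [set inl w | w in f]) \/
           exists i, e = [set inl v; inr i])
    (e \in edges (attach_pendents v p)).
Proof.
rewrite inE; apply: (iffP orP) => [[/imsetP[f fE ->]|/imsetP[i _ ->]]|].
- by left; exists f.
- by right; exists i.
by move=> [[f fE ->]|[i ->]]; [left|right]; apply/imsetP; [exists f|exists i].
Qed.

Lemma sum_attach_edges (M : nmodType) (F : {set attach_pendents v p} -> M) :
  \sum_(e in edges (attach_pendents v p)) F e =
  \sum_(e in edges H) F [set inl w | w in e] + \sum_i F [set inl v; inr i].
Proof.
rewrite [edges _]/= (eq_bigl _ _ (fun e => in_setU e _ _)) bigU /=; last first.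
  rewrite -setI_eq0; apply/eqP/setP => e; rewrite !inE; apply/negP.
  move=> /andP[/imsetP[f fE ->] /imsetP[i _]] /setP/(_ (inr i)).
  by rewrite mem_inl_set !inE eqxx orbT.
rewrite big_imset /=; last by move=> ? ? _ _ /inl_set_inj.
rewrite big_imset //= => i j _ _ /setP/(_ (inr i)).
by rewrite !inE eqxx /= => /esym/eqP[].
Qed.

Lemma card_attach_edges : #|edges (attach_pendents v p)| = (#|edges H| + p)%N.
Proof.
rewrite -sum1_card; apply: etrans (sum_attach_edges (fun=> 1%N)) _.
congr (_ + _)%N; first exact: sum1_card.
exact: etrans (sum1_card _) (card_ord p).
Qed.

Lemma attach_uniform2 : uniform 2 H -> uniform 2 (attach_pendents v p).
Proof.
move=> H2 e /attach_edgesP[[f fE ->]|[i ->]]; last by rewrite cards2.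
by rewrite card_imset ?H2 // => ? ? [].
Qed.

End Attach.

(** Naming an edge of the triangle by the vertex opposite to it makes membership
    computable. *)
Lemma triangle_edges : edges triangle = [set [set~ c] | c : 'I_3].
Proof.
apply/setP => e; rewrite inE; apply/eqP/imsetP => [ce|[c _ ->]]; last first.
  by rewrite cardsC1 card_ord.
have /cards1P[c eC] : #|~: e| == 1%N by rewrite cardsCs setCK card_ord ce.
by exists c => //; rewrite -eC setCK.
Qed.

Lemma sum_triangle_edges (M : nmodType) (F : {set triangle} -> M) :
  \sum_(e in edges triangle) F e = \sum_(c : 'I_3) F [set~ c].
Proof.
rewrite triangle_edges big_imset //= => c d _ _ /setP/(_ c).
by rewrite !inE eqxx => /esym/negbFE/eqP.
Qed.

Lemma triangle_uniform2 : uniform 2 triangle.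
Proof. by move=> e; rewrite inE => /eqP. Qed.

Lemma card_triangle_edges : #|edges triangle| = 3.
Proof.
rewrite -sum1_card; apply: etrans (sum_triangle_edges (fun=> 1%N)) _.
exact: etrans (sum1_card _) (card_ord 3).
Qed.

Lemma S3_uniform2 m : uniform 2 (S3 m).
Proof. exact/attach_uniform2/triangle_uniform2. Qed.

Lemma T1_uniform2 m : uniform 2 (T1 m).
Proof. exact/attach_uniform2/S3_uniform2. Qed.

Lemma card_S3_edges m : (3 <= m)%N -> #|edges (S3 m)| = m.
Proof. by move=> m3; rewrite card_attach_edges card_triangle_edges subnKC. Qed.

Lemma card_T1_edges m : (4 <= m)%N -> #|edges (T1 m)| = m.
Proof.
case: m => // m m3; rewrite card_attach_edges card_S3_edges //= addn1 //.
Qed.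

(** The edge map is determined by [phi]: an edge of [G] belongs to the edge of [H]
    that is its preimage. *)
Lemma power_recognition_preim (k : nat) (H G : hypergraph) (phi : H -> G) :
  uniform 2 H -> uniform k G -> injective phi ->
  #|edges H| = #|edges G| ->
  (forall e, e \in edges H -> exists2 f, f \in edges G & phi @^-1: f = e) ->
  (forall e f v, e \in edges G -> f \in edges G -> e != f ->
    v \in e -> v \in f -> exists i, v = phi i) ->
  (forall v, exists2 f, f \in edges G & v \in f) ->
  isomorphic G (power H k).
Proof.
move=> H2 Gk phi_inj cE lift overlap cover.
pose psi e := odflt set0 [pick f in edges G | phi @^-1: f == e].
have psiP e : e \in edges H -> psi e \in edges G /\ phi @^-1: psi e = e.
  move=> /lift[f fG fe]; rewrite /psi.
  by case: pickP => [f' /andP[? /eqP]//|/(_ f)]; rewrite fG fe eqxx.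
have psi_inj : {in edges H &, injective psi}.
  by move=> e f /psiP[_ {2}<-] /psiP[_ {2}<-] ->.
have psi_onto : psi @: edges H = edges G.
  apply/eqP; rewrite eqEcard card_in_imset // cE leqnn andbT.
  by apply/subsetP => _ /imsetP[e /psiP[? _] ->].
apply: (power_recognition (phi := phi) (psi := psi)) => //.
- by move=> e /psiP[].
- by move=> e i /psiP[_ {2}<-]; rewrite inE.
- move=> e f v eH fH ef; apply: overlap; [exact: (psiP e eH).1|exact: (psiP f fH).1|].
  by apply: contra ef => /eqP/(psi_inj _ _ eH fH)/eqP.
move=> v; right; have [f] := cover v.
by rewrite -psi_onto => /imsetP[e eH ->]; exists e.
Qed.

(** The vertices of the graphs are found in a decomposed hypergraph as follows: the
    triangle is [u], [a], [b], and a pendent edge is represented by one of the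
    vertices that it reveals. *)
Section Shapes.
Variables (k : nat) (G : hypergraph) (u : G) (e0 : {set G}) (a b : G).
Variables (C : {set G} -> {set G}) (p : {set G} -> G) (rk : {set G} -> nat).
Variables (i h : {set G}).
Hypotheses (k3 : (3 <= k)%N) (linG : linear_hypergraph G) (Gk : uniform k G).
Hypothesis D : decomposition k u e0 a b C p rk.
Hypotheses (iE : i \in edges G) (hE : h \in edges G) (aC : a \in C i) (bC : b \in C h).
Hypotheses (ih : i != h) (ie0 : i != e0) (he0 : h != e0).

Let e0E : e0 \in edges G. Proof. exact: dec_e0 D. Qed.

Lemma mem_dec_edge e v : e \in edges G ->
  (v \in e) = (v \in C e) || (if e == e0 then (v == a) || (v == b) else v == p e).
Proof.
move=> eE; case: eqP => [->|/eqP ne].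
  by have [eq_e _ _ _ _] := dec_closing D; rewrite [in LHS]eq_e !inE orbA orbC.
by have [eq_e _ _] := dec_tree D eE ne; rewrite [in LHS]eq_e !inE orbC.
Qed.

Lemma mem_dec_C e f v : e \in edges G -> f \in edges G -> v \in C f ->
  (v \in C e) = (e == f).
Proof.
move=> eE fE vf; apply/idP/eqP => [ve|-> //].
exact: dec_disjoint D _ _ _ eE fE ve vf.
Qed.

Let rep e : G := odflt u [pick v in C e].

Lemma repP e : e \in edges G -> rep e \in C e.
Proof.
move=> eE; rewrite /rep; case: pickP => [v //|C0].
have : (0 < #|C e|)%N.
  have [->|ne] := eqVneq e e0.
    by have [_ _ _ _ ->] := dec_closing D; rewrite subn_gt0.
  by have [_ _ ->] := dec_tree D eE ne; rewrite -subn1 subn_gt0 ltnW.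
by case/card_gt0P=> v; rewrite C0.
Qed.

Let rep_u e : e \in edges G -> (rep e == u) = false.
Proof.
by move=> eE; apply: contraNF (dec_root D eE) => /eqP <-; exact: repP.
Qed.

Let au : a != u. Proof. by apply: contraTneq aC => ->; exact: (dec_root D iE). Qed.
Let bu : b != u. Proof. by apply: contraTneq bC => ->; exact: (dec_root D hE). Qed.
Let ab : a != b. Proof. by have [_ ? _ _ _] := dec_closing D. Qed.

Let corner (c : 'I_3) : G := nth u [:: u; a; b] c.
Let side (c : 'I_3) : {set G} := nth e0 [:: e0; h; i] c.

Let corner_side c d : p i = u -> p h = u -> (corner c \in side d) = (c != d).
Proof.
move=> pi ph; case: c d => [[|[|[|//]]] lc] [[|[|[|//]]] ld];
  rewrite mem_dec_edge /corner /side ?eqxx //= ?(negPf ie0) ?(negPf he0) ?pi ?ph.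
- by rewrite (negPf (dec_root D e0E)) ![u == _]eq_sym (negPf au) (negPf bu).
- by rewrite eqxx orbT.
- by rewrite eqxx orbT.
- by rewrite orbT.
- by rewrite (mem_dec_C hE iE aC) eq_sym (negPf ih) (negPf au).
- by rewrite aC.
- by rewrite !orbT.
- by rewrite bC.
by rewrite (mem_dec_C iE hE bC) (negPf ih) (negPf bu).
Qed.

Let corner_C c e : e \in edges G -> corner c \in C e -> e = i \/ e = h.
Proof.
move=> eE; case: c => [[|[|[|//]]] lc]; rewrite /corner /=.
- by rewrite (negPf (dec_root D eE)).
- by rewrite (mem_dec_C eE iE aC) => /eqP; left.
by rewrite (mem_dec_C eE hE bC) => /eqP; right.
Qed.

Let corner_inj : injective corner.
Proof.
move=> [[|[|[|//]]] lc] [[|[|[|//]]] ld] /eqP; rewrite /corner /= => cd;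
  try exact: val_inj; exfalso; move: cd; apply/negP => //;
  by rewrite eq_sym.
Qed.

Let rep_corner e c : e \in edges G -> e != i -> e != h -> rep e != corner c.
Proof.
move=> eE ei eh; apply/eqP => rc; have := repP eE; rewrite rc.
by case/(corner_C eE) => e'; [rewrite e' eqxx in ei|rewrite e' eqxx in eh].
Qed.

Let rep_side e c : e \in edges G -> e != i -> e != h -> e != e0 ->
  p i = u -> p h = u -> (rep e \in side c) = false.
Proof.
move=> eE ei eh ee0 pi ph.
have ra : (rep e == a) = false by apply/negbTE/(rep_corner (@Ordinal 3 1 isT)).
have rb : (rep e == b) = false by apply/negbTE/(rep_corner (@Ordinal 3 2 isT)).
case: c => [[|[|[|//]]] lc]; rewrite /side /= mem_dec_edge // ?eqxx ?ra ?rb ?orbF.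
- by rewrite (mem_dec_C e0E eE (repP eE)) eq_sym (negPf ee0).
- by rewrite (negPf he0) ph rep_u // orbF (mem_dec_C hE eE (repP eE)) eq_sym (negPf eh).
by rewrite (negPf ie0) pi rep_u // orbF (mem_dec_C iE eE (repP eE)) eq_sym (negPf ei).
Qed.

Let sideE c : side c \in edges G.
Proof. by case: c => [[|[|[|//]]] lc]. Qed.

Let tree_edge e : e \in edges G -> e != e0 ->
  forall v, (v \in e) = (v \in C e) || (v == p e).
Proof. by move=> eE ne v; rewrite mem_dec_edge // (negPf ne). Qed.

(** Distinct edges reveal disjoint sets, so a common vertex is an old vertex of one
    of them. *)
Lemma dec_shared_vertex e f v : e \in edges G -> f \in edges G -> e != f ->
  v \in e -> v \in f ->
  [|| v == a, v == b, (e != e0) && (v == p e) | (f != e0) && (v == p f)].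
Proof.
move=> eE fE ef; rewrite (mem_dec_edge v eE) (mem_dec_edge v fE).
case/orP=> [ve|]; last first.
  case: eqP => [_ /orP[]->|_ ->]; rewrite ?orbT //.
case/orP=> [vf|]; last first.
  case: eqP => [_ /orP[]->|_ ->]; rewrite ?orbT //.
by rewrite -(mem_dec_C eE fE vf) ve in ef.
Qed.

Lemma dec_covers_edges v : u \in i -> exists2 f, f \in edges G & v \in f.
Proof.
move=> ui; have [->|vu] := eqVneq v u; first by exists i.
have [e eE vC] := dec_cover D vu; exists e => //.
by rewrite mem_dec_edge // vC.
Qed.

Lemma star_recognition m : (3 <= m)%N -> #|edges G| = m ->
  (forall e, e \in edges G -> e != e0 -> u \in e) -> isomorphic G (power (S3 m) k).
Proof.
move=> m3 cE star.
have pu e : e \in edges G -> e != e0 -> p e = u.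
  by move=> eE ne; apply/eqP; rewrite (dec_petal D) // star.
pose J := edges G :\ e0 :\ i :\ h.
have memJ e : e \in J -> [/\ e \in edges G, e != e0, e != i & e != h].
  by rewrite !in_setD1 => /and4P[].
have cJ : #|J| = (m - 3)%N.
  rewrite -cE (cardsD1 e0 (edges G)) e0E (cardsD1 i (_ :\ e0)) in_setD1 ie0 iE.
  rewrite (cardsD1 h (_ :\ i)) !in_setD1 eq_sym ih he0 hE -/J /= !add1n.
  by rewrite !subSS subn0.
pose petal (j : 'I_(m - 3)) := nth e0 (enum J) j.
have petalJ j : petal j \in J.
  by rewrite -mem_enum mem_nth // -cardE cJ.
have petal_inj : injective petal.
  move=> j j' /eqP; rewrite nth_uniq ?enum_uniq -?cardE ?cJ //.
  by move=> /eqP/val_inj.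
pose phi (w : S3 m) : G := match w with inl c => corner c | inr j => rep (petal j) end.
have rep_petal j e : e \in edges G -> e != e0 -> (rep (petal j) \in e) = (e == petal j).
  move=> eE ne; have [jE j0 ji jh] := memJ _ (petalJ j).
  by rewrite tree_edge // pu // rep_u // orbF (mem_dec_C eE jE (repP jE)).
apply: (power_recognition_preim (phi := phi)) => //.
- exact: S3_uniform2.
- move=> [c|j] [c'|j'] /= eq.
  + by rewrite (corner_inj eq).
  + have [jE j0 ji jh] := memJ _ (petalJ j').
    by have := rep_corner c jE ji jh; rewrite eq eqxx.
  + have [jE j0 ji jh] := memJ _ (petalJ j).
    by have := rep_corner c' jE ji jh; rewrite eq eqxx.
  have [jE _ _ _] := memJ _ (petalJ j); have [jE' _ _ _] := memJ _ (petalJ j').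
  have := repP jE'; rewrite -eq (mem_dec_C jE' jE (repP jE)).
  by move=> /eqP/petal_inj ->.
- by rewrite card_S3_edges.
- move=> e /attach_edgesP[[f + ->]|[j ->]].
    rewrite triangle_edges => /imsetP[c _ ->]; exists (side c); first exact: sideE.
    apply/setP => w; rewrite inE mem_inl_set; case: w => [d|j] /=.
      by rewrite corner_side ?pu // !inE.
    have [jE j0 ji jh] := memJ _ (petalJ j).
    by rewrite rep_side // pu.
  have [jE j0 ji jh] := memJ _ (petalJ j).
  exists (petal j) => //; apply/setP => w; rewrite !inE; case: w => [d|j'] /=.
    rewrite tree_edge // pu //.
    have -> : (corner d \in C (petal j)) = false.
      by apply/negP => /(corner_C jE)[] /eqP; apply/negP.
    by rewrite orbF -[u]/(corner ord0) (inj_eq corner_inj).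
  by rewrite rep_petal // (inj_eq petal_inj) eq_sym.
- move=> e f v eE fE ef ve vf.
  have := dec_shared_vertex eE fE ef ve vf.
  case/or4P=> [/eqP->|/eqP->|/andP[ne /eqP->]|/andP[ne /eqP->]].
  + by exists (inl (@Ordinal 3 1 isT)).
  + by exists (inl (@Ordinal 3 2 isT)).
  + by exists (inl ord0); rewrite pu.
  by exists (inl ord0); rewrite pu.
by move=> v; apply: dec_covers_edges => //; exact: star.
Qed.

Lemma bull_recognition m g : (5 <= m)%N -> #|edges G| = m ->
  g \in edges G -> g != e0 -> p g = a ->
  (forall e, e \in edges G -> e != e0 -> e != g -> u \in e) ->
  isomorphic G (power (T1 m) k).
Proof.
move=> m5 cE gE ge0 pg star.
have gi : g != i.
  apply/eqP => gi; have := dec_rank D gE iE ge0; rewrite pg gi => /(_ aC).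
  by rewrite ltnn.
have ga v : (v \in g) = (v \in C g) || (v == a) by rewrite tree_edge // pg.
have gh : g != h.
  apply: contraNneq ge0 => gh; apply/eqP/(linear_eq linG gE e0E ab).
  - by rewrite ga eqxx orbT.
  - by rewrite ga gh bC.
  - by rewrite mem_dec_edge // !eqxx !orbT.
  by rewrite mem_dec_edge // !eqxx !orbT.
have pu e : e \in edges G -> e != e0 -> e != g -> p e = u.
  by move=> eE ne eg; apply/eqP; rewrite (dec_petal D) // star.
have pi : p i = u by rewrite pu // eq_sym.
have ph : p h = u by rewrite pu // eq_sym.
pose J := edges G :\ e0 :\ i :\ h :\ g.
have memJ e : e \in J -> [/\ e \in edges G, e != e0, e != i, e != h & e != g].
  by rewrite !in_setD1 => /and5P[].
have cJ : #|J| = (m.-1 - 3)%N.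
  rewrite -cE (cardsD1 e0 (edges G)) e0E (cardsD1 i (_ :\ e0)) in_setD1 ie0 iE.
  rewrite (cardsD1 h (_ :\ i)) !in_setD1 eq_sym ih he0 hE.
  rewrite (cardsD1 g (_ :\ h)) !in_setD1 gh gi ge0 gE -/J /= !add1n.
  by rewrite !subSS subn0.
pose petal (j : 'I_(m.-1 - 3)) := nth e0 (enum J) j.
have petalJ j : petal j \in J.
  by rewrite -mem_enum mem_nth // -cardE cJ.
have petal_inj : injective petal.
  move=> j j' /eqP; rewrite nth_uniq ?enum_uniq -?cardE ?cJ //.
  by move=> /eqP/val_inj.
pose phi (w : T1 m) : G := match w with
  | inl (inl c) => corner c
  | inl (inr j) => rep (petal j)
  | inr _ => rep g
  end.
have rep_in e f : e \in edges G -> f \in edges G -> f != i -> f != e0 ->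
    (rep f \in e) = (e == f) || (e == e0) && ((rep f == a) || (rep f == b)).
  move=> eE fE fi f0; rewrite mem_dec_edge // (mem_dec_C eE fE (repP fE)).
  case: (eqVneq e e0) => [//|ne]; rewrite orbF.
  have [->|eg] := eqVneq e g.
    rewrite pg; have -> : (rep f == a) = false; last by rewrite orbF.
    apply/eqP => ra; have := mem_dec_C iE fE (repP fE); rewrite ra aC => /esym/eqP if_.
    by rewrite if_ eqxx in fi.
  by rewrite pu // rep_u // orbF.
have rep_e0 f : f \in edges G -> f != i -> f != h ->
    (rep f == a) || (rep f == b) = false.
  move=> fE fi fh; apply/negbTE; rewrite negb_or.
  by rewrite (rep_corner (@Ordinal 3 1 isT)) // (rep_corner (@Ordinal 3 2 isT)).
have rep_mem e f : e \in edges G -> f \in edges G -> f != i -> f != h ->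
    f != e0 -> (rep f \in e) = (e == f).
  by move=> eE fE fi fh f0; rewrite rep_in // rep_e0 // andbF orbF.
have corner_off c e : e \in edges G -> e != i -> e != h -> (corner c \in C e) = false.
  move=> eE ei eh; apply/negP => /(corner_C eE)[] /eqP; exact/negP.
apply: (power_recognition_preim (phi := phi)) => //.
- exact: T1_uniform2.
- have rep_inj e f : e \in edges G -> f \in edges G -> rep e = rep f -> e = f.
    move=> eE fE ref; apply/eqP; rewrite -(mem_dec_C eE fE (repP fE)) -ref.
    exact: repP.
  move=> [[c|j]|j] [[c'|j']|j'] /= eq.
  + by rewrite (corner_inj eq).
  + have [jE j0 ji jh jg] := memJ _ (petalJ j').
    by have := rep_corner c jE ji jh; rewrite eq eqxx.
  + by have := rep_corner c gE gi gh; rewrite eq eqxx.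
  + have [jE j0 ji jh jg] := memJ _ (petalJ j).
    by have := rep_corner c' jE ji jh; rewrite eq eqxx.
  + have [jE _ _ _ _] := memJ _ (petalJ j); have [jE' _ _ _ _] := memJ _ (petalJ j').
    by rewrite (petal_inj _ _ (rep_inj _ _ jE jE' eq)).
  + have [jE _ _ _ jg] := memJ _ (petalJ j).
    by rewrite (rep_inj _ _ jE gE eq) eqxx in jg.
  + by have := rep_corner c' gE gi gh; rewrite eq eqxx.
  + have [jE _ _ _ jg] := memJ _ (petalJ j').
    by rewrite -(rep_inj _ _ gE jE eq) eqxx in jg.
  by rewrite [j]ord1 [j']ord1.
- by rewrite card_T1_edges // ltnW.
- move=> e /attach_edgesP[[f /attach_edgesP[[f' + ->]|[j ->]] ->]|[j ->]].
  + rewrite triangle_edges => /imsetP[c _ ->]; exists (side c); first exact: sideE.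
    apply/setP => w; rewrite inE mem_inl_set; case: w => [[d|j]|j] /=.
    * by rewrite mem_inl_set corner_side // !inE.
    * have [jE j0 ji jh jg] := memJ _ (petalJ j).
      by rewrite mem_inl_set rep_side.
    by rewrite rep_side.
  + have [jE j0 ji jh jg] := memJ _ (petalJ j).
    exists (petal j) => //; apply/setP => w; rewrite inE mem_inl_set.
    case: w => [[d|j']|j'] /=.
    * rewrite !inE tree_edge // pu // corner_off //=.
      by rewrite orbF -[u]/(corner ord0) (inj_eq corner_inj).
    * have [jE' j0' ji' jh' jg'] := memJ _ (petalJ j').
      by rewrite !inE rep_mem // (inj_eq petal_inj) eq_sym.
    by rewrite rep_mem // (negPf jg).
  exists g => //; apply/setP => w; rewrite !inE; case: w => [[d|j']|j'] /=.
  + rewrite ga corner_off //= orbF -[a]/(corner (@Ordinal 3 1 isT)).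
    rewrite (inj_eq corner_inj); congr (d == _).
    by apply/val_inj; rewrite /= inordK.
  + have [jE' j0' ji' jh' jg'] := memJ _ (petalJ j').
    by rewrite rep_mem // eq_sym (negPf jg').
  by rewrite rep_mem // eqxx [j']ord1 [j]ord1 ?eqxx ?orbT.
- move=> e f v eE fE ef ve vf.
  have pc e' : e' \in edges G -> e' != e0 -> exists c, p e' = corner c.
    move=> e'E ne; have [->|eg] := eqVneq e' g; first by exists (@Ordinal 3 1 isT).
    by exists ord0; rewrite pu.
  have := dec_shared_vertex eE fE ef ve vf.
  case/or4P=> [/eqP->|/eqP->|/andP[ne /eqP->]|/andP[ne /eqP->]].
  + by exists (inl (inl (@Ordinal 3 1 isT))).
  + by exists (inl (inl (@Ordinal 3 2 isT))).
  + by have [c ->] := pc e eE ne; exists (inl (inl c)).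
  by have [c ->] := pc f fE ne; exists (inl (inl c)).
by move=> v; apply: dec_covers_edges => //; rewrite star // eq_sym.
Qed.

End Shapes.

(** * The powers of S3 and T1 are linear and unicyclic *)

Section Reach.
Variable G : hypergraph.
Implicit Types u v w : G.

Definition reach u v := exists2 s, walk u s & walk_end u s = v.

Lemma reach_edge e v w : e \in edges G -> v \in e -> w \in e -> reach v w.
Proof. by move=> eE ve we; exists [:: (e, w)]; rewrite //= eE subUset !sub1set ve we. Qed.

Lemma reach_trans v u w : reach u v -> reach v w -> reach u w.
Proof.
move=> [s ws endv] [t wt endw]; exists (s ++ t); first by rewrite walk_cat ws endv.
by rewrite walk_end_cat endv.
Qed.

Lemma reach_sym u v : reach u v -> reach v u.
Proof.
by move=> [s /reverse_walk[t [wt endt _]] ends]; rewrite ends in wt endt; exists t.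
Qed.

Lemma connected_from_root u : (forall v, reach u v) -> hypergraph_connected G.
Proof. by move=> ru v w; apply: reach_trans (ru w); exact: reach_sym. Qed.

End Reach.

Lemma reach_map (H G : hypergraph) (phi : H -> G) (x y : H) :
  (forall e v w, e \in edges H -> v \in e -> w \in e -> reach (phi v) (phi w)) ->
  reach x y -> reach (phi x) (phi y).
Proof.
move=> adj [s ws <-] {y}; elim: s x ws => [|[e w] s IHs] x /=.
  by exists [::].
case/and3P=> eE; rewrite subUset !sub1set => /andP[xe we] /IHs.
exact/reach_trans/(adj e).
Qed.

(** A connected hypergraph with a triangle on whose corners all intersections of
    edges take place; in particular all cycles run through the corners.  This is
    preserved by attaching pendent edges at a corner and by taking powers. *)
Record triangular (H : hypergraph) (corner : 'I_3 -> H) : Prop := Triangular {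
  tri_connected : hypergraph_connected H;
  tri_side : forall d, exists2 f, f \in edges H &
    forall c, (corner c \in f) = (c != d);
  tri_shared : forall e f v, e \in edges H -> f \in edges H -> e != f ->
    v \in e -> v \in f -> exists c, v = corner c
}.

Lemma triangle_triangular : @triangular triangle id.
Proof.
have side (d : 'I_3) : [set~ d] \in edges triangle.
  by rewrite triangle_edges; apply/imsetP; exists d.
split; last by move=> e f v; exists v.
  move=> u v; have [->|uv] := eqVneq u v; first by exists [::].
  have [d du dv] : exists2 d : 'I_3, u != d & v != d.
    have /card_gt0P[d] : (0 < #|~: [set u; v]|)%N by rewrite cardsCs setCK card_ord cards2 uv.
    by rewrite !inE negb_or => /andP[du dv]; exists d; rewrite eq_sym.
  by apply: (reach_edge (side d)); rewrite !inE.
by move=> d; exists [set~ d] => // c; rewrite !inE.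
Qed.

Lemma attach_triangular (H : hypergraph) corner c0 (p : nat) :
  triangular corner ->
  @triangular (attach_pendents (corner c0 : H) p) (fun c => inl (corner c)).
Proof.
move=> [conn side shared]; set K := attach_pendents _ _; split.
- have step e v w : e \in edges H -> v \in e -> w \in e ->
      @reach K (inl v) (inl w).
    move=> eE ve we; apply: (@reach_edge K [set (inl x : H + 'I_p) | x in e]).
    + by apply/attach_edgesP; left; exists e.
    + by rewrite mem_inl_set.
    by rewrite mem_inl_set.
  apply: (@connected_from_root K (inl (corner c0))) => -[v|i].
    exact: (reach_map step) (conn _ _).
  apply: (@reach_edge K [set (inl (corner c0) : H + 'I_p); inr i]).
  + by apply/attach_edgesP; right; exists i.
  + by rewrite !inE eqxx.
  by rewrite !inE eqxx orbT.
- move=> d; have [f fE fc] := side d; exists [set (inl x : H + 'I_p) | x in f].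
    by apply/attach_edgesP; left; exists f.
  by move=> c; rewrite mem_inl_set.
move=> e f v /attach_edgesP[[e' eE ->]|[i ->]] /attach_edgesP[[f' fE ->]|[j ->]] ef.
- rewrite !mem_inl_set; case: v => // v ve vf.
  have [|c ->] := shared e' f' v eE fE _ ve vf; last by exists c.
  by apply: contraNneq ef => ->.
- rewrite mem_inl_set; case: v => // v _.
  by rewrite !inE => /orP[/eqP[->]|//]; exists c0.
- move=> + /[!mem_inl_set]; case: v => // v + _.
  by rewrite !inE => /orP[/eqP[->]|//]; exists c0.
rewrite !inE => /orP[/eqP->|/eqP->]; first by exists c0.
by move=> /orP[//|/eqP[ij]]; rewrite ij eqxx in ef.
Qed.

(** The new vertices of a power lie on one edge each. *)
Lemma power_edge_shared (H : hypergraph) k (e f : {e : {set H} | e \in edges H}) v :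
  e != f -> v \in power_edge k e -> v \in power_edge k f ->
  exists2 x, v = inl x & (x \in val e) && (x \in val f).
Proof.
move=> ef; case: v => [x|[g j]].
  by rewrite !inl_power_edge => xe xf; exists x; rewrite // xe.
by rewrite !inr_power_edge => /eqP-> /eqP fe; rewrite fe eqxx in ef.
Qed.

Lemma power_triangular (H : hypergraph) corner (k : nat) : uniform 2 H ->
  triangular corner -> @triangular (power H k) (fun c => inl (corner c : H)).
Proof.
move=> H2 [conn side shared]; set K := power H k; split.
- have edgeK (e : {e : {set H} | e \in edges H}) : power_edge k e \in edges K.
    by apply/power_edgesP; exists e.
  have step e v w : e \in edges H -> v \in e -> w \in e ->
      @reach K (inl v) (inl w).
    move=> eE ve we; apply: (reach_edge (edgeK (exist _ e eE))).
      by rewrite inl_power_edge.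
    by rewrite inl_power_edge.
  apply: (@connected_from_root K (inl (corner ord0))) => -[v|[e j]].
    exact: (reach_map step) (conn _ _).
  have /card_gt0P[v ve] : (0 < #|val e|)%N by rewrite (H2 _ (valP e)).
  apply: (@reach_trans K (inl v)); first exact: (reach_map step) (conn _ _).
  by apply: (reach_edge (edgeK e)); rewrite ?inl_power_edge ?inr_power_edge.
- move=> d; have [f fE fc] := side d; exists (power_edge k (exist _ f fE)).
    by apply/power_edgesP; exists (exist _ f fE).
  by move=> c; rewrite inl_power_edge.
move=> _ _ v /power_edgesP[e ->] /power_edgesP[f ->] ef ve vf.
have ef' : e != f by apply: contraNneq ef => ->.
have [x -> /andP[xe xf]] := power_edge_shared ef' ve vf.
by have [c ->] := shared _ _ x (valP e) (valP f) ef' xe xf; exists c.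
Qed.

Lemma power_linear (H : hypergraph) k : uniform 2 H -> linear_hypergraph (power H k).
Proof.
move=> H2 _ _ /power_edgesP[e ->] /power_edgesP[f ->] ef.
have {ef} ef : e != f by apply: contraNneq ef => ->.
rewrite leqNgt; apply/negP => /card_gt1P[v [w []]].
rewrite !in_setI => /andP[ve vf] /andP[we wf] vw.
have [x vx /andP[xe xf]] := power_edge_shared ef ve vf.
have [y wy /andP[ye yf]] := power_edge_shared ef we wf.
have xy : x != y by apply: contraNneq vw => xy; rewrite vx wy xy.
have two (g : {e : {set H} | e \in edges H}) : x \in val g -> y \in val g ->
    val g = [set x; y].
  move=> xg yg; apply/esym/eqP; rewrite eqEcard subUset !sub1set xg yg cards2 xy.
  by rewrite (H2 _ (valP g)).
have := two e xe ye; rewrite -(two f xf yf) => /val_inj/eqP.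
by rewrite (negPf ef).
Qed.

Lemma power_uniform (H : hypergraph) k : (2 <= k)%N -> uniform 2 H ->
  uniform k (power H k).
Proof.
move=> k2 H2 _ /power_edgesP[e ->]; rewrite cardsU.
have -> : [set (inl v : power_vertex H k) | v in val e] :&:
    [set inr (e, j) | j : 'I_(k - 2)] = set0.
  apply/setP => w; rewrite in_setI !in_set0; apply/negP.
  by move=> /andP[/imsetP[v _ ->] /imsetP[]].
rewrite cards0 subn0 !card_imset ?card_ord ?(H2 _ (valP e)) ?subnKC //.
  by move=> j j' [].
by move=> v w [].
Qed.

Lemma power_edge_inj (H : hypergraph) k : uniform 2 H -> injective (@power_edge H k).
Proof.
move=> H2 e f ef; apply: val_inj; apply/setP => v.
by rewrite -!(inl_power_edge k) ef.
Qed.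

Lemma edges_power (H : hypergraph) k :
  edges (power H k) = [set power_edge k e | e : {e : {set H} | e \in edges H}].
Proof. by []. Qed.

Lemma card_power_edges (H : hypergraph) k : uniform 2 H ->
  #|edges (power H k)| = #|edges H|.
Proof.
by move=> H2; rewrite edges_power card_imset ?card_sig //; exact: power_edge_inj.
Qed.

(** A vertex of a cycle lies on two edges, hence is a corner; so a cycle has at most
    three vertices.  Length two contradicts linearity, and a cycle of length three
    is one of the six ways to write the triangle. *)
Lemma triangular_unicyclic (G : hypergraph) corner :
  linear_hypergraph G -> @triangular G corner -> unicyclic G.
Proof.
move=> linG [conn side shared]; split=> //.
have corner_inj : injective corner.
  move=> c d cd; have [f _ fc] := side d.
  by apply/eqP/negPn; rewrite -fc cd fc eqxx.
pose o1 : 'I_3 := @Ordinal 3 1 isT; pose o2 : 'I_3 := @Ordinal 3 2 isT.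
have [f0 f0E f0c] := side ord0; have [f1 f1E f1c] := side o1.
have [f2 f2E f2c] := side o2.
have f01 : f0 != f1 by apply/eqP => e; have := f0c ord0; rewrite e f1c.
have f02 : f0 != f2 by apply/eqP => e; have := f0c ord0; rewrite e f2c.
have f12 : f1 != f2 by apply/eqP => e; have := f1c o1; rewrite e f2c.
pose s := [:: (f2, corner o1); (f0, corner o2); (f1, corner ord0)].
have cs : is_cycle (corner ord0) s.
  split=> //=.
  - by rewrite f0E f1E f2E !subUset !sub1set !f0c !f1c !f2c.
  - by rewrite !inE negb_or [f2 == f0]eq_sym [f2 == f1]eq_sym f02 f12 f01.
  by rewrite !inE !(inj_eq corner_inj).
exists (corner ord0), s; split=> // w t ct.
have [wt endt t2 u1 u2] := ct.
have vert x : x \in unzip2 t -> exists c, x = corner c.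
  case/mapP=> -[e x'] et /= ->.
  have [f [ft fe xf]] := cycle_next_edge ct et.
  have eE : e \in edges G by apply: walk_edges wt _ _; apply/mapP; exists (e, x').
  have fE : f \in edges G by exact: walk_edges wt _ ft.
  apply: (shared e f) => //; first by rewrite eq_sym.
  exact: walk_mem_vertex wt et.
have size_t : (size t <= 3)%N.
  have : (size (unzip2 t) <= size (map corner (enum 'I_3)))%N.
    apply: uniq_leq_size u2 _ => x /vert[c ->].
    by apply/mapP; exists c; rewrite // mem_enum.
  by rewrite (size_map snd t) (size_map corner) -cardE card_ord.
have edge_eq e c d g : e \in edges G -> c != g -> d != g -> c != d ->
    corner c \in e -> corner d \in e -> e = tnth [tuple f0; f1; f2] g.
  move=> eE cg dg cd ce de; case: g cg dg => [[|[|[|//]]] lg] cg dg.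
  - by apply: (linear_eq linG eE f0E _ ce de); rewrite ?f0c // inj_eq.
  - by apply: (linear_eq linG eE f1E _ ce de); rewrite ?f1c // inj_eq.
  by apply: (linear_eq linG eE f2E _ ce de); rewrite ?f2c // inj_eq.
case: t ct wt endt t2 u1 u2 vert size_t => // -[e1 x1] [//|[e2 x2] [|[e3 x3] [|//]]];
  rewrite /walk_end /= !subUset !sub1set => ct wt endt t2 u1 u2 vert _.
  move: wt u1 u2; rewrite endt !inE !andbT.
  move=> /and3P[e1E /andP[we1 x1e1] /and3P[e2E x1e2 we2]] e12 x1w.
  by rewrite (linear_eq linG e1E e2E x1w x1e1 we1 x1e2 we2) eqxx in e12.
have [c1 x1c] := vert x1 (mem_head _ _).
have [c2 x2c] : exists c, x2 = corner c by apply: vert; rewrite !inE eqxx orbT.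
have [c3 x3c] : exists c, x3 = corner c by apply: vert; rewrite !inE eqxx !orbT.
move: wt u2; rewrite -endt x1c x2c x3c !inE !(inj_eq corner_inj) !andbT negb_or.
move=> /andP[e1E /andP[/andP[e1c3 e1c1] /andP[e2E /andP[/andP[e2c1 e2c2]]]]].
move=> /andP[e3E /andP[e3c2 e3c3]].
move=> /andP[/andP[c12 c13] c23].
have c21 : c2 != c1 by rewrite eq_sym.
have c31 : c3 != c1 by rewrite eq_sym.
have c32 : c3 != c2 by rewrite eq_sym.
rewrite (edge_eq e1 c1 c3 c2 e1E c12 c32 c13 e1c1 e1c3).
rewrite (edge_eq e2 c1 c2 c3 e2E c13 c23 c12 e2c1 e2c2).
rewrite (edge_eq e3 c2 c3 c1 e3E c21 c31 c23 e3c2 e3c3).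
move: c12 c13 c23; clear -s; rewrite /s => {s}.
have cases (c : 'I_3) : [\/ c = ord0, c = o1 | c = o2].
  case: c => [[|[|[|//]]] lc]; [apply: Or31|apply: Or32|apply: Or33];
    exact: val_inj.
by case: (cases c1) => ->; case: (cases c2) => -> //;
  case: (cases c3) => -> // _ _ _;
  first [by exists 0%N; left | by exists 1%N; left | by exists 2%N; left
        | by exists 0%N; right | by exists 1%N; right | by exists 2%N; right].
Qed.

Lemma power_linear_unicyclic (H : hypergraph) corner k : (2 <= k)%N ->
  uniform 2 H -> @triangular H corner ->
  linear_unicyclic k #|edges H| (power H k).
Proof.
move=> k2 H2 tri; split; [exact: power_linear| |exact: power_uniform|].
  exact: (triangular_unicyclic (power_linear (k := k) H2) (power_triangular k H2 tri)).
exact: card_power_edges.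
Qed.

Lemma S3_triangular m : triangular (fun c : 'I_3 => inl c : S3 m).
Proof. exact: (attach_triangular ord0 _ triangle_triangular). Qed.

Lemma power_S3_linear_unicyclic k m : (2 <= k)%N -> (3 <= m)%N ->
  linear_unicyclic k m (power (S3 m) k).
Proof.
move=> k2 m3; rewrite -{1}(card_S3_edges m3).
exact: power_linear_unicyclic k2 (@S3_uniform2 m) (S3_triangular m).
Qed.

Lemma power_T1_linear_unicyclic k m : (2 <= k)%N -> (4 <= m)%N ->
  linear_unicyclic k m (power (T1 m) k).
Proof.
move=> k2 m4; rewrite -{1}(card_T1_edges m4).
apply: (power_linear_unicyclic k2 (@T1_uniform2 m)).
exact: (attach_triangular (inord 1) 1 (S3_triangular m.-1)).
Qed.

(** * Radii of powers *)

Section Isomorphism.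
Variables (G H : hypergraph) (f : G -> H).
Hypothesis f_bij : bijective f.
Hypothesis f_edges : forall e : {set G}, (e \in edges G) = (f @: e \in edges H).

Let f_inj : injective f := bij_inj f_bij.

Lemma iso_edges : edges H = [set f @: (e : {set G}) | e : {set G} in edges G].
Proof.
have [g fK gK] := f_bij; apply/setP => A; apply/idP/imsetP => [AE|[e eE ->]].
  have gA : A = f @: (g @: A).
    rewrite -imset_comp -[LHS]imset_id; apply: eq_imset => v /=.
    by rewrite gK.
  by exists (g @: A); rewrite // f_edges -gA.
by rewrite -f_edges.
Qed.

Lemma iso_uniform k : uniform k G -> uniform k H.
Proof.
move=> Gk A; rewrite iso_edges => /imsetP[e eE ->].
by rewrite card_imset ?Gk.
Qed.

Lemma iso_edge_form (R : realType) (x : H -> R) : edge_form (x \o f) = edge_form x.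
Proof.
rewrite /edge_form iso_edges big_imset /=; last first.
  by move=> e e' _ _; exact: imset_inj.
by apply: eq_bigr => e _; rewrite big_imset //= => v w _ _; exact: f_inj.
Qed.

Lemma iso_mass (R : realType) k (x : H -> R) : mass k (x \o f) = mass k x.
Proof.
have [g fK gK] := f_bij.
by rewrite /mass [RHS](reindex f) //; exists g => v _.
Qed.

End Isomorphism.

Lemma isomorphic_sym (G H : hypergraph) : isomorphic G H -> isomorphic H G.
Proof.
case=> f [g fK gK] fE; exists g; first by exists f.
move=> A; rewrite fE; have -> // : f @: (g @: A) = A.
by rewrite -imset_comp -[RHS]imset_id; apply: eq_imset => v /=; rewrite gK.
Qed.

Lemma spectral_radius_iso (R : realType) (k : nat) (G H : hypergraph) :
  (1 < k)%N -> uniform k G -> isomorphic G H ->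
  spectral_radius R k G = spectral_radius R k H.
Proof.
have le (A B : hypergraph) : (1 < k)%N -> uniform k A -> uniform k B ->
    isomorphic A B -> spectral_radius R k B <= spectral_radius R k A.
  move=> k1 Ak Bk [f f_bij f_edges].
  have [y [y0 my -> _ _]] := spectral_radius_variational R k1 Bk.
  have [x [_ _ _ maxA _]] := spectral_radius_variational R k1 Ak.
  have := maxA (y \o f) (fun v => y0 (f v)).
  by rewrite (iso_edge_form f_bij f_edges) (iso_mass f_bij) my mulr1.
move=> k1 Gk iso; have Hk : uniform k H.
  by have [f f_bij f_edges] := iso; exact: iso_uniform f_bij f_edges _ Gk.
by apply/eqP; rewrite eq_le (le H G) ?(le G H) //; exact: isomorphic_sym.
Qed.

(** A positive vector [y] on the graph is lifted to the power: [y v ^+ 2] and, for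
    the new vertices of the edge [i j], [y i * y j / lam], all under a k-th root.
    For an eigenvector this is the eigenvector of the power; in general the gain of
    the form over [rho / k] times the mass is, up to a positive factor, that of the
    quadratic form of [y] over [lam / 2] times its square norm. *)
Section PowerTest.
Variables (R : realType) (k : nat) (H : hypergraph) (y : H -> R) (lam rho : R).
Hypotheses (k2 : (2 <= k)%N) (H2 : uniform 2 H) (y0 : forall v, 0 < y v).
Hypotheses (lam0 : 0 < lam) (rho0 : 0 < rho) (rhoX : rho ^+ k = lam ^+ 2).

Lemma sum_sig_edges (F : {set H} -> R) :
  \sum_(e : {e : {set H} | e \in edges H}) F (val e) = \sum_(e in edges H) F e.
Proof.
rewrite [RHS](reindex_omap (val : {e | e \in edges H} -> _) insub) /=.
  by apply: eq_bigl => e; rewrite valK eqxx (valP e).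
by move=> e eE; rewrite insubT.
Qed.

Lemma power_test_vector : exists x : power H k -> R,
  [/\ forall w, 0 <= x w,
      k%:R * edge_form x = rho * (k%:R * edge_form y / lam) &
      mass k x = mass 2 y + (k - 2)%:R * (edge_form y / lam)].
Proof.
have k0 : (0 < k)%N by exact: ltnW.
have kn0 : k%:R != 0 :> R by rewrite pnatr_eq0 -lt0n.
pose root (t : R) := t `^ (k%:R)^-1.
have root_ge0 t : 0 <= root t by exact: powR_ge0.
have rootX t : 0 <= t -> root t ^+ k = t.
  by move=> t0; rewrite -powR_mulrn // -powRrM mulVf // powRr1.
pose P (e : {set H}) := \prod_(v in e) y v.
have P0 e : 0 < P e by exact: prodr_gt0.
pose x (w : power H k) : R := match w with
  | inl v => root (y v ^+ 2)
  | inr (e, _) => root (P (val e) / lam)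
  end.
have x0 w : 0 <= x w by case: w => [v|[e j]]; exact: root_ge0.
have prodx e : \prod_(w in power_edge k e) x w = rho / lam * P (val e).
  have -> : \prod_(w in power_edge k e) x w =
      (\prod_(v in val e) root (y v ^+ 2)) * root (P (val e) / lam) ^+ (k - 2).
    rewrite (eq_bigl _ _ (fun w => in_setU w _ _)) bigU /=; last first.
      rewrite -setI_eq0; apply/eqP/setP => w; rewrite in_setI in_set0.
      by apply/negP => /andP[/imsetP[v _ ->] /imsetP[]].
    rewrite big_imset /=; last by move=> v w _ _ [].
    rewrite big_imset /=; last by move=> j j' _ _ [].
    by rewrite prodr_const card_ord.
  apply/eqP; rewrite -(eqrXn2 k0); last 2 first.
  - by rewrite mulr_ge0 ?exprn_ge0 // prodr_ge0.
  - by rewrite mulr_ge0 ?divr_ge0 // ltW.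
  have prod_root : (\prod_(v in val e) root (y v ^+ 2)) ^+ k = P (val e) ^+ 2.
    rewrite -!prodrXl; apply: eq_bigr => v _.
    by rewrite rootX // exprn_ge0 // ltW.
  rewrite exprMn prod_root -exprM mulnC exprM rootX ?divr_ge0 ?ltW //.
  rewrite !exprMn !exprVn rhoX.
  have kE : k = (k - 2 + 2)%N by rewrite subnK.
  rewrite [in X in _ == X]kE !exprD; apply/eqP; field.
  by rewrite !expf_neq0 // lt0r_neq0.
have formx : edge_form x = rho / lam * edge_form y.
  rewrite /edge_form edges_power big_imset /=; last first.
    by move=> e f _ _; exact: power_edge_inj.
  under eq_bigr do rewrite prodx.
  by rewrite -big_distrr /= (sum_sig_edges P).
exists x; split => //; first by rewrite formx; ring.
rewrite /mass big_sumType /=; congr (_ + _).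
  by apply: eq_bigr => v _; rewrite rootX // exprn_ge0 // ltW.
rewrite (eq_bigr (fun w : {e | e \in edges H} * 'I_(k - 2) => P (val w.1) / lam)).
  rewrite -(pair_bigA _ (fun e _ => P (val e) / lam)) /=.
  under eq_bigr do rewrite sumr_const card_ord -mulr_natl.
  by rewrite -big_distrr /= -big_distrl /= (sum_sig_edges P).
by move=> [e j] _; rewrite /= rootX // divr_ge0 // ltW.
Qed.

Lemma power_radius_ge : lam * mass 2 y <= 2 * edge_form y ->
  rho <= spectral_radius R k (power H k) /\
  (lam * mass 2 y < 2 * edge_form y -> rho < spectral_radius R k (power H k)).
Proof.
move=> le_Q; have [x [x0 formx massx]] := power_test_vector.
have [z [_ _ _ maxr _]] := spectral_radius_variational R k2 (power_uniform k2 H2).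
have := maxr x x0; rewrite formx massx.
have m2 : 0 < mass 2 y.
  have /card_gt0P[v _] := vertex_gt0 H.
  by apply: (@mass_gt0 _ _ _ _ v) => // w; exact: ltW.
have Q0 : 0 <= edge_form y by apply: edge_form_ge0 => v; exact: ltW.
have M0 : 0 < mass 2 y + (k - 2)%:R * (edge_form y / lam).
  by rewrite ltr_wpDr // mulr_ge0 ?ler0n // divr_ge0 // ltW.
have kE : k%:R = (k - 2)%:R + 2 :> R by rewrite -natrD subnK.
have gain : k%:R * edge_form y / lam - (mass 2 y + (k - 2)%:R * (edge_form y / lam)) =
    (2 * edge_form y - lam * mass 2 y) / lam.
  by rewrite kE; field; rewrite lt0r_neq0.
move=> le_r; split=> [|lt_Q].
  rewrite -(ler_pM2r M0); apply: le_trans le_r; rewrite ler_pM2l // -subr_ge0 gain.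
  by rewrite divr_ge0 ?subr_ge0 // ltW.
rewrite -(ltr_pM2r M0); apply: lt_le_trans le_r; rewrite ltr_pM2l // -subr_gt0 gain.
by rewrite divr_gt0 ?subr_gt0.
Qed.

End PowerTest.

Lemma edge_form_attach (R : realType) (H : hypergraph) (v : H) p
    (y : attach_pendents v p -> R) :
  edge_form y = edge_form (fun w : H => y (inl w)) + \sum_i y (inl v) * y (inr i).
Proof.
rewrite /edge_form sum_attach_edges; congr (_ + _); apply: eq_bigr => e _.
  by rewrite big_imset //= => a b _ _ [].
by rewrite big_setU1 ?inE //= big_set1.
Qed.

Lemma mass_attach (R : realType) k (H : hypergraph) (v : H) p
    (y : attach_pendents v p -> R) :
  mass k y = mass k (fun w : H => y (inl w)) + \sum_i y (inr i) ^+ k.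
Proof. by rewrite /mass big_sumType. Qed.

Definition corners (R : realType) (A B C : R) (c : 'I_3) : R := nth 0 [:: A; B; C] c.

Lemma edge_form_triangle (R : realType) (A B C : R) :
  @edge_form R triangle (corners A B C) = A * B + A * C + B * C.
Proof.
rewrite /edge_form sum_triangle_edges /=.
have prodC (c : 'I_3) : \prod_(v in [set~ c]) corners A B C v =
    \prod_(v < 3) if v != c then corners A B C v else 1.
  by rewrite big_mkcond; apply: eq_bigr => v _; rewrite !inE.
rewrite (eq_bigr _ (fun c _ => prodC c)).
rewrite !big_ord_recl !big_ord0 /corners /=; ring.
Qed.

Lemma mass_triangle (R : realType) k (A B C : R) :
  mass k (corners A B C) = A ^+ k + B ^+ k + C ^+ k.
Proof. by rewrite /mass !big_ord_recl big_ord0 /corners /= addr0 addrA. Qed.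

Lemma corners_gt0 (R : realType) (A B C : R) c : 0 < A -> 0 < B -> 0 < C ->
  0 < corners A B C c.
Proof. by case: c => [[|[|[|]]]]. Qed.

Section Radii.
Variables (R : realType) (k n : nat) (lam rho : R).
Hypotheses (k3 : (3 <= k)%N) (lamP : bull_root n lam).
Hypotheses (rho0 : 0 < rho) (rhoX : rho ^+ k = lam ^+ 2).

Let k2 : (2 <= k)%N. Proof. exact: ltnW. Qed.
Let lam2 : 2 < lam. Proof. by case: lamP. Qed.
Let lam0 : 0 < lam. Proof. exact: lt_trans lam2. Qed.

Lemma power_T1_radius_ge : rho <= spectral_radius R k (power (T1 (n + 4)) k).
Proof.
pose y0 := lam ^+ 2 - 2; pose ya := lam + 1; pose yb := (lam ^+ 2 + lam - 1) / lam.
have y0_gt0 : 0 < y0 by have := lam2; rewrite /y0; nra.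
have ya_gt0 : 0 < ya by have := lam2; rewrite /ya; lra.
have yb_gt0 : 0 < yb.
  by rewrite divr_gt0 //; have := y0_gt0; have := lam2; rewrite /y0; lra.
pose y (w : T1 (n + 4)) : R := match w with
  | inl (inl c) => corners y0 ya yb c
  | inl (inr _) => y0 / lam
  | inr _ => ya / lam
  end.
have ypos w : 0 < y w.
  case: w => [[c|j]|j] /=; [exact: corners_gt0|exact: divr_gt0|exact: divr_gt0].
have cn : ((n + 4).-1 - 3)%N = n by rewrite addnS /= addnK.
have formE : edge_form y = y0 * ya + y0 * yb + ya * yb + n%:R * (y0 * (y0 / lam)) +
    ya * (ya / lam).
  rewrite edge_form_attach edge_form_attach /= edge_form_triangle.
  rewrite !sumr_const !card_ord cn -(mulr_natl (y0 * _) n); congr (_ + _).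
  by rewrite mulr1n /corners inordK.
have massE : mass 2 y = y0 ^+ 2 + ya ^+ 2 + yb ^+ 2 + n%:R * (y0 / lam) ^+ 2 +
    (ya / lam) ^+ 2.
  rewrite mass_attach mass_attach /= mass_triangle !sumr_const !card_ord cn.
  by rewrite -(mulr_natl (_ ^+ 2) n) mulr1n.
have [] // := power_radius_ge k2 (@T1_uniform2 _) ypos lam0 rho0 rhoX.
rewrite formE massE le_eqVlt; apply/orP; left; apply/eqP.
have [_ root] := lamP.
have nE : n%:R = (lam ^+ 4 - 4 * lam ^+ 2 - 2 * lam + 1) / (lam ^+ 2 - 2).
  apply: (canRL (mulfK (lt0r_neq0 y0_gt0))); apply/esym/subr0_eq.
  by rewrite -[RHS]root /y0; ring.
rewrite nE /yb /ya /y0; field.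
by rewrite (lt0r_neq0 y0_gt0) lt0r_neq0.
Qed.

(** The test vector is the solution of the eigenvalue equations of [S3 (n + 4)] at
    all vertices but the centre, for [lam] instead of the eigenvalue.  The defect
    at the centre is a multiple of [lam ^+ 3 - lam ^+ 2 - (n + 3) * lam + n + 1],
    which equals [- n / (lam + 1)] by the equation of [lam]. *)
Lemma power_S3_radius_gt : (0 < n)%N ->
  rho < spectral_radius R k (power (S3 (n + 4)) k).
Proof.
move=> n_gt0; have n0 : 0 < n%:R :> R by rewrite ltr0n.
have lam1 : 0 < lam - 1 by have := lam2; lra.
pose y (w : S3 (n + 4)) : R := match w with
  | inl c => corners (lam - 1) 1 1 c
  | inr _ => (lam - 1) / lam
  end.
have ypos w : 0 < y w.
  by case: w => [c|j] /=; [exact: corners_gt0|exact: divr_gt0].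
have cn : (n + 4 - 3)%N = n.+1 by rewrite -addnBA // addn1.
have formE : edge_form y = 2 * (lam - 1) + 1 + (n%:R + 1) * ((lam - 1) * ((lam - 1) / lam)).
  rewrite edge_form_attach /= edge_form_triangle.
  rewrite !sumr_const !card_ord cn -(mulr_natl (_ * _) n.+1) -natr1.
  by rewrite /corners /=; ring.
have massE : mass 2 y = (lam - 1) ^+ 2 + 2 + (n%:R + 1) * ((lam - 1) / lam) ^+ 2.
  rewrite mass_attach /= mass_triangle !sumr_const !card_ord cn.
  by rewrite -(mulr_natl (_ ^+ 2) n.+1) -natr1; ring.
have [_ root] := lamP.
have gap : 2 * edge_form y - lam * mass 2 y = (lam - 1) / lam * (n%:R / (lam + 1)).
  have -> : n%:R / (lam + 1) =
      - (lam ^+ 3 - lam ^+ 2 - (n%:R + 3) * lam + n%:R + 1).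
    have lam1' : lam + 1 != 0 by rewrite lt0r_neq0 // addr_gt0.
    apply: (canLR (mulfK lam1')); apply: subr0_eq.
    by rewrite -[RHS]root; ring.
  by rewrite formE massE; field; rewrite lt0r_neq0.
have lt_Q : lam * mass 2 y < 2 * edge_form y.
  rewrite -subr_gt0 gap mulr_gt0 // divr_gt0 // addr_gt0 //.
by have [|_ ->] := power_radius_ge k2 (@S3_uniform2 _) ypos lam0 rho0 rhoX; first exact: ltW.
Qed.

End Radii.

(** This holds for the power of [S3 m], with its centre, and separates it from the
    power of [T1 m]. *)
Definition almost_star (G : hypergraph) : Prop := exists u : G, forall e f : {set G},
  e \in edges G -> f \in edges G -> u \notin e -> u \notin f -> e = f.

(** The pendent edges [far] and [near] at the two centres are disjoint, and each of
    them is disjoint from the side of the triangle opposite to its own centre; so a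
    vertex on one of them misses the other and that side. *)
Lemma power_T1_not_almost_star k n : (0 < n)%N -> ~ almost_star (power (T1 (n + 4)) k).
Proof.
move=> n_gt0 [u avoid].
pose H := T1 (n + 4); pose c1 : 'I_3 := inord 1.
have j : 'I_((n + 4).-1 - 3) by apply: (@Ordinal _ 0); rewrite addnS /= addnK.
pose far : {set H} := [set inl (inl c1); inr ord0].
pose near : {set H} := [set inl w | w in [set inl ord0; inr j] : {set S3 (n + 4).-1}].
pose side (c : 'I_3) : {set H} :=
  [set inl w | w in [set inl d | d in [set~ c]] : {set S3 (n + 4).-1}].
have farE : far \in edges H by apply/attach_edgesP; right; exists ord0.
have nearE : near \in edges H.
  apply/attach_edgesP; left; exists [set inl ord0; inr j] => //.
  by apply/attach_edgesP; right; exists j.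
have sideE c : side c \in edges H.
  apply/attach_edgesP; left; exists [set inl d | d in [set~ c]] => //.
  apply/attach_edgesP; left; exists [set~ c] => //.
  by rewrite triangle_edges; apply/imsetP; exists c.
have far_in w : (w \in far) = (w == inl (inl c1)) || (w == inr ord0) by rewrite !inE.
have near_in w : (w \in near) = (w == inl (inl ord0)) || (w == inl (inr j)).
  by rewrite mem_inl_set; case: w => // w; rewrite !inE.
have side_in c w : (w \in side c) = if w is inl (inl d) then d != c else false.
  by rewrite mem_inl_set; case: w => // w; rewrite mem_inl_set; case: w => // d; rewrite !inE.
have c10 : c1 != ord0 by apply/eqP => /(congr1 val); rewrite /= inordK.
pose pe (e : {set H}) (eE : e \in edges H) := power_edge k (exist _ e eE).
have apart e f (eE : e \in edges H) (fE : f \in edges H) :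
    (forall w, w \in e -> w \in f -> False) -> u \in pe e eE -> u \notin pe f fE.
  move=> disj ue; apply/negP => uf.
  have ef : exist _ e eE != exist _ f fE.
    apply/eqP => [[ef]]; have /card_gt0P[w we] : (0 < #|e|)%N by rewrite (@T1_uniform2 _ _ eE).
    by apply: (disj w we); rewrite -ef.
  by have [w _ /andP[/= we /(disj _ we)]] := power_edge_shared ef ue uf.
have same e f (eE : e \in edges H) (fE : f \in edges H) :
    u \notin pe e eE -> u \notin pe f fE -> e = f.
  move=> ue uf; have : pe e eE = pe f fE.
    by apply: avoid => //; apply/power_edgesP; [exists (exist _ e eE)|exists (exist _ f fE)].
  by move=> /(power_edge_inj (@T1_uniform2 _)) [].
have [u_far|u_far] := boolP (u \in pe far farE).
  have u_near : u \notin pe near nearE.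
    apply: apart u_far => w; rewrite far_in near_in => /orP[/eqP->|/eqP->] //.
    by rewrite orbF => /eqP[] /eqP; apply/negP.
  have u_side : u \notin pe (side c1) (sideE c1).
    apply: apart u_far => w; rewrite far_in side_in => /orP[/eqP->|/eqP->] //.
    by rewrite eqxx.
  have /setP/(_ (inl (inr j))) := same _ _ _ _ u_near u_side.
  by rewrite near_in side_in eqxx orbT.
have [u_near|u_near] := boolP (u \in pe near nearE); last first.
  have /setP/(_ (inr ord0)) := same _ _ _ _ u_far u_near.
  by rewrite far_in near_in eqxx orbT.
have u_side : u \notin pe (side ord0) (sideE ord0).
  apply: apart u_near => w; rewrite near_in side_in => /orP[/eqP->|/eqP->] //.
have /setP/(_ (inr ord0)) := same _ _ _ _ u_far u_side.
by rewrite far_in side_in eqxx orbT.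
Qed.

(** * The second largest radius *)

(** With [u] a maximal entry of the maximiser, [G] has the shape of the power of
    [S3] if all edges but the closing one contain [u], and the exchanges of the
    previous parts apply otherwise. *)
Lemma large_radius_classification (R : realType) (k n : nat) (lam rho : R)
    (G : hypergraph) :
  (3 <= k)%N -> (0 < n)%N -> linear_unicyclic k (n + 4) G ->
  bull_root n lam -> 0 < rho -> rho ^+ k = lam ^+ 2 ->
  rho <= spectral_radius R k G ->
  (almost_star G /\ isomorphic G (power (S3 (n + 4)) k)) \/
  (isomorphic G (power (T1 (n + 4)) k) /\ spectral_radius R k G <= rho).
Proof.
move=> k3 n0 luG lamP rho0 rhoX le_rho; have [linG uniG Gk cE] := luG.
have k2 : (1 < k)%N by exact: ltnW.
have [x [x0 m1 radius _ eig]] := spectral_radius_variational R k2 Gk.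
have [v0 _] : exists v0 : G, true.
  by have /card_gt0P[v0 _] := vertex_gt0 G; exists v0.
have [u maxu] : exists u, forall v, x v <= x u.
  have [u _ maxu] := arg_maxP x (isT : xpredT v0).
  by exists u => v; exact: maxu.
have xu0 : 0 < x u.
  rewrite lt_def x0 andbT; apply/eqP => xu; move: m1.
  rewrite /mass big1 => [/esym/eqP|v _]; first by rewrite oner_eq0.
  have -> : x v = 0 by apply/le_anti; rewrite x0 -xu maxu.
  by rewrite expr0n gtn_eqF // ltnW.
have form_ge : rho * mass k x <= k%:R * edge_form x by rewrite m1 mulr1 -radius.
have star_ge :
    rho * x u ^+ k <= \sum_(e in edges G | u \in e) \prod_(v in e) x v.
  by rewrite eig ler_wpM2r // exprn_ge0.
have [e0 [a [b [C [p [rk D]]]]]] := unicyclic_decomposition u k3 luG.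
have [/exists_inP[g gE /andP[ge0 ug]]|/exists_inPn star] :=
    boolP [exists g in edges G, (g != e0) && (u \notin g)].
  right; have [|shape form_le] := classify_bull k3 linG cE x0 xu0 maxu rho0 lamP
    rhoX form_ge star_ge D; first by exists g.
  split; last by move: form_le; rewrite m1 mulr1 -radius.
  have [e1 [a1 [b1 [C1 [p1 [rk1 [g1 [D1 g1E g1e ga star]]]]]]]] := shape.
  have [i [h [iE hE aC bC [ih ie he]]]] := dec_owners linG D1.
  apply: (bull_recognition k3 linG Gk D1 iE hE aC bC ih ie he _ cE g1E g1e ga star).
  by rewrite addn4.
left; have {}star e : e \in edges G -> e != e0 -> u \in e.
  by move=> eE ne; have := star e eE; rewrite ne /= negbK.
split.
  exists u => e f eE fE ue uf.
  have only e' : e' \in edges G -> u \notin e' -> e' = e0.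
    by move=> e'E; apply: contraNeq => /(star _ e'E).
  by rewrite (only e) // (only f).
have [i [h [iE hE aC bC [ih ie he]]]] := dec_owners linG D.
apply: (star_recognition k3 Gk D iE hE aC bC ih ie he _ cE star).
by rewrite addn4.
Qed.

Theorem theorem3p8 (R : realType) (k m : nat) (hk : (3 <= k)%N)
    (hm : (5 <= m)%N) (G : hypergraph) (hG : linear_unicyclic k m G) :
  is_second_maximum (linear_unicyclic_radii R k m) (spectral_radius R k G)
  <-> isomorphic G (power (T1 m) k).
Proof.
have k2 : (1 < k)%N by exact: ltnW.
have [n n0 mE] : exists2 n, (0 < n)%N & m = (n + 4)%N.
  by exists (m - 4)%N; rewrite ?subn_gt0 ?subnK // ltnW.
rewrite mE in hG *; have {}hm : (5 <= n + 4)%N by rewrite -mE.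
have [lam lamP] := bull_root_exists R n.
have lam0 : 0 < lam by have [? _] := lamP; lra.
pose rho := (lam ^+ 2) `^ (k%:R)^-1.
have rho0 : 0 < rho by rewrite powR_gt0 // exprn_gt0.
have rhoX : rho ^+ k = lam ^+ 2.
  rewrite -powR_mulrn ?powR_ge0 // -powRrM mulVf ?powRr1 ?exprn_ge0 ?(ltW lam0) //.
  by rewrite pnatr_eq0 -lt0n ltnW.
pose rad H := spectral_radius R k H.
have S_lu : linear_unicyclic k (n + 4) (power (S3 (n + 4)) k).
  by apply: power_S3_linear_unicyclic; rewrite // addn4.
have T_lu : linear_unicyclic k (n + 4) (power (T1 (n + 4)) k).
  by apply: power_T1_linear_unicyclic; rewrite // addn4.
have S_gt : rho < rad (power (S3 (n + 4)) k) by exact: power_S3_radius_gt lamP rho0 rhoX n0.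
have T_ge : rho <= rad (power (T1 (n + 4)) k) by exact: power_T1_radius_ge lamP rho0 rhoX.
have classify H : linear_unicyclic k (n + 4) H -> rho <= rad H ->
    rad H = rad (power (S3 (n + 4)) k) \/
    isomorphic H (power (T1 (n + 4)) k) /\ rad H <= rho.
  move=> luH leH; have [_ _ Hk _] := luH.
  have [[_ iso]|?] := large_radius_classification hk n0 luH lamP rho0 rhoX leH.
    by left; exact: spectral_radius_iso k2 Hk iso.
  by right.
have T_rho : rad (power (T1 (n + 4)) k) = rho.
  apply/le_anti; rewrite T_ge andbT.
  have [[star _]|[_ //]] := large_radius_classification hk n0 T_lu lamP rho0 rhoX T_ge.
  by have := power_T1_not_almost_star n0 star.
have below H : linear_unicyclic k (n + 4) H ->
    rad H = rad (power (S3 (n + 4)) k) \/ rad H <= rho.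
  move=> luH; have [le_rho|lt_rho] := lerP rho (rad H); last by right; exact: ltW.
  by have [|[_]] := classify H luH le_rho; [left|right].
have S_max : is_maximum (linear_unicyclic_radii R k (n + 4)) (rad (power (S3 (n + 4)) k)).
  split; first by exists (power (S3 (n + 4)) k).
  move=> _ [H luH ->]; have [|le_rho] := below H luH; first by rewrite /rad => ->.
  exact: le_trans le_rho (ltW S_gt).
split=> [[y y_max [[radG ney] ubG]]|iso].
  have yS : y = rad (power (S3 (n + 4)) k).
    by apply/le_anti; rewrite (S_max.2 _ y_max.1) (y_max.2 _ S_max.1).
  have le_rho : rho <= rad G.
    rewrite -T_rho; apply: ubG; split; first by exists (power (T1 (n + 4)) k).
    by rewrite /= yS; apply/eqP; rewrite T_rho lt_eqF.
  have [radS|[//]] := classify G hG le_rho.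
  by case: ney; rewrite yS.
have [_ _ Gk _] := hG.
have radG : spectral_radius R k G = rho by rewrite (spectral_radius_iso R k2 Gk iso).
exists (rad (power (S3 (n + 4)) k)) => //; split; first split.
- by exists G.
- by rewrite /= radG; apply/eqP; rewrite lt_eqF.
move=> _ [[H luH ->] neS]; rewrite radG.
by have [eqS|//] := below H luH; case: neS.
Qed.
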